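(* Let $R\in\mathcal{E}(\Omega)$. Then $R$ is moderate (resp. negligible) with respect to type $[\mathrm{A}_\mathrm{g}^\infty]$ if and only if it is moderate (resp. negligible) with respect to type $[\mathrm{A}_\mathrm{l}^\infty]$.
   Context: Notation: $\mathbb{N}=\{1,2,\dots\}$, $\mathbb{N}_0=\mathbb{N}\cup\{0\}$, $I=(0,1]$; $\Omega\subseteq\mathbb{R}^s$ open; $K\subset\subset\Omega$ means $K$ is a compact subset of $\Omega$. $\mathcal{D}(\Omega)$: compactly supported smooth functions with usual (LF) topology. $\mathcal{A}_0(\Omega)=\{\varphi\in\mathcal{D}(\Omega):\int\varphi=1\}$. $\langle\xi^\alpha,\varphi\rangle=\int\xi^\alpha\varphi(\xi)\,d\xi$. Smoothness is in the sense of convenient calculus (Kriegl–Michor): smooth curves are mapped to smooth curves. $S_\varepsilon\varphi(\xi)=\varepsilon^{-s}\varphi(\xi/\varepsilon)$, $T(\varphi,x)=(\varphi(\cdot-x),x)$, $U(\Omega)=T^{-1}(\mathcal{A}_0(\Omega)\times\Omega)$, and $\mathcal{E}(\Omega)=\mathcal{C}^\infty(U(\Omega))$ is the set of $R:U(\Omega)\to\mathbb{C}$ with $R\circ T^{-1}:\mathcal{A}_0(\Omega)\times\Omega\to\mathbb{C}$ smooth. All $O$-estimates are for $\varepsilon\to0$. Test objects are elements of $\mathcal{C}_b^\infty(I\times\Omega,\mathcal{A}_0(\mathbb{R}^s))$, the set of smooth $\phi:I\times\Omega\to\mathcal{A}_0(\mathbb{R}^s)$ such that for all $K\subset\subset\Omega$,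 $\alpha\in\mathbb{N}_0^s$ the set $\{\partial_x^\alpha\phi(\varepsilon,x):\varepsilon\in I,x\in K\}$ is bounded in $\mathcal{D}(\mathbb{R}^s)$. For $q\in\mathbb{N}$ and $K\subset\subset\Omega$ a test object $\phi$ is of type $[\mathrm{A}_\mathrm{l}^\infty]_{K,q}$ if $\sup_{x\in K}|\langle\xi^\alpha,\partial_x^\beta\phi(\varepsilon,x)\rangle|=O(\varepsilon^q)$ for all $\beta\in\mathbb{N}_0^s$ and all $\alpha\in\mathbb{N}_0^s$ with $1\le|\alpha|\le q$; it is of type $[\mathrm{A}_\mathrm{g}^\infty]_q$ if it is of type $[\mathrm{A}_\mathrm{l}^\infty]_{L,q}$ for every $L\subset\subset\Omega$. $R$ is moderate with respect to type $[\mathrm{A}_\mathrm{g}^\infty]$ (resp. $[\mathrm{A}_\mathrm{l}^\infty]$) if $\forall K\subset\subset\Omega\ \forall\alpha\in\mathbb{N}_0^s\ \exists N\in\mathbb{N}$: for all test objects $\phi$ of type $[\mathrm{A}_\mathrm{g}^\infty]_N$ (resp. $[\mathrm{A}_\mathrm{l}^\infty]_{K,N}$), $\sup_{x\in K}|\partial^\alpha(R(S_\varepsilon\phi(\varepsilon,x),x))|=O(\varepsilon^{-N})$. $R$ is negligible with respect to type $[\mathrm{A}_\mathrm{g}^\infty]$ (resp. $[\mathrm{A}_\mathrm{l}^\infty]$) if $\forall K\ \forall\alpha\ \forall n\in\mathbb{N}\ \exists q\in\mathbb{N}$: for all test objects $\phi$ of type $[\mathrm{A}_\mathrm{g}^\infty]_q$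 (resp. $[\mathrm{A}_\mathrm{l}^\infty]_{K,q}$), $\sup_{x\in K}|\partial^\alpha(R(S_\varepsilon\phi(\varepsilon,x),x))|=O(\varepsilon^{n})$. *)

(* Defs.v *)
From HB Require Import structures.
From mathcomp Require Import all_boot all_order all_algebra.
From mathcomp Require Import all_classical all_reals all_analysis.
From mathcomp Require Import complex.

Set Implicit Arguments.
Unset Strict Implicit.
Unset Printing Implicit Defensive.

Import Order.TTheory GRing.Theory Num.Theory.
Import numFieldNormedType.Exports.

Local Open Scope classical_set_scope.
Local Open Scope ring_scope.

(* [Rcomplex R] is the field of complex numbers seen as a real normed space
   (its norm is the modulus, with values in [R]), so that the real directional
   derivatives ['D_v f] make sense for complex-valued functions. *)
Section ComplexNormedModule.
Variable R : realType.

HB.instance Definition _ :=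
  PseudoMetric.copy (Rcomplex R) (pseudoMetric_normed (Rcomplex R)).
HB.instance Definition _ := isPointed.Build (Rcomplex R) 0.
HB.instance Definition _ :=
  NormedZmod_PseudoMetric_eq.Build R (Rcomplex R) erefl.

Fact Rcomplex_normrZ (k : R) (z : Rcomplex R) : `|k *: z| = `|k| * `|z|.
Proof.
case: z => a b.
change (Num.sqrt ((k * a) ^+ 2 + (k * b) ^+ 2)
        = `|k| * Num.sqrt (a ^+ 2 + b ^+ 2)).
by rewrite !exprMn -mulrDr sqrtrM ?sqr_ge0// sqrtr_sqr.
Qed.

HB.instance Definition _ :=
  PseudoMetricNormedZmod_Lmodule_isNormedModule.Build R (Rcomplex R)
    Rcomplex_normrZ.

End ComplexNormedModule.

Section PartialDerivatives.
Context {R : realType} {s : nat}.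
Local Notation E := 'rV[R]_s.
Local Notation C := (Rcomplex R).

Definition midx_deg (alpha : 'I_s -> nat) : nat := (\sum_i alpha i)%N.

(* The list of directions 0, ..., 0, 1, ..., 1, ... in which the index [i]
   occurs [alpha i] times. *)
Definition midx_dirs (alpha : 'I_s -> nat) : seq 'I_s :=
  flatten [seq nseq (alpha i) i | i <- enum 'I_s].

Definition partials (l : seq 'I_s) (f : E -> C) : E -> C :=
  foldr (fun i g => 'D_(delta_mx 0 i) g) f l.

Definition mpartial (alpha : 'I_s -> nat) (f : E -> C) : E -> C :=
  partials (midx_dirs alpha) f.

Definition smooth (f : E -> C) : Prop := forall l : seq 'I_s,
  continuous (partials l f) /\
  forall i x, derivable (partials l f) x (delta_mx 0 i).

Definition smooth_curve {W : normedModType R} (c : R -> W) : Prop :=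
  forall n t, derivable (derive1n n c) t 1.

End PartialDerivatives.

Section Integral.
Context {R : realType}.

(* The integral over R^s as an iterated Lebesgue integral; it is only applied
   to continuous functions with compact support. *)
Fixpoint rv_integral (s : nat) : ('rV[R]_s -> R) -> R :=
  match s return ('rV[R]_s -> R) -> R with
  | 0 => fun f => f 0
  | s'.+1 => fun f =>
      Rintegral (@lebesgue_measure R) setT
        (fun t : R => rv_integral
           (fun y : 'rV[R]_s' => f (row_mx (t%:M : 'rV[R]_1) y)))
  end.

Definition rv_cintegral (s : nat) (f : 'rV[R]_s -> Rcomplex R) : Rcomplex R :=
  (rv_integral (fun x => complex.Re (f x))
   +i* rv_integral (fun x => complex.Im (f x)))%C.

End Integral.

Section TestFunctions.
Context {R : realType} {s : nat}.
Local Notation E := 'rV[R]_s.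
Local Notation C := (Rcomplex R).
Local Notation fn := (E -> C).
Implicit Types (K Omega : set E) (W V B : set fn).

Definition test_functions_on K : set fn :=
  [set f | smooth f /\ forall x, ~ K x -> f x = 0].

(* D(Omega), its elements being extended by zero to R^s. *)
Definition test_functions Omega : set fn :=
  [set f | exists K, [/\ compact K, K `<=` Omega & test_functions_on K f]].

(* [W] contains a neighbourhood of 0 of the Frechet space D_K. *)
Definition Frechet_nbhs0 K W : Prop :=
  exists (m : nat) (d : R), 0 < d /\
    forall f, test_functions_on K f ->
      (forall alpha, (midx_deg alpha <= m)%N ->
         forall x, `|mpartial alpha f x| <= d) ->
      W f.

Definition balanced W : Prop :=
  forall (z : C) (f : fn), `|z| <= 1 -> W f -> W (fun x => z * f x).

(* The base of 0-neighbourhoods defining the (LF) topology, i.e. the locally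
   convex inductive limit of the D_K, K a compact subset of Omega. *)
Definition LF_base0 Omega W : Prop :=
  [/\ W `<=` test_functions Omega, convex_set W, balanced W &
      forall K, compact K -> K `<=` Omega -> Frechet_nbhs0 K W].

Definition LF_nbhs0 Omega : set_system fn :=
  [set V | exists2 W, LF_base0 Omega W & W `<=` V].

Definition LF_bounded Omega B : Prop :=
  B `<=` test_functions Omega /\
  forall V, LF_nbhs0 Omega V ->
    exists2 r : R, 0 < r & B `<=` [set r *: g | g in V].

(* Directional derivatives of D(Omega)-valued maps, the limit of the difference
   quotients being taken in the (LF) topology. *)
Definition is_LF_derive Omega {X : normedModType R}
    (f : X -> fn) (x v : X) (l : fn) : Prop :=
  test_functions Omega l /\
  forall V, LF_nbhs0 Omega V ->
    \forall h \near (0 : R)^', V (h^-1 *: (f (h *: v + x) - f x) - l).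

Definition LF_derive Omega {X : normedModType R}
    (f : X -> fn) (x v : X) : fn := get (is_LF_derive Omega f x v).

Definition LF_mpartial Omega (alpha : 'I_s -> nat) (f : E -> fn) : E -> fn :=
  foldr (fun i g x => LF_derive Omega g x (delta_mx 0 i)) f (midx_dirs alpha).

(* [d n] is the n-th derivative of the curve [c]. *)
Definition LF_smooth_curve Omega (c : R -> fn) : Prop :=
  exists d : nat -> R -> fn,
    d 0%N = c /\
    forall n t, test_functions Omega (d n t) /\
                is_LF_derive Omega (d n) t 1 (d n.+1 t).

Definition A0 Omega : set fn :=
  [set f | test_functions Omega f /\ rv_cintegral f = 1].

Definition monomial (alpha : 'I_s -> nat) (xi : E) : R :=
  \prod_i xi 0 i ^+ alpha i.

Definition moment (alpha : 'I_s -> nat) (f : fn) : C :=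
  rv_cintegral (fun xi => monomial alpha xi *: f xi).

Definition scaling (e : R) (f : fn) : fn :=
  fun xi => e ^- s *: f (e^-1 *: xi).

Definition translate (a : E) (f : fn) : fn := fun xi => f (xi - a).

End TestFunctions.

Section GeneralizedFunctions.
Context {R : realType} {s : nat}.
Local Notation E := 'rV[R]_s.
Local Notation C := (Rcomplex R).
Local Notation fn := (E -> C).
Implicit Types (K L Omega : set E) (phi : R -> E -> fn) (F : fn -> E -> C).

(* E(Omega). An element is given by a total function [F], of which only the
   values on U(Omega) = {(f, x) | translate x f \in A0 Omega, x \in Omega}
   are constrained. The composite of [F] with T^-1 (f, x) =
   (translate (- x) f, x) has to map smooth curves in A0 Omega * Omega to
   smooth curves. *)
Definition basic_space Omega F : Prop :=
  forall (c : R -> fn) (x : R -> E),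
    LF_smooth_curve Omega c -> (forall t, A0 Omega (c t)) ->
    smooth_curve x -> (forall t, Omega (x t)) ->
    smooth_curve (fun t => F (translate (- x t) (c t)) (x t)).

Definition unit_itv : set R := [set e | 0 < e <= 1].

Definition test_object Omega phi : Prop :=
  [/\ forall e x, unit_itv e -> Omega x -> A0 setT (phi e x),
      forall (e : R -> R) (x : R -> E),
        smooth_curve e -> (forall t, unit_itv (e t)) ->
        smooth_curve x -> (forall t, Omega (x t)) ->
        LF_smooth_curve setT (fun t => phi (e t) (x t)) &
      forall K alpha, compact K -> K `<=` Omega ->
        LF_bounded setT [set f | exists e x,
          [/\ unit_itv e, K x & f = LF_mpartial setT alpha (phi e) x]]].

(* sup_{x in K} |g e x| = O(b e) as e -> 0, e > 0. *)
Definition sup_bigO K (g : R -> E -> C) (b : R -> R) : Prop :=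
  exists M : R, \forall e \near (0 : R)^'+, forall x, K x -> `|g e x| <= M * b e.

Definition type_Al K (q : nat) phi : Prop :=
  forall alpha beta : 'I_s -> nat, (1 <= midx_deg alpha <= q)%N ->
    sup_bigO K (fun e x => moment alpha (LF_mpartial setT beta (phi e) x))
               (fun e => e ^+ q).

Definition type_Ag Omega (q : nat) phi : Prop :=
  forall L, compact L -> L `<=` Omega -> type_Al L q phi.

Definition composite F phi (e : R) : E -> C :=
  fun x => F (scaling e (phi e x)) x.

(* [ty K q phi] stands for "[phi] is of the type under consideration, with
   respect to [K] and of order [q]". *)
Definition moderate Omega (ty : set E -> nat -> (R -> E -> fn) -> Prop) F :=
  forall K, compact K -> K `<=` Omega -> forall alpha : 'I_s -> nat,
  exists2 N : nat, (1 <= N)%N &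
    forall phi, test_object Omega phi -> ty K N phi ->
      sup_bigO K (fun e => mpartial alpha (composite F phi e))
                 (fun e => e ^- N).

Definition negligible Omega (ty : set E -> nat -> (R -> E -> fn) -> Prop) F :=
  forall K, compact K -> K `<=` Omega -> forall alpha : 'I_s -> nat,
  forall n : nat, (1 <= n)%N ->
  exists2 q : nat, (1 <= q)%N &
    forall phi, test_object Omega phi -> ty K q phi ->
      sup_bigO K (fun e => mpartial alpha (composite F phi e))
                 (fun e => e ^+ n).

Definition moderate_Ag Omega := moderate Omega (fun _ => type_Ag Omega).
Definition moderate_Al Omega := moderate Omega type_Al.
Definition negligible_Ag Omega := negligible Omega (fun _ => type_Ag Omega).
Definition negligible_Al Omega := negligible Omega type_Al.

End GeneralizedFunctions.

(* Main.v *)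
From mathcomp Require Import all_boot all_order all_algebra.
From mathcomp Require Import all_classical all_reals all_analysis.
From mathcomp Require Import complex.
From mathcomp Require Import ring lra.
Require Import Defs.

Set Implicit Arguments.
Unset Strict Implicit.
Unset Printing Implicit Defensive.

Import Order.TTheory GRing.Theory Num.Theory.
Import numFieldNormedType.Exports.

Local Open Scope classical_set_scope.
Local Open Scope ring_scope.

(** A test object of type Ag of some order is of type Al of this order for every
compact K, so that an estimate for all test objects of type Al contains the one
for all test objects of type Ag. The converse is by contradiction. Suppose that
an estimate on K holds for all test objects of type Ag of order q, but fails for
a test object phi of type Al of order q + 2 on K. Then it fails at points
(eps_n, x_n) with x_n in K and eps_n tending to 0. The heart of the proof
([globalization]) is a test object psi of type Ag of order q such that, after
passing to a suitable sequence of such points, psi (eps_n) = phi (eps_n) near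
x_n for all n. As R (S_eps psi (eps, x), x) depends on the values of psi only,
its derivatives at x_n are those belonging to phi, and psi violates the estimate
as well.

The construction of psi. Let W (eps, x) be the vector of the moments of
phi (eps, x) of order 1 to q, that is, the deviation from vanishing moments.
Finitely many test functions g_i and a linear map P realize every such vector:
sum_i (W P)_i g_i has the moments W and integral 0 ([values_section],
[deviation_section]; the vector with integral 0 and moments W is a limit of the
moments of phi (eps, x) - phi (eps', x') for eps' -> 0 and x' in K). Put
  psi = phi + sum_i ((Lam - 1) W P)_i g_i,
whose moments are Lam * W, with a scalar function Lam (eps, x) supported in the
union of the sets |eps - eps_n| < eps_n / 4, |x - x_n| <= eta_n, and equal to 1
for eps = eps_n, |x - x_n| <= eta_n / 2. Outside of these sets the moments of
psi of order 1 to q vanish, so that psi is of type Ag as soon as Lam * W is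
O (eps^q) with all its derivatives on them.

Let eta_n = eps_n^(1/(n+1)). All derivatives of W are O (eps^(q+2)) at points of
K, and they are bounded on a neighbourhood of K; by Taylor's formula with
(q+2)(n+1) terms they are still O (eps^(q+2)) on the cube of radius eta_n around
x_n ([jet_cube_bound]). The derivatives of Lam of order at most n are
O (eta_n^(-n)), hence O (eps^(-1)), which costs one of the two extra powers of
eps; the other one absorbs the constants if eps_n is small enough depending on n
([cutoff_deviation_small]). For the derivatives of order l this leaves out the
finitely many n < l, whose sets stay away from eps = 0 ([localizer_deviation]).

To carry this out, phi (eps, .) must have iterated partial derivatives in the
space of test functions that can be taken in any order, whereas a test object is
only known to be smooth along smooth curves and to have bounded derivatives for
one fixed order of differentiation. This is [LF_partials_derive]. It rests on a
statement on scalar functions h (t, u): if all derivatives in t and the first two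
in u are bounded, then the mixed derivatives exist ([mixed_derivatives]). The second
difference of h in u with step B is O (B^2), its derivatives in t are bounded,
so these are O (B^(3/2)) by interpolation ([interpolation_small]), and the dyadic
difference quotients in u of the derivatives in t converge geometrically. All
constants depend on the bounds only, so that the result passes to maps with
values in the test functions ([LF_mixed_derivatives]). Moments commute with these
derivatives because they are continuous linear functionals on the test
functions ([moment_LF_continuous]). *)

(** * Complex norm and mean value estimates *)

Section ComplexNorm.
Variable R : realType.
Implicit Types z w : Rcomplex R.

Lemma normC_def z :
  `|z| = Num.sqrt (complex.Re z ^+ 2 + complex.Im z ^+ 2) :> R.
Proof. by case: z. Qed.

Lemma normCM z w : `|z * w : Rcomplex R| = `|z| * `|w| :> R.
Proof.
case: z => a b; case: w => c d.
rewrite [LHS]normC_def [`|(a +i* b)%C : Rcomplex R|]normC_def.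
rewrite [`|(c +i* d)%C : Rcomplex R|]normC_def /=.
by rewrite -sqrtrM ?addr_ge0 ?sqr_ge0//; congr Num.sqrt; ring.
Qed.

Lemma norm_Re z : `|complex.Re z| <= `|z|.
Proof.
rewrite normC_def -[`|complex.Re z|]sqrtr_sqr.
by rewrite ler_sqrt ?lerDl ?sqr_ge0// addr_ge0 ?sqr_ge0.
Qed.

Lemma norm_Im z : `|complex.Im z| <= `|z|.
Proof.
rewrite normC_def -[`|complex.Im z|]sqrtr_sqr.
by rewrite ler_sqrt ?lerDr ?sqr_ge0// addr_ge0 ?sqr_ge0.
Qed.

Lemma norm_ReIm z : `|z| <= `|complex.Re z| + `|complex.Im z|.
Proof.
rewrite normC_def -(@ler_pXn2r _ 2) ?nnegrE ?sqrtr_ge0 ?addr_ge0//.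
rewrite sqr_sqrtr ?addr_ge0 ?sqr_ge0// sqrrD !real_normK ?num_real//.
by rewrite [leRHS]addrAC lerDl mulrn_wge0// mulr_ge0.
Qed.

Lemma RcomplexZ (k : R) z : k *: z = (k%:C)%C * z.
Proof. by case: z => a b; apply/eqP; rewrite eq_complex /= !mul0r subr0 addr0 !eqxx. Qed.

Lemma scalerMC (k : R) z w : k *: (z * w) = (k *: z) * w.
Proof. by rewrite !RcomplexZ mulrA. Qed.

Lemma scalerMCr (k : R) z w : k *: (z * w) = z * (k *: w).
Proof. by rewrite !RcomplexZ mulrCA. Qed.

End ComplexNorm.

Section DeriveBound.
Variable R : realType.

(** The difference quotient multiplied out: in this form, estimates can be added
and passed to limits, and h = 0 is not an exception. *)
Lemma is_deriveP (V W : normedModType R) (f : V -> W) (x v : V) (l : W) :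
  is_derive x v f l <->
  forall e, 0 < e -> exists2 d, 0 < d & forall h : R, `|h| < d ->
    `|f (h *: v + x) - f x - h *: l| <= e * `|h|.
Proof.
split.
  case=> fd fl e e0.
  have /cvgrPdist_le/(_ e e0) : (fun h : R => h^-1 *: ((f \o shift x) (h *: v) - f x)) @ 0^' --> l.
    by rewrite -fl.
  rewrite near_withinE => /nbhs_ballP[d /= d0 H].
  exists d => // h hd.
  have [->|h0] := eqVneq h 0.
    by rewrite !scale0r add0r subrr subr0 !normr0 mulr0.
  have := H h; rewrite /ball/= sub0r normrN => /(_ hd h0).
  move=> {}H.
  have -> : f (h *: v + x) - f x - h *: l = - (h *: (l - h^-1 *: (f (h *: v + x) - f x))).
    by rewrite scalerBr scalerA divff// scale1r opprB.
  by rewrite normrN normrZ mulrC ler_wpM2r.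
move=> H.
have cv : (fun h : R => h^-1 *: ((f \o shift x) (h *: v) - f x)) @ 0^' --> l.
  apply/cvgrPdist_le => e e0.
  have [d d0 {}H] := H _ e0.
  rewrite near_withinE; apply/nbhs_ballP; exists d => //= h.
  rewrite /ball/= sub0r normrN => hd h0.
  have := H _ hd.
  have -> : f (h *: v + x) - f x - h *: l = - (h *: (l - h^-1 *: (f (h *: v + x) - f x))).
    by rewrite scalerBr scalerA divff// scale1r opprB.
  by rewrite normrN normrZ mulrC ler_pM2r// normr_gt0.
have fd : derivable f x v by apply/cvg_ex; exists l.
by split => //; apply/cvg_lim.
Qed.

Lemma is_derive_unique (V W : normedModType R) (f : V -> W) (x v : V) (l l' : W) :
  is_derive x v f l -> is_derive x v f l' -> l = l'.
Proof. by case=> _ <- [_ <-]. Qed.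

Lemma is_derive_local (V W : normedModType R) (f g : V -> W) (x v : V) (l : W) d :
  0 < d -> (forall h : R, `|h| < d -> f (h *: v + x) = g (h *: v + x)) ->
  is_derive x v f l -> is_derive x v g l.
Proof.
move=> d0 fg /is_deriveP H; apply/is_deriveP => e e0.
have [d' d'0 {}H] := H _ e0.
exists (Num.min d d'); first by rewrite lt_min d0.
move=> h; rewrite lt_min => /andP[hd hd'].
rewrite -fg//; have := fg 0; rewrite normr0 scale0r add0r => <- //.
exact: H.
Qed.

(** A quadratic error bound passes to pointwise limits, unlike the mere
existence of the derivative. *)
Lemma is_derive_quad (V W : normedModType R) (f : V -> W) (x v : V) (l : W) (C d : R) :
  0 < d -> (forall h : R, `|h| < d -> `|f (h *: v + x) - f x - h *: l| <= C * h ^+ 2) ->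
  is_derive x v f l.
Proof.
move=> d0 H; apply/is_deriveP => e e0.
have C0 : 0 < `|C| + 1 by rewrite ltr_wpDl.
exists (Num.min d (e / (`|C| + 1))); first by rewrite lt_min d0 divr_gt0.
move=> h; rewrite lt_min => /andP[hd he].
apply: le_trans (H _ hd) _.
rewrite -real_normK ?num_real// expr2 mulrA ler_wpM2r//.
apply: (@le_trans _ _ ((`|C| + 1) * `|h|)).
  by rewrite ler_wpM2r// (le_trans (ler_norm _))// lerDl.
by rewrite mulrC -ler_pdivlMr// ltW.
Qed.

Lemma is_derive_line (V W : normedModType R) (f : V -> W) (x v : V) (t : R) (l : W) :
  is_derive (t *: v + x) v f l <-> is_derive t 1 (fun s : R => f (s *: v + x)) l.
Proof.
have E (h : R) : (h *: (1 : R) + t) *: v + x = h *: v + (t *: v + x).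
  by rewrite [h *: 1]mulr1 scalerDl addrA.
split=> /is_deriveP H; apply/is_deriveP => e /H[d d0 {}H];
  by exists d => // h hd; have := H h hd; rewrite E.
Qed.

Lemma is_derive_Re (V : normedModType R) (f : V -> Rcomplex R) x v l :
  is_derive x v f l -> is_derive x v (fun y => complex.Re (f y)) (complex.Re l).
Proof.
move=> /is_deriveP H; apply/is_deriveP => e /H[d d0 {}H]; exists d => // h hd.
apply: le_trans (H _ hd); apply: le_trans (norm_Re _).
rewrite le_eqVlt; apply/orP; left; apply/eqP; congr (`| _ |).
by clear; case: (f _) (f x) l => [a b] [a' b'] [a'' b''].
Qed.

Lemma is_derive_Im (V : normedModType R) (f : V -> Rcomplex R) x v l :
  is_derive x v f l -> is_derive x v (fun y => complex.Im (f y)) (complex.Im l).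
Proof.
move=> /is_deriveP H; apply/is_deriveP => e /H[d d0 {}H]; exists d => // h hd.
apply: le_trans (H _ hd); apply: le_trans (norm_Im _).
rewrite le_eqVlt; apply/orP; left; apply/eqP; congr (`| _ |).
by clear; case: (f _) (f x) l => [a b] [a' b'] [a'' b''].
Qed.

Lemma real_mean_value (f f' : R -> R) (a b M : R) : a <= b ->
  (forall t, a <= t <= b -> is_derive t 1 f (f' t)) ->
  (forall t, a <= t <= b -> `|f' t| <= M) ->
  `|f b - f a| <= M * (b - a).
Proof.
move=> ab fd fM.
have [|c|c /[!in_itv]/= cab ->] := @MVT_segment R f f' a b ab.
- by move=> x; rewrite in_itv/= => /andP[/ltW xa /ltW xb]; apply: fd; rewrite xa xb.
- apply: derivable_within_continuous => x; rewrite in_itv/= => /fd[] //.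
by rewrite normrM [`|b - a|]ger0_norm ?subr_ge0// ler_wpM2r ?subr_ge0 ?fM.
Qed.

(** The real and the imaginary part are treated separately, whence the factor 2. *)
Lemma mean_value (f f' : R -> Rcomplex R) (a b M : R) : a <= b ->
  (forall t, a <= t <= b -> is_derive t 1 f (f' t)) ->
  (forall t, a <= t <= b -> `|f' t| <= M) ->
  `|f b - f a| <= 2 * M * (b - a).
Proof.
move=> ab fd fM.
apply: le_trans (norm_ReIm _) _.
have -> : 2 * M * (b - a) = M * (b - a) + M * (b - a) by ring.
have -> : complex.Re (f b - f a) = complex.Re (f b) - complex.Re (f a).
  by case: (f b) (f a) => [? ?] [? ?].
have -> : complex.Im (f b - f a) = complex.Im (f b) - complex.Im (f a).
  by case: (f b) (f a) => [? ?] [? ?].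
apply: lerD.
  apply: (@real_mean_value (fun t => complex.Re (f t)) (fun t => complex.Re (f' t))) => // t tab.
    exact/is_derive_Re/fd.
  exact: le_trans (norm_Re _) (fM _ tab).
apply: (@real_mean_value (fun t => complex.Im (f t)) (fun t => complex.Im (f' t))) => // t tab.
  exact/is_derive_Im/fd.
exact: le_trans (norm_Im _) (fM _ tab).
Qed.

Lemma mean_value_seg (f f' : R -> Rcomplex R) (a b M : R) :
  (forall t : R, Num.min a b <= t <= Num.max a b -> is_derive t 1 f (f' t)) ->
  (forall t : R, Num.min a b <= t <= Num.max a b -> `|f' t| <= M) ->
  `|f b - f a| <= 2 * M * `|b - a|.
Proof.
wlog ab : a b / a <= b.
  move=> W; have [ab|/ltW ba] := leP a b; first by have := W _ _ ab; rewrite (min_idPl ab) (max_idPr ab).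
  by rewrite distrC [X in _ * X]distrC => fd fM; apply: W => // t; rewrite (min_idPl ba) (max_idPr ba) => ?; [apply: fd|apply: fM].
rewrite (min_idPl ab) (max_idPr ab) => fd fM.
rewrite [X in _ * X]ger0_norm ?subr_ge0//.
exact: (@mean_value f f').
Qed.

Lemma seg_ball (a b r t : R) : `|a| < r -> `|b| < r ->
  Num.min a b <= t <= Num.max a b -> `|t| < r.
Proof.
rewrite !ltr_norml => /andP[? ?] /andP[? ?] /andP[].
by case: (leP a b) => ? ? ?; apply/andP; split; lra.
Qed.

Lemma mean_value_ball (f f' : R -> Rcomplex R) (r a b M : R) :
  `|a| < r -> `|b| < r ->
  (forall t : R, `|t| < r -> is_derive t 1 f (f' t)) ->
  (forall t : R, `|t| < r -> `|f' t| <= M) ->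
  `|f b - f a| <= 2 * M * `|b - a|.
Proof.
move=> ar br fd fM.
by apply: (@mean_value_seg f f') => t /(seg_ball ar br); [exact: fd|exact: fM].
Qed.

(** The mean value inequality for s |-> f s - s *: f1 t, whose derivative
f1 s - f1 t is in turn estimated by the mean value inequality. *)
Lemma taylor1_ball (f f1 f2 : R -> Rcomplex R) (r t a M : R) :
  `|t| < r -> `|a| < r ->
  (forall t : R, `|t| < r -> is_derive t 1 f (f1 t)) ->
  (forall t : R, `|t| < r -> is_derive t 1 f1 (f2 t)) ->
  (forall t : R, `|t| < r -> `|f2 t| <= M) ->
  `|f a - f t - (a - t) *: f1 t| <= 4 * M * (a - t) ^+ 2.
Proof.
move=> tr ar fd f1d f2M.
have gd u : Num.min t a <= u <= Num.max t a ->
    is_derive u 1 (fun s => f s - s *: f1 t) (f1 u - f1 t).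
  move=> /(seg_ball tr ar) ur.
  have H1 := fd _ ur.
  have H2 : is_derive u 1 (fun s : R => s *: f1 t) (f1 t).
    apply: (@is_derive_quad _ _ _ _ _ _ 0 1) => // h _.
    by rewrite [h *: 1]mulr1 scalerDl addrK subrr normr0 mul0r.
  by have := is_deriveB H1 H2; apply: is_derive_local ltr01 _ => h _; rewrite fctE.
have := mean_value_seg (M := 2 * M * `|a - t|) gd.
have -> : f a - a *: f1 t - (f t - t *: f1 t) = f a - f t - (a - t) *: f1 t.
  by rewrite scalerBl !opprB [t *: f1 t - f t]addrC addrACA [- _ + _]addrC.
have -> : 2 * (2 * M * `|a - t|) * `|a - t| = 4 * M * (a - t) ^+ 2.
  by rewrite -[(a - t) ^+ 2]real_normK ?num_real//; ring.
apply=> u tua.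
have ur := seg_ball tr ar tua.
have M0 : 0 <= M by apply: le_trans (f2M _ tr).
apply: le_trans (mean_value_ball tr ur f1d f2M) _.
rewrite ler_wpM2l ?mulr_ge0//.
by move: tua => /andP[]; case: (leP t a) => ta ? ?;
  [rewrite (@ger0_norm _ (u - t)) ?(@ger0_norm _ (a - t))|rewrite (@ler0_norm _ (u - t)) ?(@ler0_norm _ (a - t))]; lra.
Qed.

End DeriveBound.

(** * Interpolation between derivatives *)

Section Interpolation.
Variable R : realType.
Local Notation C := (Rcomplex R).

(** Sequences of successive derivatives are used instead of the operator
[derive1n], as they are only needed, and only known, on an interval. *)
Definition derivative_chain (r : R) (f : nat -> R -> C) : Prop :=
  forall n (t : R), `|t| < r -> is_derive t 1 (f n) (f n.+1 t).

(** Taylor's formula at a point s with |s - t| = h, solved for f1 t. *)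
Lemma landau_inequality (f f1 f2 : R -> C) (r t a b h : R) :
  `|t| < r -> 0 < h < r ->
  (forall t : R, `|t| < r -> is_derive t 1 f (f1 t)) ->
  (forall t : R, `|t| < r -> is_derive t 1 f1 (f2 t)) ->
  (forall t : R, `|t| < r -> `|f t| <= a) ->
  (forall t : R, `|t| < r -> `|f2 t| <= b) ->
  h * `|f1 t| <= 2 * a + 4 * b * h ^+ 2.
Proof.
move=> tr /andP[h0 hr] fd f1d fa f2b.
have [s sr sh] : exists2 s : R, `|s| < r & `|s - t| = h.
  move: tr; rewrite ltr_norml => /andP[? ?].
  have [t0|t0] := leP 0 t.
    exists (t - h); first by rewrite ltr_norml; apply/andP; split; lra.
    by rewrite ler0_norm; lra.
  exists (t + h); first by rewrite ltr_norml; apply/andP; split; lra.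
  by rewrite ger0_norm; lra.
have := taylor1_ball tr sr fd f1d f2b.
rewrite -[(s - t) ^+ 2]real_normK ?num_real// sh => T.
have -> : h * `|f1 t| = `|(s - t) *: f1 t| by rewrite normrZ sh.
have -> : (s - t) *: f1 t = (f s - f t) - (f s - f t - (s - t) *: f1 t) by rewrite subKr.
apply: le_trans (ler_normB _ _) _; apply: lerD => //.
apply: le_trans (ler_normB _ _) _.
by rewrite mulr2n mulrDl mul1r lerD ?fa.
Qed.

(** The intermediate derivatives are controlled by the extreme ones at every
scale h. This is the iterated form of Landau's inequality; in the induction, the
supremum of the highest intermediate derivative is absorbed in the left-hand
side. *)
Lemma interpolation N : exists C c : R, [/\ 1 <= C, 0 < c <= 1 &
  forall (f : nat -> R -> Rcomplex R) (r a b h : R) (B : nat -> R),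
    derivative_chain r f -> 
    (forall n t, `|t| < r -> `|f n t| <= B n) ->
    (forall t, `|t| < r -> `|f 0%N t| <= a) ->
    (forall t, `|t| < r -> `|f N.+1 t| <= b) ->
    0 < h < c * r -> 
    forall n t, (n <= N.+1)%N -> `|t| < r -> 
      h ^+ n * `|f n t| <= C * (a + b * h ^+ N.+1)].
Proof.
elim: N => [|N [C [c [C1 /andP[c0 c1] IH]]]].
  exists 1, 1; split; rewrite ?lexx ?ltr01//.
  move=> f r a b h B _ _ fa fb /andP[h0 hr] n t n1 tr; rewrite mul1r expr1.
  have a0 : 0 <= a by apply: le_trans (fa _ tr).
  have b0 : 0 <= b by apply: le_trans (fb _ tr).
  case: n n1 => [|[|//]] _; rewrite ?expr0 ?mul1r ?expr1.
    by rewrite (le_trans (fa _ tr))// lerDl mulr_ge0// ltW.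
  by rewrite mulrC (@le_trans _ _ (b * h))// ?lerDr// ler_wpM2r ?fb// ltW.
have C0 : 0 < C by rewrite (lt_le_trans ltr01).
have CC : 1 <= C * C by rewrite -[1]mul1r ler_pM.
exists (32 * C ^+ 2), (Num.min c (4 * C)^-1); split.
- by rewrite expr2; lra.
- by rewrite lt_min c0 invr_gt0 mulr_gt0//= ge_min c1.
move=> f r a b h B ch fB fa fb /andP[h0 hr] n t nN tr.
have r0 : 0 < r by rewrite (le_lt_trans _ tr).
have a0 : 0 <= a by apply: le_trans (fa _ tr).
have b0 : 0 <= b by apply: le_trans (fb _ tr).
have hc : 0 < h < c * r by rewrite h0 (lt_le_trans hr)// ler_wpM2r ?(ltW r0)// ge_min lexx.
have hC : 0 < 4 * C * h < r.
  rewrite !mulr_gt0//= -ltr_pdivlMl ?mulr_gt0//.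
  by rewrite (lt_le_trans hr)// ler_wpM2r ?(ltW r0)// ge_min lexx orbT.
(* The bounds B ensure that the supremum S of f N.+1 is finite. Landau's
   inequality with the step 4 * C * h bounds it by S / 2 and known terms. *)
pose A := [set x | exists2 t : R, `|t| < r & x = `|f N.+1 t|].
have A0 : A !=set0 by exists `|f N.+1 t|, t.
have Aub : ubound A (B N.+1) by move=> _ [u ur ->]; exact: fB.
set S := sup A.
have HS u : `|u| < r -> `|f N.+1 u| <= S.
  by move=> ur; apply: ub_le_sup; [exists (B N.+1)|exists u].
have IH' := IH f r a S h B ch fB fa HS hc.
have hN m : 0 < h ^+ m by rewrite exprn_gt0.
have SS : S * h ^+ N.+1 <= a + 32 * C * b * h ^+ N.+2.
  have : S <= a / (2 * h ^+ N.+1) + S / 2 + 16 * C * b * h.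
    apply: sup_le_ub => // _ [u ur ->].
    have HN : forall u, `|u| < r -> `|f N u| <= C * (a + S * h ^+ N.+1) / h ^+ N.
      by move=> v vr; rewrite ler_pdivlMr// mulrC IH'// ltnW.
    have := landau_inequality ur hC (ch N) (ch N.+1) HN fb.
    rewrite -ler_pdivlMl ?mulr_gt0// => /le_trans; apply.
    rewrite le_eqVlt; apply/orP; left; apply/eqP.
    rewrite (exprS _ N); field.
    by rewrite !gt_eqF.
  rewrite -subr_ge0 => H.
  have : 0 <= (a / (2 * h ^+ N.+1) + S / 2 + 16 * C * b * h - S) * (2 * h ^+ N.+1).
    by rewrite mulr_ge0// mulr_ge0// ltW.
  have -> : (a / (2 * h ^+ N.+1) + S / 2 + 16 * C * b * h - S) * (2 * h ^+ N.+1) =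
     a + 32 * C * b * h ^+ N.+2 - S * h ^+ N.+1.
    rewrite (exprS _ N.+1); field; by rewrite gt_eqF.
  by rewrite subr_ge0.
have S0 : 0 <= S by apply: le_trans (HS _ tr).
have bh m : 0 <= b * h ^+ m by rewrite mulr_ge0// ltW.
move: nN; rewrite leq_eqVlt => /predU1P[->|nN].
  rewrite mulrC.
  apply: (@le_trans _ _ (1 * (b * h ^+ N.+2))); first by rewrite mul1r ler_wpM2r ?fb// ltW.
  by rewrite ler_pM//; [rewrite expr2; lra|rewrite lerDr].
apply: le_trans (IH' n t nN tr) _.
apply: (@le_trans _ _ (C * (a + (a + 32 * C * b * h ^+ N.+2)))).
  by rewrite ler_wpM2l ?(ltW C0)// lerD2l.
rewrite -subr_ge0.
have -> : 32 * C ^+ 2 * (a + b * h ^+ N.+2) - C * (a + (a + 32 * C * b * h ^+ N.+2)) =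
  2 * C * (16 * C - 1) * a by ring.
by rewrite !mulr_ge0// ?(ltW C0)//; lra.
Qed.

(** In the interpolation inequality of order 4n + 4 for the derivative of order
n + 1, the step h = k * B^(1/(2n+2)) makes both terms on the right of order B^2,
while h^(n+1) is of order B^(1/2). The exponent 3/2 could be any number below 2;
what matters is that it exceeds 1. *)
Lemma interpolation_small (r a : R) (b : nat -> R) n : 0 < r ->
  exists2 E, 0 <= E & forall (f : nat -> R -> C) (B : R), 0 < B <= 1 ->
    derivative_chain r f ->
    (forall t, `|t| < r -> `|f 0%N t| <= a * B ^+ 2) ->
    (forall m t, `|t| < r -> `|f m t| <= b m) ->
    forall t, `|t| < r -> `|f n t| <= E * (B * Num.sqrt B).
Proof.
move=> r0; case: n => [|n].
  exists `|a| => // f B /andP[B0 B1] _ fa _ t tr.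
  apply: le_trans (fa _ tr) _.
  have s0 : 0 <= Num.sqrt B by rewrite sqrtr_ge0.
  have s1 : Num.sqrt B <= 1 by rewrite -[leRHS]sqrtr1 ler_sqrt.
  have -> : a * B ^+ 2 = (a * Num.sqrt B) * (B * Num.sqrt B).
    by rewrite mulrACA -expr2 sqr_sqrtr ?ltW// -mulrA -expr2.
  rewrite ler_wpM2r ?mulr_ge0 ?(ltW B0)//.
  by rewrite (le_trans (ler_norm _))// normrM [`|Num.sqrt B|]ger0_norm// ler_piMr.
have [C [c [C1 /andP[c0 c1] H]]] := interpolation (4 * n + 3).
pose k := c * r / 2.
have k0 : 0 < k by rewrite /k divr_gt0// mulr_gt0.
exists (C * (`|a| + `|b (4 * n + 4)%N| * k ^+ (4 * n + 4)) / k ^+ n.+1).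
  apply: divr_ge0; last exact/exprn_ge0/ltW.
  apply: mulr_ge0; first exact: le_trans C1.
  by apply: addr_ge0 => //; apply: mulr_ge0 => //; exact/exprn_ge0/ltW.
move=> f B /andP[B0 B1] ch fa fb t tr.
pose s := Num.sqrt B.
have s0 : 0 < s by rewrite sqrtr_gt0.
have s1 : s <= 1 by rewrite -[leRHS]sqrtr1 ler_sqrt.
pose be := s `^ n.+1%:R^-1.
have ben : be ^+ n.+1 = s.
  by rewrite -powR_mulrn ?powR_ge0// -powRrM mulVf ?pnatr_eq0// powRr1// ltW.
have be0 : 0 < be by rewrite powR_gt0.
have be1 : be <= 1.
  by rewrite -(@expr_le1 _ n.+1) ?ben// ltW.
have hh : 0 < k * be < c * r.
  rewrite mulr_gt0//= (@le_lt_trans _ _ (k * 1))// ?ler_pM2l// mulr1 /k.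
  by rewrite ltr_pdivrMr// ltr_pMr ?mulr_gt0// ltr1n.
have N4 : (4 * n + 3).+1 = (4 * n + 4)%N by rewrite -addnS.
have E4 : be ^+ (4 * n + 4) = B ^+ 2.
  have -> : (4 * n + 4 = n.+1 * 4)%N by rewrite mulnC mulSn addnC.
  by rewrite exprM ben (exprM _ 2 2) sqr_sqrtr// ltW.
have := H f r (a * B ^+ 2) (b (4 * n + 4)%N) (k * be) b ch fb fa _ hh n.+1 t _ tr.
rewrite N4 => /(_ (fb _)) => X.
have le4 : (n.+1 <= 4 * n + 4)%N by rewrite addnS ltnS (leq_trans (leq_pmull n _) (leq_addr _ _)).
have {X} := X le4.
rewrite !(exprMn _ k be) ben E4.
rewrite -ler_pdivlMl ?mulr_gt0 ?exprn_gt0// => /le_trans; apply.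
rewrite -/s; have -> : C * (`|a| + `|b (4 * n + 4)%N| * k ^+ (4 * n + 4)) / k ^+ n.+1 * (B * s) =
  (k ^+ n.+1 * s)^-1 * (C * (`|a| * B ^+ 2 + `|b (4 * n + 4)%N| * (k ^+ (4 * n + 4) * B ^+ 2))).
  have -> : B = s ^+ 2 by rewrite sqr_sqrtr// ltW.
  field; by rewrite !gt_eqF// exprn_gt0.
rewrite ler_wpM2l ?invr_ge0 ?mulr_ge0 ?exprn_ge0 ?(ltW k0) ?(ltW s0)//.
rewrite ler_wpM2l ?(le_trans ler01)// lerD//.
  by rewrite ler_wpM2r ?exprn_ge0 ?(ltW B0)// ler_norm.
by rewrite ler_wpM2r ?mulr_ge0 ?exprn_ge0 ?(ltW B0) ?(ltW k0)// ler_norm.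
Qed.

End Interpolation.

(** * Mixed derivatives of functions of two variables *)

Section MixedQuotient.
Variable R : realType.
Local Notation C := (Rcomplex R).

Lemma exists_expr_lt (q e : R) : 0 <= q < 1 -> 0 < e -> exists n, q ^+ n < e.
Proof.
move=> /andP[q0 q1] e0.
have := @cvg_expr R q; rewrite ger0_norm// => /(_ q1) /cvgrPdist_lt/(_ _ e0) [n _ /(_ n (leqnn n))].
by rewrite /= sub0r normrN ger0_norm ?exprn_ge0// => ?; exists n.
Qed.

(** Error terms of a geometric approximation may be dropped in inequalities. *)
Lemma le_geo (x y D : R) : (forall j, x <= y + D * (3 / 4) ^+ j) -> x <= y.
Proof.
move=> H; rewrite leNgt; apply/negP => yx.
have D0 : 0 < `|D| + 1 by rewrite ltr_wpDl.
have q01 : 0 <= (3 / 4 : R) < 1 by lra.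
have [j] := exists_expr_lt q01 (divr_gt0 (etrans (subr_gt0 _ _) yx) D0).
rewrite ltr_pdivlMr// => Hj; have := H j; apply/negP; rewrite -ltNge -ltrBrDl.
apply: le_lt_trans Hj; rewrite mulrC ler_wpM2l ?exprn_ge0 ?divr_ge0//.
by rewrite (le_trans (ler_norm _))// lerDl.
Qed.

Lemma real_geo_lim (z : nat -> R) (D : R) :
  (forall j, `|z j.+1 - z j| <= D * (3 / 4) ^+ j) ->
  exists l, forall j, `|z j - l| <= 4 * D * (3 / 4) ^+ j.
Proof.
move=> zD.
have q0 : (0 : R) <= 3 / 4 by lra.
have dist i k : `|z (i + k)%N - z i| <= 4 * D * (3 / 4) ^+ i * (1 - (3 / 4) ^+ k).
  elim: k => [|k IH]; first by rewrite addn0 subrr normr0 expr0 subrr mulr0.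
  have -> : z (i + k.+1)%N - z i = (z (i + k).+1 - z (i + k)%N) + (z (i + k)%N - z i).
    by rewrite addrA subrK addnS.
  apply: le_trans (ler_normD _ _) _.
  have -> : 4 * D * (3 / 4) ^+ i * (1 - (3 / 4) ^+ k.+1) =
    D * (3 / 4) ^+ (i + k) + 4 * D * (3 / 4) ^+ i * (1 - (3 / 4) ^+ k).
    by rewrite exprD exprS; field.
  exact: lerD.
have D0 : 0 <= D by have := zD 0%N; rewrite expr0 mulr1; exact: le_trans.
have dist' i k : `|z (i + k)%N - z i| <= 4 * D * (3 / 4) ^+ i.
  apply: le_trans (dist _ _) _; apply: ler_piMr.
    by rewrite !mulr_ge0// exprn_ge0.
  by rewrite gerBl exprn_ge0.
have cz : cvgn z.
  apply: cauchy_cvg; apply/cauchy_exP => e e0.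
  have e4 : 0 < e / (4 * D + 1) by rewrite divr_gt0// ltr_wpDl// mulr_ge0.
  have q01 : 0 <= (3 / 4 : R) < 1 by rewrite q0/=; lra.
  have [n hn] := exists_expr_lt q01 e4.
  exists (z n); exists n => // m /= nm.
  rewrite /ball/= distrC -(subnKC nm).
  apply: le_lt_trans (dist' _ _) _.
  rewrite ltr_pdivlMr ?ltr_wpDl ?mulr_ge0// in hn.
  by apply: le_lt_trans hn; rewrite mulrC ler_wpM2l ?exprn_ge0// lerDl.
exists (limn z) => j.
have cj : (fun k => `|z (k + j)%N - z j|) @ \oo --> `|limn z - z j|.
  apply: cvg_norm; apply: cvgB; last exact: cvg_cst.
  by rewrite cvg_shiftn.
rewrite distrC -(cvg_lim _ cj)//.
apply: limr_le; first by apply/cvg_ex; eexists; exact: cj.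
by near=> k; rewrite addnC dist'.
Unshelve. all: by end_near. Qed.

Lemma geo_lim (z : nat -> C) (D : R) :
  (forall j, `|z j.+1 - z j| <= D * (3 / 4) ^+ j) ->
  exists l, forall j, `|z j - l| <= 8 * D * (3 / 4) ^+ j.
Proof.
move=> zD.
have [a|a Ha] := @real_geo_lim (fun j => complex.Re (z j)) D.
  apply: le_trans (zD a); apply: le_trans (norm_Re _).
  by case: (z a) (z a.+1) => ? ? [].
have [b|b Hb] := @real_geo_lim (fun j => complex.Im (z j)) D.
  apply: le_trans (zD b); apply: le_trans (norm_Im _).
  by case: (z b) (z b.+1) => ? ? [].
exists (a +i* b)%C => j; apply: le_trans (norm_ReIm _) _.
have -> : 8 * D * (3 / 4) ^+ j = 4 * D * (3 / 4) ^+ j + 4 * D * (3 / 4) ^+ j by ring.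
have /= := lerD (Ha j) (Hb j).
by case: (z j) => p q /=; apply: le_trans.
Qed.

(** The ratio 3/4 of all the geometric sequences comes from here: it is a
rational number above 2^(-1/2). *)
Lemma sqrt_half (B : R) j : 0 <= B ->
  Num.sqrt (B / 2 ^+ j) <= Num.sqrt B * (3 / 4) ^+ j.
Proof.
move=> B0.
have q0 : (0 : R) <= (3 / 4) ^+ j by rewrite exprn_ge0// divr_ge0.
have -> : Num.sqrt B * (3 / 4) ^+ j = Num.sqrt (B * ((3 / 4) ^+ j) ^+ 2).
  by rewrite sqrtrM// sqrtr_sqr ger0_norm.
rewrite ler_sqrt ?mulr_ge0 ?exprn_ge0//.
rewrite ler_wpM2l// -exprM mulnC exprM -exprVn.
by apply: lerXn2r; rewrite ?nnegrE ?exprn_ge0 ?divr_ge0 ?invr_ge0//; lra.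
Qed.

(** Here h n is the n-th derivative in t of h 0, and g1 and g2 are the first two
derivatives of h 0 in u. *)
Definition mixed_data (r : R) (A : nat -> R) (A' : R)
    (h : nat -> R -> R -> C) (g1 g2 : R -> R -> C) : Prop :=
  [/\ forall n (t u : R), `|t| < r -> `|u| < r ->
        is_derive t 1 (fun t => h n t u) (h n.+1 t u),
      forall t u : R, `|t| < r -> `|u| < r -> is_derive u 1 (h 0%N t) (g1 t u),
      forall t u : R, `|t| < r -> `|u| < r -> is_derive u 1 (g1 t) (g2 t u),
      forall n (t u : R), `|t| < r -> `|u| < r -> `|h n t u| <= A n &
      forall t u : R, `|t| < r -> `|u| < r -> `|g2 t u| <= A'].

Section Data.
Variables (r : R) (A : nat -> R) (A' : R).
Hypothesis r01 : 0 < r <= 1.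
Let r0 : 0 < r. Proof. by case/andP: r01. Qed.
Let r1 : r <= 1. Proof. by case/andP: r01. Qed.

Let half_lt (B : R) j : `|B| < r -> `|B / 2 ^+ j| < r.
Proof.
move=> Br; rewrite normrM normfV [`|2 ^+ j|]ger0_norm ?exprn_ge0//.
apply: le_lt_trans Br; rewrite ler_pdivrMr ?exprn_gt0// ler_peMr//.
by rewrite exprn_ege1// ler1n.
Qed.

(** The pure second difference in u is of order B^2, and all its derivatives
in t are bounded, so that they are of order B^(3/2) by interpolation. *)
Lemma mixed_second_difference n : exists E, 0 <= E /\
  forall h g1 g2, mixed_data r A A' h g1 g2 ->
  forall t B : R, `|t| < r -> `|B| < r ->
  `|h n t B - h n t (B / 2) *+ 2 + h n t 0| <= E * (`|B| * Num.sqrt `|B|).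
Proof.
have [E E0 H] := interpolation_small (6 * A') (fun m => 4 * A m) n r0.
exists E; split=> // h g1 g2 [ht h1 h2 hA gA] t B tr Br.
have zr : `|0 : R| < r by rewrite normr0.
have B2r : `|B / 2| < r by have := half_lt 1 Br; rewrite expr1.
have [->|B0] := eqVneq B 0.
  by rewrite mul0r normr0 mul0r mulr0 addrAC mulr2n subrr normr0.
have nB : 0 < `|B| by rewrite normr_gt0.
apply: (H (fun n t => h n t B - h n t (B / 2) *+ 2 + h n t 0)) => //.
- by rewrite nB (le_trans (ltW Br)).
- move=> m u ur.
  have D1 := ht m u B ur Br; have D2 := ht m u (B / 2) ur B2r.
  have D3 := ht m u 0 ur zr.
  have := is_deriveD (is_deriveB D1 (is_deriveD D2 D2)) D3.
  rewrite -!mulr2n; apply: is_derive_local ltr01 _ => k _.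
  by rewrite !fctE mulr2n.
- move=> u ur.
  have T1 := taylor1_ball zr Br (h1 u ^~ ur) (h2 u ^~ ur) (gA u ^~ ur).
  have T2 := taylor1_ball zr B2r (h1 u ^~ ur) (h2 u ^~ ur) (gA u ^~ ur).
  rewrite !subr0 in T1 T2.
  have -> : h 0%N u B - h 0%N u (B / 2) *+ 2 + h 0%N u 0 =
    (h 0%N u B - h 0%N u 0 - B *: g1 u 0) -
    (h 0%N u (B / 2) - h 0%N u 0 - (B / 2) *: g1 u 0) *+ 2.
    have -> : B *: g1 u 0 = (B / 2) *: g1 u 0 *+ 2.
      by rewrite scalerMnl -mulr_natr divfK ?pnatr_eq0.
    ring.
  apply: le_trans (ler_normB _ _) _; rewrite mulr2n.
  apply: le_trans (lerD T1 (le_trans (ler_normD _ _) (lerD T2 T2))) _.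
  rewrite real_normK ?num_real//.
  by rewrite le_eqVlt; apply/orP; left; apply/eqP; field.
- move=> m u ur.
  apply: le_trans (ler_normD _ _) _.
  have -> : 4 * A m = (A m + (A m + A m)) + A m by ring.
  apply: lerD; last exact: hA.
  apply: le_trans (ler_normB _ _) _; apply: lerD; first exact: hA.
  by rewrite mulr2n; apply: le_trans (ler_normD _ _) _; apply: lerD; exact: hA.
Qed.

(** Taylor's formula, with its bound independent of j, passes to the limit. *)
Lemma geo_chain_limit (q : nat -> nat -> R -> C) (v : nat -> R -> C)
    (D b : nat -> R) :
  (forall j, derivative_chain r (q j)) ->
  (forall n j (t : R), `|t| < r -> `|q j n t - v n t| <= D n * (3 / 4) ^+ j) ->
  (forall n j (t : R), `|t| < r -> `|q j n t| <= b n) ->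
  forall n (t a : R), `|t| < r -> `|a| < r ->
    `|v n a - v n t - (a - t) *: v n.+1 t| <= 4 * b n.+2 * (a - t) ^+ 2.
Proof.
move=> qc qv qb n t a tr ar.
apply: (@le_geo _ _ (D n + D n + `|a - t| * D n.+1)) => j.
have T := taylor1_ball tr ar (qc j n) (qc j n.+1) (qb n.+2 j).
have -> : v n a - v n t - (a - t) *: v n.+1 t =
  (q j n a - q j n t - (a - t) *: q j n.+1 t)
  - ((q j n a - v n a) - (q j n t - v n t) - (a - t) *: (q j n.+1 t - v n.+1 t)).
  rewrite scalerBr; ring.
apply: le_trans (ler_normB _ _) _; apply: lerD => //.
rewrite (mulrDl (D n + D n)) (mulrDl (D n)); apply: le_trans (ler_normB _ _) _; apply: lerD.
  by apply: le_trans (ler_normB _ _) _; apply: lerD; exact: qv.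
by rewrite normrZ -mulrA ler_wpM2l// qv.
Qed.

Lemma derivative_chain_unique (v w : nat -> R -> C) :
  derivative_chain r v -> derivative_chain r w ->
  (forall t, `|t| < r -> v 0%N t = w 0%N t) ->
  forall n t, `|t| < r -> v n t = w n t.
Proof.
move=> vc wc vw; elim=> // n IH t tr.
apply: is_derive_unique (vc n t tr) _.
have d0 : 0 < r - `|t| by rewrite subr_gt0.
apply: is_derive_local d0 _ (wc n t tr) => k kd; rewrite IH//.
by rewrite [k *: _]mulr1 (le_lt_trans (ler_normD _ _))// -ltrBrDr.
Qed.

Lemma quad_chain (v : nat -> R -> C) (K : nat -> R) :
  (forall n (t a : R), `|t| < r -> `|a| < r ->
    `|v n a - v n t - (a - t) *: v n.+1 t| <= K n * (a - t) ^+ 2) ->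
  derivative_chain r v.
Proof.
move=> H n t tr; have d0 : 0 < r - `|t| by rewrite subr_gt0.
apply: is_derive_quad d0 _ => k kd; rewrite [k *: 1]mulr1.
have := H n t (k + t) tr; rewrite addrK; apply.
by rewrite (le_lt_trans (ler_normD _ _))// -ltrBrDr.
Qed.

(** Existence of the mixed derivatives v n from bounds on the pure ones. The limits
of the dyadic difference quotients do not depend on the initial step because
they are the successive derivatives of the same function g1 (., 0). *)
Lemma mixed_derivatives : exists E : nat -> R, forall h g1 g2,
  mixed_data r A A' h g1 g2 -> exists v : nat -> R -> C,
  [/\ forall t, `|t| < r -> v 0%N t = g1 t 0,
      forall n (t B : R), `|t| < r -> `|B| < r ->
        `|h n t B - h n t 0 - B *: v n t| <= E n * (`|B| * Num.sqrt `|B|) &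
      forall n (t a : R), `|t| < r -> `|a| < r ->
        `|v n a - v n t - (a - t) *: v n.+1 t| <= E n * (a - t) ^+ 2].
Proof.
have /choice[F HF] := mixed_second_difference.
have F0 n : 0 <= F n by case: (HF n).
have zr : `|0 : R| < r by rewrite normr0.
pose q (h : nat -> R -> R -> C) B j n t : C := (B / 2 ^+ j)^-1 *: (h n t (B / 2 ^+ j) - h n t 0).
have qchain h g1 g2 B j : mixed_data r A A' h g1 g2 -> `|B| < r -> derivative_chain r (q h B j).
  move=> [ht _ _ _ _] Br n t tr.
  have D1 := ht n t _ tr (half_lt j Br); have D2 := ht n t _ tr zr.
  have := is_deriveZ (B / 2 ^+ j)^-1 (is_deriveB D1 D2).
  by apply: is_derive_local ltr01 _ => k _; rewrite !fctE.
(* Consecutive dyadic quotients differ by a second difference divided by the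
   step, hence by a multiple of the square root of the step. *)
have qlim h g1 g2 B : mixed_data r A A' h g1 g2 -> `|B| < r -> B != 0 ->
    exists v : nat -> R -> C, forall n j t, `|t| < r ->
      `|q h B j n t - v n t| <= 8 * (F n * Num.sqrt `|B|) * (3 / 4) ^+ j.
  move=> md Br B0.
  have H n t : exists l : C, `|t| < r -> forall j, 
      `|q h B j n t - l| <= 8 * (F n * Num.sqrt `|B|) * (3 / 4) ^+ j.
    have [tr|] := boolP (`|t| < r); last by exists 0.
    have [|l Hl] := @geo_lim (fun j => q h B j n t) (F n * Num.sqrt `|B|); last by exists l.
    move=> j; set b := B / 2 ^+ j.
    have b0 : b != 0 by rewrite mulf_neq0// invr_eq0 expf_neq0.
    have nb : 0 < `|b| by rewrite normr_gt0.
    have -> : q h B j.+1 n t - q h B j n t =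
        - (b^-1 *: (h n t b - h n t (b / 2) *+ 2 + h n t 0)).
      rewrite /q -/b; have -> : B / 2 ^+ j.+1 = b / 2 by rewrite exprS /b; field; rewrite expf_neq0.
      have -> : (b / 2)^-1 = b^-1 *+ 2 by rewrite invfM invrK mulr_natr.
      rewrite !mulr2n scalerDl !(scalerBr, scalerDr); ring.
    rewrite normrN normrZ normfV ler_pdivrMl//.
    have [_ /(_ _ _ _ md _ b tr (half_lt j Br))/le_trans] := HF n; apply.
    rewrite mulrCA ler_wpM2l//.
    rewrite -mulrA ler_wpM2l//.
    by rewrite /b normrM normfV [`|2 ^+ j|]ger0_norm ?exprn_ge0// sqrt_half.
  have /choice[w Hw] : forall p : nat * R, exists l : C, `|p.2| < r -> forall j, 
      `|q h B j p.1 p.2 - l| <= 8 * (F p.1 * Num.sqrt `|B|) * (3 / 4) ^+ j.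
    by move=> [n t]; exact: H.
  by exists (fun n t => w (n, t)) => n j t tr; exact: (Hw (n, t) tr j).
have sB1 (B : R) : `|B| < r -> Num.sqrt `|B| <= 1.
  by move=> Br; rewrite -[leRHS]sqrtr1 ler_sqrt// ltW// (lt_le_trans Br).
have qbound h g1 g2 B n j t : mixed_data r A A' h g1 g2 -> `|B| < r -> B != 0 ->
    `|t| < r -> `|q h B j n t| <= 2 * A n / `|B| + 16 * F n.
  move=> md Br B0 tr; have [v Hv] := qlim h g1 g2 B md Br B0.
  have nB : 0 < `|B| by rewrite normr_gt0.
  have q0 : `|q h B 0 n t| <= 2 * A n / `|B|.
    rewrite /q expr0 divr1 normrZ normfV mulrC ler_pM2r ?invr_gt0//.
    case: md => _ _ _ hA _.
    apply: le_trans (ler_normB _ _) _.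
    by rewrite mulr2n mulrDl mul1r lerD ?hA.
  have -> : q h B j n t = q h B 0 n t + ((q h B j n t - v n t) - (q h B 0 n t - v n t)) by ring.
  apply: le_trans (ler_normD _ _) _; apply: lerD => //.
  apply: le_trans (ler_normB _ _) _.
  have -> : 16 * F n = 8 * F n + 8 * F n by ring.
  have K i : 8 * (F n * Num.sqrt `|B|) * (3 / 4) ^+ i <= 8 * F n.
    rewrite -mulrA ler_wpM2l// -mulrA ler_piMr// mulr_ile1 ?sqrtr_ge0 ?sB1 ?exprn_ge0 ?divr_ge0//.
    by rewrite exprn_ile1// ?divr_ge0//; lra.
  by apply: lerD; apply: le_trans (Hv _ _ _ tr) (K _).
have limchain h g1 g2 B v : mixed_data r A A' h g1 g2 -> `|B| < r -> B != 0 ->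
    (forall n j t, `|t| < r ->
      `|q h B j n t - v n t| <= 8 * (F n * Num.sqrt `|B|) * (3 / 4) ^+ j) ->
    forall n (t a : R), `|t| < r -> `|a| < r ->
    `|v n a - v n t - (a - t) *: v n.+1 t| <= 4 * (2 * A n.+2 / `|B| + 16 * F n.+2) * (a - t) ^+ 2.
  move=> md Br B0 Hv.
  exact: (geo_chain_limit (fun j => qchain h g1 g2 B j md Br) Hv (fun n j t => qbound h g1 g2 B n j t md Br B0)).
have lim0 h g1 g2 B v : mixed_data r A A' h g1 g2 -> `|B| < r -> B != 0 ->
    (forall n j t, `|t| < r ->
      `|q h B j n t - v n t| <= 8 * (F n * Num.sqrt `|B|) * (3 / 4) ^+ j) ->
    forall t, `|t| < r -> v 0%N t = g1 t 0.
  move=> md Br B0 Hv t tr; case: (md) => _ h1 h2 _ gA.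
  apply/eqP; rewrite -subr_eq0 -normr_le0.
  apply: (@le_geo _ _ (8 * (F 0%N * Num.sqrt `|B|) + 4 * A' * `|B|)) => j.
  rewrite add0r mulrDl.
  have -> : v 0%N t - g1 t 0 = (q h B j 0%N t - g1 t 0) - (q h B j 0%N t - v 0%N t) by ring.
  rewrite [leRHS]addrC; apply: le_trans (ler_normB _ _) _; apply: lerD; last exact: Hv.
  have := taylor1_ball zr (half_lt j Br) (h1 t ^~ tr) (h2 t ^~ tr) (gA t ^~ tr).
  rewrite subr0 /q; set b := B / 2 ^+ j.
  have b0 : b != 0 by rewrite mulf_neq0// invr_eq0 expf_neq0.
  have nb : 0 < `|b| by rewrite normr_gt0.
  have -> : h 0%N t b - h 0%N t 0 - b *: g1 t 0 = b *: (b^-1 *: (h 0%N t b - h 0%N t 0) - g1 t 0).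
    by rewrite scalerBr scalerA divff// scale1r.
  rewrite normrZ -[b ^+ 2]real_normK ?num_real// expr2 mulrCA ler_pM2l// => /le_trans; apply.
  have A'0 : 0 <= A' := le_trans (normr_ge0 _) (gA t 0 tr zr).
  rewrite -mulrA ler_wpM2l ?mulr_ge0// /b normrM ler_wpM2l//.
  rewrite normfV ger0_norm ?exprn_ge0// -exprVn.
  by apply: lerXn2r; rewrite ?nnegrE ?divr_ge0//; lra.
pose B0 := r / 2.
have B0r : `|B0| < r by have ? := r0; rewrite ger0_norm; rewrite /B0; lra.
have B00 : B0 != 0 by rewrite mulf_neq0// gt_eqF.
exists (fun n => Num.max (8 * F n) (4 * (2 * A n.+2 / `|B0| + 16 * F n.+2))) => h g1 g2 md.
have [v Hv] := qlim h g1 g2 B0 md B0r B00.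
exists v; split.
- exact: lim0 md B0r B00 Hv.
- move=> n t B tr Br; have [->|Bn0] := eqVneq B 0.
    by rewrite subrr scale0r subrr !normr0 mul0r mulr0.
  have [w Hw] := qlim h g1 g2 B md Br Bn0.
  have <- : w n t = v n t.
    apply: derivative_chain_unique tr.
    + exact: quad_chain (limchain h g1 g2 B w md Br Bn0 Hw).
    + exact: quad_chain (limchain h g1 g2 B0 v md B0r B00 Hv).
    + by move=> u ur; rewrite (lim0 h g1 g2 B w md Br Bn0 Hw)// (lim0 h g1 g2 B0 v md B0r B00 Hv).
  have := Hw n 0%N t tr; rewrite /q expr0 divr1 mulr1.
  have nB : 0 < `|B| by rewrite normr_gt0.
  rewrite -(ler_pM2l nB) -normrZ scalerBr scalerA divff// scale1r => /le_trans; apply.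
  have -> : `|B| * (8 * (F n * Num.sqrt `|B|)) = 8 * F n * (`|B| * Num.sqrt `|B|) by ring.
  by rewrite ler_wpM2r ?mulr_ge0 ?sqrtr_ge0// le_max lexx.
- move=> n t a tr ar; apply: le_trans (limchain h g1 g2 B0 v md B0r B00 Hv n t a tr ar) _.
  by rewrite ler_wpM2r ?sqr_ge0// le_max lexx orbT.
Qed.

End Data.
End MixedQuotient.

(** * Partial derivatives and jets *)

Section RowNorm.
Variables (R : realType) (s : nat).
Local Notation E := 'rV[R]_s.

Lemma norm_entry (x : E) i : `|x 0 i| <= `|x|.
Proof.
by rewrite [leRHS]/Num.norm /= mx_normrE; apply/bigmax_geP; right => /=; exists (0, i).
Qed.

Lemma norm_le_entries (x : E) (d : R) :
  0 <= d -> (forall i, `|x 0 i| <= d) -> `|x| <= d.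
Proof.
move=> d0 H; rewrite [leLHS]/Num.norm /= mx_normrE; apply/bigmax_leP; split=> //.
by move=> [j i] _ /=; rewrite ord1.
Qed.

Lemma norm_delta i : `|delta_mx 0 i : E| <= 1.
Proof.
apply: norm_le_entries => // j; rewrite mxE eqxx/=.
by case: (j == i); rewrite ?normr1 ?normr0.
Qed.

Lemma norm_delta_scale (h : R) i : `|h *: (delta_mx 0 i : E)| <= `|h|.
Proof. by rewrite normrZ ler_piMr// norm_delta. Qed.

Lemma open_ball (O : set E) x : open O -> O x ->
  exists2 r, 0 < r & forall y, `|y - x| < r -> O y.
Proof.
move=> oO Ox; have /nbhs_ballP[r /= r0 H] : nbhs x O by exact: open_nbhs_nbhs.
exists r => // y yr; apply: H.
by rewrite mx_norm_ball /ball_/= distrC.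
Qed.

Lemma continuousE_norm (V : normedModType R) (f : E -> V) : continuous f <->
  forall x e, 0 < e -> exists2 d, 0 < d & forall y, `|y - x| < d -> `|f y - f x| < e.
Proof.
split=> [fc x e e0|H x].
  have /cvgrPdist_lt/(_ e e0) /nbhs_ballP[d /= d0 Hd] := fc x.
  exists d => // y yd; rewrite distrC; apply: (Hd y).
  by rewrite mx_norm_ball /ball_/= distrC.
apply/(@cvgrPdist_lt _ _ _ (nbhs x) _ f (f x)) => e e0; have [d d0 Hd] := H x e e0.
apply/nbhs_ballP; exists d => //= y; rewrite mx_norm_ball /ball_/= => yd.
by rewrite distrC Hd// distrC.
Qed.

Lemma continuousE_add (V : normedModType R) (f g : E -> V) :
  continuous f -> continuous g -> continuous (f + g).
Proof. by move=> fc gc x; apply: continuousD; [exact: fc|exact: gc]. Qed.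

Lemma ball_compact (x0 : E) (r : R) : compact [set x : E | `|x - x0| <= r].
Proof.
apply: bounded_closed_compact.
  exists (`|x0| + r); split; first exact: num_real.
  move=> M HM x /= xr; apply: le_trans (ltW HM).
  by rewrite -[x](subrK x0) addrC (le_trans (ler_normD _ _))// lerD2l.
have H : continuous (fun x : E => `|x - x0|).
  move=> x; apply: continuous_comp; last exact: norm_continuous.
  by apply: continuousB; [exact: cvg_id|exact: cst_continuous].
by move/continuous_closedP: H => /(_ _ (@closed_le _ r)).
Qed.

Lemma continuous_ball_bounded (V : normedModType R) (f : E -> V) (x0 : E) (r : R) :
  continuous f -> exists M, forall x, `|x - x0| <= r -> `|f x| <= M.
Proof.
move=> fc.
have /compact_bounded[M [_ HM]] : compact (f @` [set x : E | `|x - x0| <= r]).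
  apply: continuous_compact; last exact: ball_compact.
  exact: continuous_subspaceT.
exists (M + 1) => x xr; apply: HM; [by rewrite ltrDl|by exists x].
Qed.

End RowNorm.

Section PermInvariant.
Variables (I : eqType) (T : Type) (X : seq I -> T).
Hypothesis swap : forall i j l, X [:: i, j & l] = X [:: j, i & l].
(* X (i :: l) depends on l through X l only, as for iterated derivatives. *)
Hypothesis congr_head : forall i l l', X l = X l' -> X (i :: l) = X (i :: l').

Lemma perm_invariant l l' : perm_eq l l' -> X l = X l'.
Proof.
have move_head i l1 l2 : X (l1 ++ i :: l2) = X (i :: l1 ++ l2).
  by elim: l1 => //= j l1 IH; rewrite (congr_head j IH) swap.
elim: l l' => [|i l IH] l'; first by rewrite perm_sym => /perm_nilP ->.
move=> p; have il' : i \in l' by rewrite -(perm_mem p) mem_head.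
move: p; case/splitPr: il' => l1 l2; rewrite perm_sym perm_catC /= perm_cons perm_catC.
by rewrite move_head perm_sym => /IH/congr_head; exact.
Qed.

End PermInvariant.

Section SmoothCalculus.
Variables (R : realType) (s : nat).
Local Notation E := 'rV[R]_s.
Local Notation C := (Rcomplex R).
Local Notation e_ i := (delta_mx 0 i : E).

(** What an error term with exponent 3/2 is good for: it is o(h). *)
Lemma three_halves_small (K e : R) : 0 < e -> exists2 d, 0 < d & forall h : R, `|h| < d ->
  K * (`|h| * Num.sqrt `|h|) <= e * `|h|.
Proof.
move=> e0; have K0 : 0 < `|K| + 1 by rewrite ltr_wpDl.
have eK : 0 < e / (`|K| + 1) by rewrite divr_gt0.
exists ((e / (`|K| + 1)) ^+ 2); first by rewrite exprn_gt0.
move=> h he; rewrite mulrCA mulrC ler_wpM2r//.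
have hs : Num.sqrt `|h| <= e / (`|K| + 1).
  have -> : e / (`|K| + 1) = Num.sqrt ((e / (`|K| + 1)) ^+ 2).
    by rewrite sqrtr_sqr [RHS]ger0_norm ?(ltW eK).
  by rewrite ler_sqrt ?sqr_ge0 ?(ltW he).
apply: (@le_trans _ _ ((`|K| + 1) * Num.sqrt `|h|)).
  by rewrite ler_wpM2r ?sqrtr_ge0// (le_trans (ler_norm _))// lerDl.
by rewrite mulrC -ler_pdivlMr.
Qed.

Lemma is_derive_three_halves (V W : normedModType R) (f : V -> W) (x v : V) (l : W) (K d : R) :
  0 < d -> (forall h : R, `|h| < d ->
    `|f (h *: v + x) - f x - h *: l| <= K * (`|h| * Num.sqrt `|h|)) ->
  is_derive x v f l.
Proof.
move=> d0 H; apply/is_deriveP => e /(three_halves_small K)[d' d'0 Hd'].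
exists (Num.min d d'); first by rewrite lt_min d0.
by move=> h; rewrite lt_min => /andP[hd hd']; apply: le_trans (H _ hd) (Hd' _ hd').
Qed.

Lemma smooth_is_derive (f : E -> C) l i x : smooth f ->
  is_derive x (e_ i) (partials l f) (partials (i :: l) f x).
Proof. by move=> fs; have [_ H] := fs l; exact/derivableP/H. Qed.

(** A family indexed by lists of directions in which X (i :: l) is the derivative
of X l in direction i. Unlike the derivatives of X [::] themselves, which are
global total functions, it only concerns the points of O. *)
Definition is_jet (V : normedModType R) (O : set E) (X : seq 'I_s -> E -> V) : Prop :=
  forall l i x, O x -> is_derive x (e_ i) (X l) (X (i :: l) x).

Lemma smooth_jet (f : E -> C) : smooth f -> is_jet setT (partials ^~ f).
Proof. by move=> fs l i x _; exact: smooth_is_derive. Qed.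

Lemma is_jetD (V : normedModType R) (O : set E) (X Y : seq 'I_s -> E -> V) :
  is_jet O X -> is_jet O Y -> is_jet O (fun l => X l + Y l).
Proof. by move=> jX jY l i x Ox; apply: is_deriveD; [exact: jX|exact: jY]. Qed.

Lemma jet_partials (X : seq 'I_s -> E -> C) : is_jet setT X ->
  forall l, partials l (X [::]) = X l.
Proof.
move=> H; elim=> //= i l IH; rewrite IH.
by apply/funext => x; have [_ ->] := H l i x I.
Qed.

Lemma jet_smooth (X : seq 'I_s -> E -> C) : is_jet setT X ->
  (forall l, continuous (X l)) -> smooth (X [::]).
Proof.
move=> H cX l; rewrite (jet_partials H); split=> [|i x]; first exact: cX.
by have [] := H l i x I.
Qed.

Lemma is_derive_cmull (V : normedModType R) (f : V -> C) (z l : C) (x v : V) :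
  is_derive x v f l -> is_derive x v (fun y => z * f y : C) (z * l : C).
Proof.
move=> /is_deriveP H; apply/is_deriveP => e e0.
have z0 : 0 < `|z| + 1 by rewrite ltr_wpDl.
have [d d0 {}H] := H _ (divr_gt0 e0 z0); exists d => // h hd.
rewrite scalerMCr -!mulrBr normCM.
apply: le_trans (ler_wpM2l (normr_ge0 _) (H _ hd)) _.
rewrite mulrA ler_wpM2r// mulrCA ler_piMr ?(ltW e0)//.
by rewrite ler_pdivrMr// mul1r lerDl.
Qed.

Lemma is_jetM (O : set E) (z : C) (X : seq 'I_s -> E -> C) :
  is_jet O X -> is_jet O (fun l x => z * X l x : C).
Proof. by move=> jX l i x Ox; apply: is_derive_cmull; exact: jX. Qed.

Lemma smoothD (f g : E -> C) : smooth f -> smooth g -> smooth (f + g).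
Proof.
move=> fs gs; apply: (jet_smooth (is_jetD (smooth_jet fs) (smooth_jet gs))) => l.
by case: (fs l) (gs l) => ? _ [? _]; exact: continuousE_add.
Qed.

Lemma partialsD (f g : E -> C) l : smooth f -> smooth g ->
  partials l (f + g) = partials l f + partials l g.
Proof.
by move=> fs gs; exact: (jet_partials (is_jetD (smooth_jet fs) (smooth_jet gs))).
Qed.

Lemma smoothM (z : C) (f : E -> C) : smooth f -> smooth (fun x => z * f x).
Proof.
move=> fs; apply: (jet_smooth (is_jetM z (smooth_jet fs))) => l.
apply/continuousE_norm => x e e0.
have z0 : 0 < `|z| + 1 by rewrite ltr_wpDl.
have [/continuousE_norm fc _] := fs l.
have [d d0 Hd] := fc x _ (divr_gt0 e0 z0); exists d => // y yd.
rewrite -mulrBr normCM; apply: le_lt_trans (ler_wpM2l (normr_ge0 _) (ltW (Hd _ yd))) _.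
by rewrite mulrCA gtr_pMr// ltr_pdivrMr// mul1r ltrDl.
Qed.

Lemma partialsM (z : C) (f : E -> C) l : smooth f ->
  partials l (fun x => z * f x) = (fun x => z * partials l f x).
Proof. by move=> fs; exact: (jet_partials (is_jetM z (smooth_jet fs))). Qed.

Lemma scale_fctE (a : R) (f : E -> C) : a *: f = (fun x => (a%:C)%C * f x).
Proof. by apply/funext => x; rewrite -RcomplexZ. Qed.

Lemma smoothZ (a : R) (f : E -> C) : smooth f -> smooth (a *: f).
Proof. by rewrite scale_fctE; exact: smoothM. Qed.

Lemma partialsZ (a : R) (f : E -> C) l : smooth f ->
  partials l (a *: f) = a *: partials l f.
Proof. by move=> fs; rewrite scale_fctE partialsM// scale_fctE. Qed.

Lemma is_jet0 (V : normedModType R) (O : set E) :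
  is_jet O (fun=> (fun=> 0) : E -> V).
Proof. by move=> l i x _; exact: is_derive_cst. Qed.

Lemma smooth0 : smooth (0 : E -> C).
Proof.
apply: (jet_smooth (@is_jet0 C setT)) => l.
by apply/continuousE_norm => x e e0; exists e => // y _; rewrite subrr normr0.
Qed.

Lemma smoothN (f : E -> C) : smooth f -> smooth (- f).
Proof. by rewrite -(scaleN1r f); exact: smoothZ. Qed.

Lemma partialsN (f : E -> C) l : smooth f -> partials l (- f) = - partials l f.
Proof. by move=> fs; rewrite -(scaleN1r f) partialsZ// scaleN1r. Qed.

Lemma smoothB (f g : E -> C) : smooth f -> smooth g -> smooth (f - g).
Proof. by move=> fs gs; apply: smoothD => //; exact: smoothN. Qed.

Lemma partialsB (f g : E -> C) l : smooth f -> smooth g ->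
  partials l (f - g) = partials l f - partials l g.
Proof. by move=> fs gs; rewrite partialsD ?partialsN//; exact: smoothN. Qed.

Lemma partials_local (f g : E -> C) l (x : E) : (\forall y \near x, f y = g y) ->
  \forall y \near x, partials l f y = partials l g y.
Proof.
elim: l => //= i l IH /IH/nbhs_interior; apply: filterS => y H.
exact: near_eq_derive.
Qed.

Lemma is_derive_plane_l (V : normedModType R) (X Y : E -> V) (x : E) (t u : R) i j :
  is_derive (x + t *: e_ i + u *: e_ j) (e_ i) X (Y (x + t *: e_ i + u *: e_ j)) ->
  is_derive t 1 (fun t => X (x + t *: e_ i + u *: e_ j)) (Y (x + t *: e_ i + u *: e_ j)).
Proof.
move=> /is_deriveP H; apply/is_deriveP => e /H[d d0 {}H]; exists d => // h hd.
rewrite [h *: 1]mulr1; have := H h hd.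
suff -> : h *: e_ i + (x + t *: e_ i + u *: e_ j) = x + (h + t) *: e_ i + u *: e_ j by [].
by rewrite scalerDl !addrA [h *: _ + x]addrC.
Qed.

Lemma is_derive_plane_r (V : normedModType R) (X Y : E -> V) (x : E) (t u : R) i j :
  is_derive (x + t *: e_ i + u *: e_ j) (e_ j) X (Y (x + t *: e_ i + u *: e_ j)) ->
  is_derive u 1 (fun u => X (x + t *: e_ i + u *: e_ j)) (Y (x + t *: e_ i + u *: e_ j)).
Proof.
move=> /is_deriveP H; apply/is_deriveP => e /H[d d0 {}H]; exists d => // h hd.
rewrite [h *: 1]mulr1; have := H h hd.
suff -> : h *: e_ j + (x + t *: e_ i + u *: e_ j) = x + t *: e_ i + (h + u) *: e_ j by [].
by rewrite scalerDl addrCA.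
Qed.

(** Schwarz's theorem. The derivative v 1 provided by [mixed_derivatives] is on
the one hand the derivative in t of v 0 = g1, on the other hand the derivative in
u of h 1. *)
Lemma partials_swap (f : E -> C) i j l : smooth f ->
  partials [:: i, j & l] f = partials [:: j, i & l] f.
Proof.
move=> fs; apply/funext => x.
pose P (t u : R) := x + t *: e_ i + u *: e_ j.
pose h n t u := partials (nseq n i ++ l) f (P t u).
pose g1 t u := partials (j :: l) f (P t u).
pose g2 t u := partials [:: j, j & l] f (P t u).
have Pball (t u : R) : `|t| < 1 -> `|u| < 1 -> `|P t u - x| <= 2.
  move=> t1 u1; rewrite /P addrAC [x + _]addrC addrK.
  apply: le_trans (ler_normD _ _) _; rewrite -[2]/(1 + 1).
  by apply: lerD; apply: le_trans (norm_delta_scale _ _) (ltW _).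
have bd l0 : exists M, forall t u : R, `|t| < 1 -> `|u| < 1 -> `|partials l0 f (P t u)| <= M.
  have [c _] := fs l0; have [M HM] := continuous_ball_bounded x 2 c.
  by exists M => t u t1 u1; apply: HM; exact: Pball.
have /choice[A HA] : forall n, exists M, forall t u : R, `|t| < 1 -> `|u| < 1 -> `|h n t u| <= M.
  by move=> n; exact: bd.
have [A' HA'] := bd [:: j, j & l].
have data : mixed_data 1 A A' h g1 g2.
  split; last 2 first.
  - exact: HA.
  - exact: HA'.
  - by move=> n t u _ _; apply: is_derive_plane_l; exact: smooth_is_derive.
  - by move=> t u _ _; apply: is_derive_plane_r; exact: smooth_is_derive.
  - by move=> t u _ _; apply: is_derive_plane_r; exact: smooth_is_derive.
have r01 : 0 < (1 : R) <= 1 by rewrite ltr01 lexx.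
have [K HK] := mixed_derivatives A A' r01.
have [v [v0 vh vq]] := HK _ _ _ data.
have z1 : `|0 : R| < 1 by rewrite normr0.
have P00 : P 0 0 = x by rewrite /P !scale0r !addr0.
have D1 : is_derive (0 : R) 1 (v 0%N) (v 1%N 0) by exact: quad_chain vq 0%N 0 z1.
have D2 : is_derive (0 : R) 1 (fun t => g1 t 0) (partials [:: i, j & l] f (P 0 0)).
  by apply: is_derive_plane_l; exact: smooth_is_derive.
have E1 : v 1%N 0 = partials [:: i, j & l] f x.
  rewrite -P00; apply: is_derive_unique D2.
  by apply: is_derive_local ltr01 _ D1 => k k1; rewrite addr0 [k *: 1]mulr1 v0.
rewrite -E1; apply: is_derive_unique (smooth_is_derive (i :: l) j x fs).
apply: (@is_derive_three_halves _ _ _ _ _ _ (K 1%N)) ltr01 _ => k k1.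
have := vh 1%N 0 k z1 k1; rewrite /h P00.
by have -> : P 0 k = k *: e_ j + x by rewrite /P scale0r addr0 addrC.
Qed.

Lemma partials_perm (f : E -> C) l l' : smooth f -> perm_eq l l' ->
  partials l f = partials l' f.
Proof.
move=> fs; apply: (@perm_invariant _ _ (fun l => partials l f)).
  by move=> i j l0; exact: partials_swap.
by move=> i l0 l1 /=; rewrite /partials /= => ->.
Qed.

Lemma perm_midx_dirs (l : seq 'I_s) : perm_eq l (midx_dirs (fun i => count_mem i l)).
Proof.
apply/allP => i _ /=; rewrite /midx_dirs count_flatten -map_comp.
rewrite (eq_map (g := fun j => if j == i then count_mem i l else 0%N)); last first.
  by move=> j /=; rewrite count_nseq /=; case: eqP => [->|_]; rewrite ?mul1n ?mul0n.
rewrite sumnE big_map big_enum /= -big_mkcond /=.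
by rewrite (eq_bigl (pred1 i)) // big_pred1_eq.
Qed.

Lemma midx_deg_count (l : seq 'I_s) : midx_deg (fun i => count_mem i l) = size l.
Proof.
rewrite (perm_size (perm_midx_dirs l)) /midx_dirs size_flatten /shape -map_comp.
by rewrite sumnE big_map big_enum /=; apply: eq_bigr => i _; rewrite /= size_nseq.
Qed.

Lemma size_midx_dirs (al : 'I_s -> nat) : size (midx_dirs al) = midx_deg al.
Proof.
rewrite /midx_dirs size_flatten /shape -map_comp.
by rewrite sumnE big_map big_enum /=; apply: eq_bigr => i _; rewrite /= size_nseq.
Qed.

Lemma partials_mpartial (f : E -> C) l : smooth f ->
  partials l f = mpartial (fun i => count_mem i l) f.
Proof. by move=> fs; apply: partials_perm => //; exact: perm_midx_dirs. Qed.

End SmoothCalculus.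

(** * Neighbourhoods and bounded sets of test functions *)

Section LFTopology.
Variables (R : realType) (s : nat).
Local Notation E := 'rV[R]_s.
Local Notation C := (Rcomplex R).
Local Notation fn := (E -> C).
Local Notation e_ i := (delta_mx 0 i : E).
Local Notation D := (@test_functions R s setT).

Lemma test_functionP (f : fn) :
  D f <-> smooth f /\ exists r, forall x, r < `|x| -> f x = 0.
Proof.
split=> [[K [/compact_bounded[M [_ HM]] _ [fs fK]]]|[fs [r fr]]].
  split=> //; exists (M + 1) => x; apply: contraPeq => /eqP fx0 xM.
  have /HM : M < M + 1 by rewrite ltrDl.
  by move=> /(_ x); rewrite /= leNgt xM => /(_ (contrapT (fun H => fx0 (fK x H)))).
exists [set x | `|x - 0| <= r]; split=> //; first exact: ball_compact.
by split=> // x /=; rewrite subr0 => /negP; rewrite -ltNge => /fr.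
Qed.

Lemma partials_support (f : fn) (r : R) l x : (forall x, r < `|x| -> f x = 0) ->
  r < `|x| -> partials l f x = 0.
Proof.
move=> fr rx.
have : \forall y \near x, f y = (0 : fn) y.
  apply/nbhs_ballP; exists (`|x| - r) => /=; first by rewrite subr_gt0.
  move=> y; rewrite mx_norm_ball /ball_/= => yx; apply: fr.
  by rewrite ltrBrDl -ltrBrDr in yx; rewrite (lt_le_trans yx)// lerBlDr; 
     rewrite -[x in leLHS](subrK y) addrC (le_trans (ler_normD _ _)).
move=> /(partials_local l)/nbhs_singleton ->.
by rewrite (jet_partials (@is_jet0 R s C setT)).
Qed.

Lemma test_functionD (f g : fn) : D f -> D g -> D (f + g).
Proof.
move=> /test_functionP[fs [r fr]] /test_functionP[gs [r' gr]].
apply/test_functionP; split; first exact: smoothD.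
exists (Num.max r r') => x; rewrite gt_max => /andP[rx r'x].
by rewrite fctE fr// gr// addr0.
Qed.

Lemma test_functionM (z : C) (f : fn) : D f -> D (fun x => z * f x).
Proof.
move=> /test_functionP[fs [r fr]]; apply/test_functionP; split; first exact: smoothM.
by exists r => x rx; rewrite fr// mulr0.
Qed.

Lemma test_functionZ (a : R) (f : fn) : D f -> D (a *: f).
Proof. by rewrite scale_fctE; exact: test_functionM. Qed.

Lemma test_functionB (f g : fn) : D f -> D g -> D (f - g).
Proof. by move=> Df Dg; rewrite -(scaleN1r g); apply: test_functionD => //; exact: test_functionZ. Qed.

Lemma test_function0 : D 0.
Proof. by apply/test_functionP; split; [exact: smooth0|exists 0]. Qed.

Lemma test_function_smooth (f : fn) : D f -> smooth f.
Proof. by case/test_functionP. Qed.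

Lemma test_function_bounded (f : fn) l : D f -> exists M, forall x, `|partials l f x| <= M.
Proof.
move=> /test_functionP[fs [r fr]].
have [fc _] := fs l; have [M HM] := continuous_ball_bounded 0 r fc.
exists (Num.max M 0) => x; rewrite le_max.
have [xr|rx] := leP `|x| r; first by rewrite HM// subr0.
by rewrite (partials_support l fr rx) normr0 lexx orbT.
Qed.

(** The families of linear functionals whose polars are neighbourhoods of 0 of the
(LF) topology. They give access to this topology without handling convex hulls:
the uniform norms of derivatives and weighted evaluations at points going to
infinity are of this form. *)
Definition LF_functionals (J : Type) (T : J -> fn -> C) (c : J -> R) : Prop :=
  [/\ forall j f g, D f -> D g -> T j (f + g) = T j f + T j g,
      forall j (z : C) f, D f -> T j (fun x => z * f x) = z * T j f &
      forall K, compact K -> exists (m : nat) (d : R), 0 < d /\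
        forall f, test_functions_on K f ->
          (forall alpha, (midx_deg alpha <= m)%N -> forall x, `|mpartial alpha f x| <= d) ->
          forall j, `|T j f| <= c j].

Lemma LF_functionals_nbhs0 (J : Type) (T : J -> fn -> C) (c : J -> R) :
  LF_functionals T c -> LF_base0 setT [set f | D f /\ forall j, `|T j f| <= c j].
Proof.
move=> [TD TM TK]; split.
- by move=> f [].
- move=> f g k /set_mem[Df Tf] /set_mem[Dg Tg]; apply/mem_set.
  pose a : R := k%:inum; pose b : R := 1 - a.
  have -> : conv k f g = (fun x => (a%:C)%C * f x) + (fun x => (b%:C)%C * g x) :> fn.
    by rewrite -!scale_fctE.
  split; first by apply: test_functionD; exact: test_functionM.
  move=> j; rewrite TD ?TM//; try exact: test_functionM.
  have k0 : (0 : R) <= k%:inum by [].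
  have k1' : k%:inum <= (1 : R) by [].
  have k1 : 0 <= b by rewrite subr_ge0.
  rewrite -!RcomplexZ; apply: le_trans (ler_normD _ _) _.
  rewrite !normrZ (ger0_norm k0) (ger0_norm k1).
  apply: le_trans (lerD (ler_wpM2l k0 (Tf j)) (ler_wpM2l k1 (Tg j))) _.
  by rewrite -mulrDl addrC subrK mul1r.
- move=> z f z1 [Df Tf]; split; first exact: test_functionM.
  by move=> j; rewrite TM// normCM (le_trans _ (Tf j))// ler_piMl.
- move=> K cK _; have [m [d [d0 H]]] := TK K cK.
  exists m, d; split=> // f fK fd; split; last exact: H fK fd.
  by exists K; split.
Qed.

Lemma LF_functionals_partials l (d : R) : 0 < d ->
  LF_functionals (fun x f => partials l f x) (fun=> d).
Proof.
move=> d0; split.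
- by move=> x f g /test_function_smooth fs /test_function_smooth gs; rewrite partialsD.
- by move=> x z f /test_function_smooth fs; rewrite partialsM.
- move=> K cK; exists (size l), d; split=> // f [fs _] fd x.
  by rewrite partials_mpartial//; apply: fd; rewrite midx_deg_count.
Qed.

(** On functions with support in a given compact set, all but finitely many of the
evaluations vanish. *)
Lemma LF_functionals_points (xi : nat -> E) (c : nat -> R) :
  (forall n, 0 < c n) -> (forall n, n%:R < `|xi n|) ->
  LF_functionals (fun n f => f (xi n)) c.
Proof.
move=> c0 xin; split => // K cK.
have [M [_ HM]] := compact_bounded cK.
have {HM} HM x : K x -> `|x| <= M + 1 by apply: HM; rewrite ltrDl.
pose N := Num.truncn (M + 1).
have [d [d0 dc]] : exists d, 0 < d /\ forall n, (n <= N)%N -> d <= c n.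
  elim: N => [|N [d [d0 dc]]]; first by exists (c 0%N); split=> // n; rewrite leqn0 => /eqP ->.
  exists (Num.min d (c N.+1)); split; first by rewrite lt_min d0 c0.
  move=> n; rewrite leq_eqVlt => /predU1P[->|nN]; first by rewrite ge_min lexx orbT.
  by rewrite ge_min dc.
exists 0%N, d; split=> // f [fs fK] fd n.
have [nN|Nn] := leqP n N.
  apply: le_trans (dc _ nN).
  have := fd (fun=> 0%N); rewrite /midx_deg big1// => /(_ isT (xi n)).
  rewrite /mpartial; have -> // : @midx_dirs s (fun=> 0%N) = [::].
  by apply: size0nil; rewrite size_midx_dirs /midx_deg big1.
rewrite fK ?normr0 ?(ltW (c0 n))// => /HM; apply/negP; rewrite -ltNge.
apply: lt_trans (xin n).
by rewrite (lt_le_trans (truncnS_gt _))// ler_nat.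
Qed.

Lemma LF_bounded_functionals (B : set fn) (J : Type) (T : J -> fn -> C) (c : J -> R) :
  LF_bounded setT B -> LF_functionals T c ->
  exists2 r : R, 0 < r & forall f, B f -> forall j, `|T j f| <= r * c j.
Proof.
move=> [BD HB] HT; have W := LF_functionals_nbhs0 HT.
have [|r r0 Br] := HB [set f | D f /\ forall j, `|T j f| <= c j]; first by exists [set f | D f /\ forall j, `|T j f| <= c j].
exists r => // f /Br /= [g [Dg Tg] <-] j.
case: HT => _ TM _; rewrite scale_fctE TM// -RcomplexZ normrZ ger0_norm ?(ltW r0)//.
by rewrite ler_pM2l.
Qed.

Lemma LF_bounded_partials (B : set fn) l : LF_bounded setT B ->
  exists M, forall f, B f -> forall x, `|partials l f x| <= M.
Proof.
move=> bB; have [r _ H] := LF_bounded_functionals bB (LF_functionals_partials l ltr01).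
by exists r => f /H Hf x; have := Hf x; rewrite mulr1.
Qed.

(** If the supports are not uniformly bounded, pick functions f_n of the set
and points xi_n going to infinity with f_n(xi_n) != 0: the conditions
|g(xi_n)| <= |f_n(xi_n)|/(n+1) define a neighbourhood of 0 that does not
absorb the set. *)
Lemma LF_bounded_support (B : set fn) : LF_bounded setT B ->
  exists r : R, forall f, B f -> forall x, r < `|x| -> f x = 0.
Proof.
move=> bB; apply: contrapT => /forallNP H.
have /choice[p Hp] : forall n : nat, exists p : fn * E, [/\ B p.1, n%:R < `|p.2| & p.1 p.2 <> 0].
  move=> n; have := H n%:R => /existsNP[f] /not_implyP[Bf] /existsNP[x] /not_implyP[nx fx].
  by exists (f, x).
pose c n := `|(p n).1 (p n).2| / n.+1%:R.
have c0 n : 0 < c n.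
  by rewrite divr_gt0 ?ltr0n// normr_gt0; apply/eqP; have [] := Hp n.
have xin n : n%:R < `|(p n).2| by have [] := Hp n.
have [r r0 Hr] := LF_bounded_functionals bB (LF_functionals_points c0 xin).
pose n := Num.truncn r.
have [Bn _ _] := Hp n.
have := Hr _ Bn n; apply/negP; rewrite -ltNge /c mulrA mulrAC.
have n0 : 0 < `|(p n).1 (p n).2| by rewrite normr_gt0; apply/eqP; have [] := Hp n.
rewrite gtr_pMl// ltr_pdivrMr ?ltr0n// mul1r; exact: truncnS_gt.
Qed.

Lemma lists_bound (P : seq 'I_s -> R -> Prop) m :
  (forall l M M', P l M -> M <= M' -> P l M') -> (forall l, exists M, P l M) ->
  exists M, forall l, (size l <= m)%N -> P l M.
Proof.
move=> mono /choice[F HF].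
exists (\sum_(k < m.+1) \sum_(t : k.-tuple 'I_s) `|F t|) => l lm.
apply: mono (HF l) _; apply: le_trans (ler_norm _) _.
have lm' : (size l < m.+1)%N by [].
rewrite (bigD1 (Ordinal lm'))//= (bigD1 (in_tuple l))//= -addrA lerDl.
by rewrite addr_ge0// sumr_ge0// => k _; rewrite sumr_ge0.
Qed.

(** Such a set lies in a single space D_K, where it is absorbed by the trace of
every neighbourhood of 0. *)
Lemma LF_boundedI (B : set fn) : (forall f, B f -> smooth f) ->
  (exists r : R, forall f, B f -> forall x, r < `|x| -> f x = 0) ->
  (forall l, exists M, forall f, B f -> forall x, `|partials l f x| <= M) ->
  LF_bounded setT B.
Proof.
move=> Bs [r Br] BM; have BD : B `<=` D.
  by move=> f Bf; apply/test_functionP; split; [exact: Bs|exists r; exact: Br].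
split=> // V [W [_ _ _ WK] WV].
have [m [d [d0 Hd]]] := WK _ (@ball_compact R s 0 r) (fun _ _ => I).
have [||M HM] := @lists_bound (fun l M => forall f, B f -> forall x, `|partials l f x| <= M) m.
  by move=> l M M' H MM' f Bf x; exact: le_trans (H f Bf x) MM'.
  exact: BM.
have M0 : 0 < `|M| + 1 by rewrite ltr_wpDl.
exists ((`|M| + 1) / d); first by rewrite divr_gt0.
move=> f Bf /=; exists ((d / (`|M| + 1)) *: f).
  apply/WV/Hd.
    split; first exact/smoothZ/Bs.
    by move=> x /= /negP; rewrite subr0 -ltNge => rx; rewrite fctE (Br f Bf x rx) scaler0.
  move=> al alm x; rewrite /mpartial partialsZ; last exact: Bs.
  rewrite fctE normrZ ger0_norm; last by rewrite divr_ge0// ltW.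
  rewrite mulrAC ler_pdivrMr// ler_pM2l//.
  rewrite (le_trans (HM _ _ f Bf x)) ?size_midx_dirs//.
  by rewrite (le_trans (ler_norm _))// lerDl.
rewrite scalerA; have -> : (`|M| + 1) / d * (d / (`|M| + 1)) = 1.
  by field; rewrite !gt_eqF.
by rewrite scale1r.
Qed.

End LFTopology.

(** * Derivatives of maps into the test functions *)

Section LFDerive.
Variables (R : realType) (s : nat).
Local Notation E := 'rV[R]_s.
Local Notation C := (Rcomplex R).
Local Notation fn := (E -> C).
Local Notation e_ i := (delta_mx 0 i : E).
Local Notation D := (@test_functions R s setT).

Lemma near0P (P : R -> Prop) : (\forall h \near (0 : R)^', P h) <->
  exists2 d, 0 < d & forall h, `|h| < d -> h != 0 -> P h.
Proof.
rewrite near_withinE; split=> [/nbhs_ballP[d /= d0 H]|[d d0 H]].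
  by exists d => // h hd h0; apply: H => //; rewrite /ball/= sub0r normrN.
by apply/nbhs_ballP; exists d => //= h; rewrite /ball/= sub0r normrN => hd; exact: H.
Qed.

Lemma LF_functional_nbhs0 (T : fn -> C) (e : R) :
  LF_functionals (fun _ : unit => T) (fun=> e) -> LF_nbhs0 setT [set f | D f /\ `|T f| <= e].
Proof.
move=> H; exists [set f | D f /\ forall _ : unit, `|T f| <= e].
  exact: LF_functionals_nbhs0 H.
by move=> f [Df /(_ tt)].
Qed.

Definition LF_continuous_functional (T : fn -> C) : Prop :=
  forall e : R, 0 < e -> LF_functionals (fun _ : unit => T) (fun=> e).

Lemma LF_continuous_functional_linear (T : fn -> C) : LF_continuous_functional T ->
  [/\ forall f g, D f -> D g -> T (f + g) = T f + T g,
      forall (z : C) f, D f -> T (fun x => z * f x) = z * T f,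
      forall (a : R) f, D f -> T (a *: f) = a *: T f &
      forall f g, D f -> D g -> T (f - g) = T f - T g].
Proof.
move=> /(_ 1 ltr01)[TD TM _].
have TZ (a : R) f : D f -> T (a *: f) = a *: T f.
  by move=> Df; rewrite scale_fctE (TM tt)// RcomplexZ.
split=> [||//|]; [exact: TD tt|exact: TM tt|].
move=> f g Df Dg; rewrite -(scaleN1r g) (TD tt)//; last exact: test_functionZ.
by rewrite TZ// scaleN1r.
Qed.

Lemma LF_continuous_partials l xi : LF_continuous_functional (fun f : fn => partials l f xi).
Proof.
move=> e e0; have [TD TM TK] := LF_functionals_partials (s := s) l e0.
split; [by move=> _; exact: TD|by move=> _; exact: TM|move=> K /TK[m [d [d0 H]]]].
by exists m, d; split=> // f fK fd _; exact: H.
Qed.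

Lemma is_LF_derive_functional (X : normedModType R) (f : X -> fn) (x v : X) (l : fn)
    (T : fn -> C) d :
  LF_continuous_functional T -> 0 < d ->
  (forall h : R, `|h| < d -> D (f (h *: v + x))) ->
  is_LF_derive setT f x v l -> is_derive x v (fun y => T (f y)) (T l).
Proof.
move=> cT d0 Df [Dl H]; apply/is_deriveP => e e0.
have [TD TM TZ TB] := LF_continuous_functional_linear cT.
have /near0P[d' d'0 Hd'] := H _ (LF_functional_nbhs0 (cT e e0)).
exists (Num.min d d'); first by rewrite lt_min d0.
move=> h; rewrite lt_min => /andP[hd hd'].
have [->|h0] := eqVneq h 0; first by rewrite !scale0r add0r subrr subr0 !normr0 mulr0.
have D0 : D (f x) by have := Df 0; rewrite scale0r add0r normr0; apply.
have D1 := Df h hd.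
have [/= _] := Hd' h hd' h0.
rewrite TB//; last exact/test_functionZ/test_functionB.
rewrite TZ ?TB//; last exact: test_functionB.
have nh : 0 < `|h| by rewrite normr_gt0.
rewrite -(ler_pM2l nh) -normrZ scalerBr scalerA divff// scale1r => /le_trans; apply.
by rewrite mulrC.
Qed.

(** The evaluations at points are continuous and separate functions. *)
Lemma is_LF_derive_unique (X : normedModType R) (f : X -> fn) (x v : X) (l l' : fn) :
  is_LF_derive setT f x v l -> is_LF_derive setT f x v l' -> l = l'.
Proof.
move=> [Dl H] [Dl' H']; apply/funext => xi; apply/eqP; rewrite -subr_eq0 -normr_le0.
apply/ler_addgt0Pl => e e0; rewrite addr0.
have e2 : 0 < e / 2 by rewrite divr_gt0.
have cT := @LF_continuous_partials [::] xi.
have [TD TM TZ TB] := LF_continuous_functional_linear cT.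
have /near0P[d d0 Hd] := H _ (LF_functional_nbhs0 (cT _ e2)).
have /near0P[d' d'0 Hd'] := H' _ (LF_functional_nbhs0 (cT _ e2)).
pose h := Num.min d d' / 2.
have m0 : 0 < Num.min d d' by rewrite lt_min d0.
have h0 : 0 < h by rewrite divr_gt0.
have hm : `|h| < Num.min d d' by rewrite gtr0_norm// /h ltr_pdivrMr// ltr_pMr// ltr1n.
move: hm; rewrite lt_min => /andP[hd hd'].
have [/= Dq q] := Hd h hd (lt0r_neq0 h0); have [/= Dq' q'] := Hd' h hd' (lt0r_neq0 h0).
set w := h^-1 *: _ in Dq q Dq' q'.
have -> : l xi - l' xi = (w - l') xi - (w - l) xi by rewrite !fctE; ring.
by rewrite (le_trans (ler_normB _ _))// [e]splitr lerD.
Qed.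

Lemma is_LF_derive_transfer (X Y : normedModType R) (f : X -> fn) (g : Y -> fn) (x v : X) (y w : Y) (l : fn) d :
  0 < d -> (forall h : R, `|h| < d -> f (h *: v + x) = g (h *: w + y)) ->
  is_LF_derive setT f x v l -> is_LF_derive setT g y w l.
Proof.
move=> d0 fg [Dl H]; split=> // V /H/near0P[d' d'0 H'].
apply/near0P; exists (Num.min d d'); first by rewrite lt_min d0.
move=> h; rewrite lt_min => /andP[hd hd'] h0.
have := fg 0; rewrite !scale0r !add0r normr0 => <-//; rewrite -fg//; exact: H'.
Qed.

Lemma is_LF_derive_local (X : normedModType R) (f g : X -> fn) (x v : X) (l : fn) d :
  0 < d -> (forall h : R, `|h| < d -> f (h *: v + x) = g (h *: v + x)) ->
  is_LF_derive setT f x v l -> is_LF_derive setT g x v l.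
Proof. exact: is_LF_derive_transfer. Qed.

Lemma is_LF_deriveE (X : normedModType R) (f : X -> fn) (x v : X) (l : fn) :
  is_LF_derive setT f x v l -> LF_derive setT f x v = l.
Proof.
move=> H; apply: (is_LF_derive_unique _ H); rewrite /LF_derive.
by apply: getPex; exists l.
Qed.

Lemma convex_fnP (W : set fn) : convex_set W <->
  forall (a : R) f g, 0 <= a -> a <= 1 -> W f -> W g -> W (a *: f + (1 - a) *: g).
Proof.
split=> [Wc a f g a0 a1 Wf Wg|H f g k /set_mem Wf /set_mem Wg].
  by have /set_mem := Wc _ _ (Itv01 a0 a1) (mem_set Wf) (mem_set Wg).
have k0 : (0 : R) <= k%:inum by [].
have k1 : k%:inum <= (1 : R) by [].
exact/mem_set/(H k%:inum).
Qed.

(** The sum of two elements of this set lies in W by convexity. *)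
Lemma LF_base0_half W : LF_base0 setT W ->
  LF_base0 setT [set g : fn | W ((2 : R) *: g)].
Proof.
move=> [WD Wc Wb WK].
have half (g : fn) : g = (2^-1 : R) *: ((2 : R) *: g) by rewrite scalerA mulVf ?scale1r.
split.
- by move=> g /= /WD; rewrite {2}[g]half; exact: test_functionZ.
- apply/convex_fnP => a f g a0 a1 /= Wf Wg.
  have /convex_fnP/(_ a _ _ a0 a1 Wf Wg) := Wc.
  by congr W; rewrite scalerDr !scalerA [2 * a]mulrC [2 * (1 - a)]mulrC.
- move=> z f z1 /= Wf; have := Wb z _ z1 Wf.
  by congr W; apply/funext => x; rewrite fctE -scalerMCr.
- move=> K cK KO; have [m [d [d0 H]]] := WK K cK KO.
  exists m, (d / 2); split; first by rewrite divr_gt0.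
  move=> f [fs fK] fd /=; apply: H.
    split; first exact: smoothZ.
    by move=> x /fK fx; rewrite fctE fx scaler0.
  move=> al alm x; rewrite /mpartial partialsZ// fctE normrZ ger0_norm//.
  by rewrite mulrC -ler_pdivlMr// fd.
Qed.

Lemma is_LF_deriveD (X : normedModType R) (f g : X -> fn) (x v : X) (l l' : fn) :
  is_LF_derive setT f x v l -> is_LF_derive setT g x v l' ->
  is_LF_derive setT (fun y => f y + g y) x v (l + l').
Proof.
move=> [Dl H] [Dl' H']; split; first exact: test_functionD.
move=> V [W bW WV]; have bW2 := LF_base0_half bW.
have nW2 : LF_nbhs0 setT [set g : fn | W ((2 : R) *: g)] by exists [set g : fn | W ((2 : R) *: g)].
have /near0P[d d0 Hd] := H _ nW2; have /near0P[d' d'0 Hd'] := H' _ nW2.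
apply/near0P; exists (Num.min d d'); first by rewrite lt_min d0.
move=> h; rewrite lt_min => /andP[hd hd'] h0; apply: WV.
have /= W1 := Hd h hd h0; have /= W2 := Hd' h hd' h0.
have [_ Wc _ _] := bW.
have h0' : 0 <= 2^-1 :> R by rewrite invr_ge0.
have h1' : 2^-1 <= 1 :> R by rewrite invf_le1// ler1n.
have /convex_fnP/(_ _ _ _ h0' h1' W1 W2) := Wc.
congr W.
have -> : 1 - 2^-1 = 2^-1 :> R by field.
rewrite !scalerA mulVf// !scale1r addrACA -scalerDr -opprD.
by congr (_ *: _ - _); rewrite opprD addrACA.
Qed.

Lemma LF_nbhs0_small_scale (V : set fn) (g : fn) : LF_nbhs0 setT V -> D g ->
  exists2 d : R, 0 < d & forall z : C, `|z| <= d -> V (fun x => z * g x).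
Proof.
move=> [W [_ _ _ WK] WV] Dg; have [gs [r gr]] := (test_functionP g).1 Dg.
have [m [d [d0 H]]] := WK _ (@ball_compact R s 0 r) (fun _ _ => I).
have [||M HM] := @lists_bound R s (fun l M => forall x, `|partials l g x| <= M) m.
  by move=> l M M' HM MM' x; exact: le_trans (HM x) MM'.
  by move=> l; exact: test_function_bounded.
have M0 : 0 < `|M| + 1 by rewrite ltr_wpDl.
exists (d / (`|M| + 1)) => [|z zd]; first by rewrite divr_gt0.
apply/WV/H.
  split; first exact: smoothM.
  by move=> x /= /negP; rewrite subr0 -ltNge => rx; rewrite gr// mulr0.
move=> al alm x; rewrite /mpartial partialsM// normCM.
rewrite ler_pdivlMr// in zd; apply: le_trans zd; rewrite ler_wpM2l//.
rewrite (le_trans (HM _ _ x)) ?size_midx_dirs//.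
by rewrite (le_trans (ler_norm _))// lerDl.
Qed.

Lemma is_LF_derive_scalar (X : normedModType R) (c : X -> C) (x v : X) (c' : C) (g : fn) :
  D g -> is_derive x v c c' -> is_LF_derive setT (fun y xi => c y * g xi) x v (fun xi => c' * g xi).
Proof.
move=> Dg /is_deriveP cd; split; first exact: test_functionM.
move=> V nV; have [d d0 Hd] := LF_nbhs0_small_scale nV Dg.
have [d' d'0 Hd'] := cd _ d0; apply/near0P; exists d' => // h hd h0.
have -> : h^-1 *: ((fun xi => c (h *: v + x) * g xi) - (fun xi => c x * g xi)) - (fun xi => c' * g xi) =
    (fun xi => (h^-1 *: (c (h *: v + x) - c x - h *: c') : C) * g xi) :> fn.
  apply/funext => xi; rewrite !fctE -!mulrBl scalerMC -mulrBl; congr (_ * _).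
  by rewrite [in RHS]scalerBr scalerA mulVf// scale1r.
apply: Hd; rewrite normrZ normfV ler_pdivrMl ?normr_gt0// mulrC; exact: Hd'.
Qed.

Lemma is_LF_derive_cst (X : normedModType R) (g : fn) (x v : X) :
  is_LF_derive setT (fun=> g) x v 0.
Proof.
split; first exact: test_function0.
move=> V [W [_ _ _ WK] WV]; apply/near0P; exists 1 => // h _ _.
rewrite subrr scaler0 subr0; apply: WV.
have [m [d [d0 H]]] := WK _ (@ball_compact R s 0 0) (fun _ _ => I).
apply: H; first by split=> //; exact: smooth0.
by move=> al _ y; rewrite /mpartial (jet_partials (@is_jet0 R s C setT)) normr0 ltW.
Qed.

Lemma is_LF_derive_sum (X : normedModType R) (n : nat) (f : 'I_n -> X -> fn) (x v : X) (l : 'I_n -> fn) :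
  (forall i, is_LF_derive setT (f i) x v (l i)) ->
  is_LF_derive setT (fun y => \sum_i f i y) x v (\sum_i l i).
Proof.
elim: n f l => [|n IH] f l H.
  rewrite big_ord0; have := @is_LF_derive_cst X 0 x v; apply: is_LF_derive_local ltr01 _.
  by move=> h _; rewrite big_ord0.
rewrite big_ord_recr /=.
have := is_LF_deriveD (IH _ _ (fun i => H (widen_ord (leqnSn n) i))) (H ord_max).
by apply: is_LF_derive_local ltr01 _ => h _; rewrite big_ord_recr.
Qed.

(** If all supports lie in one compact set, the difference quotients stay in one
D_K, where uniform convergence of each derivative is sufficient. *)
Lemma is_LF_derive_criterion (X : normedModType R) (f : X -> fn) (x v : X) (l : fn) (d r : R) :
  0 < d -> (forall h : R, `|h| < d -> smooth (f (h *: v + x)) /\ forall xi, r < `|xi| -> f (h *: v + x) xi = 0) ->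
  smooth l -> (forall xi, r < `|xi| -> l xi = 0) ->
  (forall L e, 0 < e -> exists2 d', 0 < d' & forall h : R, `|h| < d' -> `|h| < d -> forall xi,
     `|partials L (f (h *: v + x)) xi - partials L (f x) xi - h *: partials L l xi| <= e * `|h|) ->
  is_LF_derive setT f x v l.
Proof.
move=> d0 Hf ls lr Hq; split; first by apply/test_functionP; split=> //; exists r.
move=> V [W [_ _ _ WK] WV].
have [m [e [e0 H]]] := WK _ (@ball_compact R s 0 r) (fun _ _ => I).
have [||M HM] := @lists_bound R s (fun L M => exists2 d', 0 < d' & 1 <= M * d' /\ forall h : R, `|h| < d' -> `|h| < d -> forall xi,
     `|partials L (f (h *: v + x)) xi - partials L (f x) xi - h *: partials L l xi| <= e * `|h|) m.
- move=> L M M' [d' d'0 [Md' Hd']] MM'; exists d' => //; split=> //.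
  by rewrite (le_trans Md')// ler_wpM2r// ltW.
- move=> L; have [d' d'0 Hd'] := Hq L e e0; exists d'^-1, d' => //; split=> //.
  by rewrite mulVf ?gt_eqF.
have M0 : 0 < `|M| + 1 by rewrite ltr_wpDl.
apply/near0P; exists (Num.min d (`|M| + 1)^-1); first by rewrite lt_min d0 invr_gt0.
move=> h; rewrite lt_min => /andP[hd hM] h0.
have Hx := Hf 0; rewrite scale0r add0r normr0 in Hx; have [fs fr] := Hx d0.
have [hs hr] := Hf h hd.
apply/WV/H.
  split; first by apply: smoothB => //; apply: smoothZ; exact: smoothB.
  move=> xi /= /negP; rewrite subr0 -ltNge => rx.
  by rewrite !fctE hr// fr// lr// !subrr scaler0 subr0.
move=> al alm xi; rewrite /mpartial partialsB//; last by apply: smoothZ; exact: smoothB.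
rewrite partialsZ; last exact: smoothB.
rewrite partialsB// !fctE.
have [|d' d'0 [Md' /(_ h) Hd']] := HM (midx_dirs al); first by rewrite size_midx_dirs.
have hd' : `|h| < d'.
  apply: (lt_le_trans hM); rewrite -div1r ler_pdivrMr// (le_trans Md')// mulrC ler_wpM2l ?(ltW d'0)//.
  by rewrite (le_trans (ler_norm _))// lerDl.
have nh : 0 < `|h| by rewrite normr_gt0.
have := Hd' hd' hd xi; set a := partials _ _ _; set b := partials _ _ _; set c := partials _ _ _ => Q.
have -> : h^-1 *: (a - b) - c = h^-1 *: (a - b - h *: c).
  by rewrite [in RHS]scalerBr scalerA mulVf// scale1r.
by rewrite normrZ normfV ler_pdivrMl// mulrC.
Qed.

End LFDerive.

(** * Mixed derivatives of maps into the test functions *)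

Section LFMixed.
Variables (R : realType) (s : nat).
Local Notation E := 'rV[R]_s.
Local Notation C := (Rcomplex R).
Local Notation fn := (E -> C).
Local Notation e_ i := (delta_mx 0 i : E).
Local Notation D := (@test_functions R s setT).

(** Completeness of D_K for geometrically convergent sequences. The limits of the
derivatives form a jet because Taylor's formula with uniformly bounded second
derivatives passes to the limit. *)
Lemma geo_limit_smooth (f : nat -> fn) (v : seq 'I_s -> fn) (K : seq 'I_s -> R) (r : R) :
  (forall k, smooth (f k)) -> (forall k xi, r < `|xi| -> f k xi = 0) ->
  (forall l k xi, `|partials l (f k) xi - v l xi| <= K l * (3 / 4) ^+ k) ->
  [/\ smooth (v [::]), forall l, partials l (v [::]) = v l &
      forall xi, r < `|xi| -> v [::] xi = 0].
Proof.
move=> fs fr fv.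
have q1 k : (3 / 4) ^+ k <= 1 :> R by rewrite exprn_ile1//; lra.
have K0 l : 0 <= K l by have := le_trans (normr_ge0 _) (fv l 0%N 0); rewrite expr0 mulr1.
have bd l : exists M, forall k xi, `|partials l (f k) xi| <= M.
  have Df : D (f 0%N) by apply/test_functionP; split=> //; exists r => xi; exact: fr.
  have [M HM] := test_function_bounded l Df.
  exists (M + (K l + K l)) => k xi.
  have -> : partials l (f k) xi = partials l (f 0%N) xi +
    ((partials l (f k) xi - v l xi) - (partials l (f 0%N) xi - v l xi)) by ring.
  apply: le_trans (ler_normD _ _) _; apply: lerD; first exact: HM.
  apply: le_trans (ler_normB _ _) _.
  by apply: lerD; apply: le_trans (fv _ _ _) _; rewrite ler_piMr.
have vj : is_jet setT v.
  move=> l i x _; have [M HM] := bd [:: i, i & l].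
  apply: (@is_derive_quad _ _ _ _ _ _ _ (4 * M)) ltr01 _ => h h1.
  apply: (@le_geo _ _ _ (K l + K l + `|h| * K (i :: l))) => k.
  have D0 (t : R) : is_derive t 1 (fun t : R => partials l (f k) (t *: e_ i + x)) (partials (i :: l) (f k) (t *: e_ i + x)).
    exact: (is_derive_line _ _ _ _ _).1 (smooth_is_derive l i _ (fs k)).
  have D1 (t : R) : is_derive t 1 (fun t : R => partials (i :: l) (f k) (t *: e_ i + x)) (partials [:: i, i & l] (f k) (t *: e_ i + x)).
    exact: (is_derive_line _ _ _ _ _).1 (smooth_is_derive (i :: l) i _ (fs k)).
  have z1 : `|0 : R| < 1 by rewrite normr0.
  have T := taylor1_ball z1 h1 (fun t _ => D0 t) (fun t _ => D1 t) (fun t _ => HM k (t *: e_ i + x)).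
  rewrite subr0 scale0r add0r in T.
  set a := partials l (f k) _ in T; set b := partials l (f k) _ in T; set c := partials _ (f k) _ in T.
  have -> : v l (h *: e_ i + x) - v l x - h *: v (i :: l) x = (a - b - h *: c) -
     ((a - v l (h *: e_ i + x)) - (b - v l x) - h *: (c - v (i :: l) x)).
    by rewrite scalerBr; ring.
  apply: le_trans (ler_normB _ _) _; apply: lerD => //.
  rewrite (mulrDl (K l + K l)) (mulrDl (K l)); apply: le_trans (ler_normB _ _) _; apply: lerD.
    by apply: le_trans (ler_normB _ _) _; apply: lerD; exact: fv.
  by rewrite normrZ -mulrA ler_wpM2l// fv.
have vc l : continuous (v l).
  apply/continuousE_norm => x e e0.
  have K1 : 0 < 4 * (K l + 1) by rewrite mulr_gt0// ltr_wpDl.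
  have q01 : 0 <= (3 / 4 : R) < 1 by lra.
  have [k hk] := exists_expr_lt q01 (divr_gt0 e0 K1).
  have [/continuousE_norm fc _] := fs k l.
  have e2 : 0 < e / 2 by rewrite divr_gt0.
  have [d d0 Hd] := fc x _ e2.
  exists d => // y /Hd yd.
  have -> : v l y - v l x = (partials l (f k) y - partials l (f k) x) -
     ((partials l (f k) y - v l y) - (partials l (f k) x - v l x)) by ring.
  apply: le_lt_trans (ler_normB _ _) _; rewrite [ltRHS]splitr; apply: ltr_leD => //.
  apply: le_trans (ler_normB _ _) _.
  apply: le_trans (lerD (fv l k y) (fv l k x)) _.
  rewrite ltr_pdivlMr// in hk.
  have : K l * (3 / 4) ^+ k <= (K l + 1) * (3 / 4) ^+ k.
    by rewrite ler_wpM2r ?lerDl// exprn_ge0// divr_ge0.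
  by rewrite mulrCA [_ * (K l + 1)]mulrC in hk; lra.
split; [exact: jet_smooth|exact: jet_partials|].
move=> xi rxi; apply/eqP; rewrite -normr_le0.
apply: (@le_geo _ _ _ (K [::])) => k; rewrite add0r.
by have := fv [::] k xi; rewrite /= fr// sub0r normrN.
Qed.

(** The scalar result applies to all the functions
(t, u) |-> partials L (T m (P t u)) xi, where P t u runs through the plane spanned
by e_i and e_j. As its constants do not depend on xi, the difference quotients
converge uniformly in xi, and the limits are test functions by completeness. *)
Lemma LF_mixed_derivatives (O : set E) (i j : 'I_s) (T : nat -> E -> fn) (U1 U2 : E -> fn) :
  open O ->
  (forall n x, O x -> is_LF_derive setT (T n) x (e_ i) (T n.+1 x)) ->
  (forall x, O x -> is_LF_derive setT (T 0%N) x (e_ j) (U1 x)) ->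
  (forall x, O x -> is_LF_derive setT U1 x (e_ j) (U2 x)) ->
  (forall n K, compact K -> K `<=` O -> LF_bounded setT [set T n x | x in K]) ->
  (forall K, compact K -> K `<=` O -> LF_bounded setT [set U2 x | x in K]) ->
  forall n x, O x ->
    is_LF_derive setT (T n) x (e_ j) (LF_derive setT (T n) x (e_ j)) /\
    is_LF_derive setT (fun x => LF_derive setT (T n) x (e_ j)) x (e_ i)
      (LF_derive setT (T n.+1) x (e_ j)).
Proof.
move=> oO hT hU1 hU2 bT bU2 n x0 Ox0.
have [rho rho0 Hrho] := open_ball oO Ox0.
pose r := Num.min 1 (rho / 4).
have r01 : 0 < r <= 1 by rewrite lt_min ltr01 divr_gt0//= ge_min lexx.
have r0 : 0 < r by case/andP: r01.
have rrho : 2 * r <= rho / 2.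
  have : r <= rho / 4 by rewrite ge_min lexx orbT.
  lra.
pose K := [set x : E | `|x - x0| <= rho / 2].
have cK : compact K by exact: ball_compact.
have KO : K `<=` O by move=> x /= xK; apply: Hrho; apply: le_lt_trans xK _; lra.
pose P (t u : R) := x0 + t *: e_ i + u *: e_ j.
have PK (t u : R) : `|t| < r -> `|u| < r -> K (P t u).
  move=> tr ur; rewrite /K/= /P addrAC [x0 + _]addrC addrK.
  apply: le_trans (ler_normD _ _) _; apply: le_trans rrho.
  rewrite mulr2n mulrDl mul1r; apply: lerD; apply: le_trans (norm_delta_scale _ _) (ltW _) => //.
have PO (t u : R) : `|t| < r -> `|u| < r -> O (P t u) by move=> ? ?; apply/KO/PK.
have Tbd m L : exists M, forall x, K x -> forall xi, `|partials L (T m x) xi| <= M.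
  have [M HM] := LF_bounded_partials L (bT m K cK KO).
  by exists M => x Kx; apply: HM; exists x.
have Ubd L : exists M, forall x, K x -> forall xi, `|partials L (U2 x) xi| <= M.
  have [M HM] := LF_bounded_partials L (bU2 K cK KO).
  by exists M => x Kx; apply: HM; exists x.
have [supp Hsupp] : exists S : nat -> R, forall m x, K x -> forall xi, S m < `|xi| -> T m x xi = 0.
  have /choice[S HS] : forall m, exists q : R, forall x, K x -> forall xi, q < `|xi| -> T m x xi = 0.
    move=> m; have [q Hq] := LF_bounded_support (bT m K cK KO).
    by exists q => x Kx; apply: Hq; exists x.
  by exists S.
have sgl x : O x -> compact [set x] /\ [set x] `<=` O.
  by move=> Ox; split; [exact: compact_set1|move=> _ ->].
have DT m x : O x -> D (T m x).
  by move=> /sgl[c1 c2]; have [+ _] := bT m _ c1 c2; apply; exists x.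
have DU1 x : O x -> D (U1 x) by move=> /hU1[].
have near_dir x k : O x -> exists2 d, 0 < d & forall h : R, `|h| < d -> O (h *: e_ k + x).
  move=> Ox; have [d d0 Hd] := open_ball oO Ox; exists d => // h hd.
  by apply: Hd; rewrite addrK; exact: le_lt_trans (norm_delta_scale _ _) hd.
have functional (f g : E -> fn) L xi k x : O x -> (forall y, O y -> D (f y)) ->
    is_LF_derive setT f x (e_ k) (g x) ->
    is_derive x (e_ k) (fun y => partials L (f y) xi) (partials L (g x) xi).
  move=> Ox Df fg; have [d d0 Hd] := near_dir x k Ox.
  apply: (is_LF_derive_functional (LF_continuous_partials L xi) d0 _ fg) => h hd.
  exact/Df/Hd.
pose h L xi m t u := partials L (T m (P t u)) xi.
pose g1 L xi t u := partials L (U1 (P t u)) xi.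
pose g2 L xi t u := partials L (U2 (P t u)) xi.
have /choice[A HA] : forall mL : nat * seq 'I_s, exists M, forall x, K x -> forall xi, `|partials mL.2 (T mL.1 x) xi| <= M.
  by move=> [m L]; exact: Tbd.
have /choice[A' HA'] := Ubd.
have data L xi : mixed_data r (fun m => A (m, L)) (A' L) (h L xi) (g1 L xi) (g2 L xi).
  split.
  - move=> m t u tr ur.
    apply: (@is_derive_plane_l _ _ _ (fun y => partials L (T m y) xi) (fun y => partials L (T m.+1 y) xi)).
    by apply: functional; [exact: PO|exact: DT|apply: hT; exact: PO].
  - move=> t u tr ur.
    apply: (@is_derive_plane_r _ _ _ (fun y => partials L (T 0%N y) xi) (fun y => partials L (U1 y) xi)).
    by apply: functional; [exact: PO|exact: DT|apply: hU1; exact: PO].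
  - move=> t u tr ur.
    apply: (@is_derive_plane_r _ _ _ (fun y => partials L (U1 y) xi) (fun y => partials L (U2 y) xi)).
    by apply: functional; [exact: PO|exact: DU1|apply: hU2; exact: PO].
  - by move=> m t u tr ur; exact: (HA (m, L) _ (PK t u tr ur)).
  - by move=> t u tr ur; exact: (HA' L _ (PK t u tr ur)).
have /choice[Er HE] := fun L => mixed_derivatives (fun m => A (m, L)) (A' L) r01.
have /choice[w Hw] : forall Lxi : seq 'I_s * E, exists w : nat -> R -> C,
    (forall m (t B : R), `|t| < r -> `|B| < r ->
        `|h Lxi.1 Lxi.2 m t B - h Lxi.1 Lxi.2 m t 0 - B *: w m t| <= Er Lxi.1 m * (`|B| * Num.sqrt `|B|)) /\
    (forall m (t a : R), `|t| < r -> `|a| < r ->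
        `|w m a - w m t - (a - t) *: w m.+1 t| <= Er Lxi.1 m * (a - t) ^+ 2).
  by move=> [L xi]; have [w [_ ? ?]] := HE L _ _ _ (data L xi); exists w.
have wh L xi m (t B : R) : `|t| < r -> `|B| < r ->
    `|h L xi m t B - h L xi m t 0 - B *: w (L, xi) m t| <= Er L m * (`|B| * Num.sqrt `|B|).
  by move=> tr Br; exact: (Hw (L, xi)).1.
have ww L xi m (t a : R) : `|t| < r -> `|a| < r ->
    `|w (L, xi) m a - w (L, xi) m t - (a - t) *: w (L, xi) m.+1 t| <= Er L m * (a - t) ^+ 2.
  by move=> tr ar; exact: (Hw (L, xi)).2.
have zr : `|0 : R| < r by rewrite normr0.
have Psm m t u : `|t| < r -> `|u| < r -> smooth (T m (P t u)).
  by move=> tr ur; apply/test_function_smooth/DT/PO.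
have lim m (t : R) : `|t| < r ->
    [/\ smooth (fun xi => w ([::], xi) m t),
        forall l, partials l (fun xi => w ([::], xi) m t) = (fun xi => w (l, xi) m t) &
        forall xi, supp m < `|xi| -> w ([::], xi) m t = 0].
  move=> tr; pose B (k : nat) : R := r / 2 / 2 ^+ k.
  have B0 k : 0 < B k by rewrite !divr_gt0// exprn_gt0.
  have Br k : `|B k| < r.
    rewrite gtr0_norm// /B; apply: (@le_lt_trans _ _ (r / 2)); last by lra.
    by rewrite ler_pdivrMr ?exprn_gt0// ler_peMr ?divr_ge0 ?(ltW r0)// exprn_ege1// ler1n.
  apply: (@geo_limit_smooth (fun k => (B k)^-1 *: (T m (P t (B k)) - T m (P t 0)))
      (fun l xi => w (l, xi) m t) (fun l => Er l m * Num.sqrt (r / 2)) (supp m)).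
  - by move=> k; apply: smoothZ; apply: smoothB; exact: Psm.
  - by move=> k xi sxi; rewrite !fctE !(Hsupp m)// ?subrr ?scaler0//; exact: PK.
  - move=> l k xi.
    rewrite partialsZ; last by apply: smoothB; exact: Psm.
    rewrite partialsB; [|exact: Psm|exact: Psm].
    have := wh l xi m t (B k) tr (Br k); rewrite !fctE.
    rewrite /h; set a := partials _ _ _; set b := partials _ _ _; set c := w _ _ _ => H.
    have -> : (B k)^-1 *: (a - b) - c = (B k)^-1 *: (a - b - B k *: c).
      by rewrite [in RHS]scalerBr scalerA mulVf ?gt_eqF// scale1r.
    rewrite normrZ normfV gtr0_norm// ler_pdivrMl//; apply: le_trans H _.
    have E0 : 0 <= Er l m.
      have := le_trans (normr_ge0 _) (wh l xi m t (B k) tr (Br k)).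
      by rewrite pmulr_lge0// mulr_gt0// ?sqrtr_gt0 normr_gt0 gt_eqF.
    rewrite gtr0_norm// mulrCA ler_pM2l// -mulrA ler_wpM2l//.
    by rewrite sqrt_half// divr_ge0// ltW.
pose V m t : fn := fun xi => w ([::], xi) m t.
have VE m (t : R) : `|t| < r -> is_LF_derive setT (T m) (P t 0) (e_ j) (V m t).
  move=> tr; have [Vs Vp V0] := lim m t tr.
  have PE B : B *: e_ j + P t 0 = P t B by rewrite /P scale0r addr0 addrC.
  apply: (@is_LF_derive_criterion _ _ _ _ _ _ _ r (supp m)) r0 _ Vs V0 _.
    move=> B Br; rewrite PE; split; first exact: Psm.
    by apply: Hsupp; exact: PK.
  move=> L e e0.
  have [d d0 Hd] := three_halves_small (Er L m) e0; exists d => // B Bd Br xi.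
  by rewrite PE Vp; apply: le_trans (wh L xi m t B tr Br) _; exact: Hd.
have VD m (t : R) : `|t| < r -> LF_derive setT (T m) (P t 0) (e_ j) = V m t.
  by move=> tr; exact/is_LF_deriveE/VE.
have P00 : P 0 0 = x0 by rewrite /P !scale0r !addr0.
have D0 : is_LF_derive setT (T n) x0 (e_ j) (V n 0) by rewrite -P00; exact: VE.
have -> : LF_derive setT (T n) x0 (e_ j) = V n 0 by exact: is_LF_deriveE.
split=> //.
have -> : LF_derive setT (T n.+1) x0 (e_ j) = V n.+1 0 by rewrite -P00; exact: VD.
have PE t : t *: e_ i + x0 = P t 0 by rewrite /P scale0r addr0 addrC.
have [Vs1 Vp1 V01] := lim n.+1 0 zr.
pose q := Num.max (supp n) (supp n.+1).
apply: (@is_LF_derive_criterion _ _ _ _ _ _ _ r q) r0 _ Vs1 _ _.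
- move=> t tr; rewrite PE VD//; have [Vs Vp V0] := lim n t tr; split=> // xi.
  by rewrite gt_max => /andP[? _]; exact: V0.
- by move=> xi; rewrite gt_max => /andP[_ ?]; exact: V01.
- move=> L e e0.
  have E0 : 0 < `|Er L n| + 1 by rewrite ltr_wpDl.
  exists (e / (`|Er L n| + 1)); first by rewrite divr_gt0.
  move=> t te tr xi; rewrite PE VD// -P00 VD// Vp1.
  have [_ -> _] := lim n t tr; have [_ -> _] := lim n 0 zr.
  have := ww L xi n 0 t zr tr; rewrite subr0 => /le_trans; apply.
  rewrite -real_normK ?num_real// expr2 mulrA ler_wpM2r//.
  apply: (@le_trans _ _ ((`|Er L n| + 1) * `|t|)).
    by rewrite ler_wpM2r// (le_trans (ler_norm _))// lerDl.
  by rewrite mulrC -ler_pdivlMr// ltW.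
Qed.

End LFMixed.

(** * Smooth curves and a bump function *)

Section SmoothCurves.
Variable R : realType.

Lemma telescope3 (W : zmodType) (P Y Z U Q V : W) :
  (P - Y - Z) + (Z - U) + (Y - Q - V) = P - Q - (U + V).
Proof.
by rewrite subrKA [P - Y + _]addrAC -[Y - Q + _]addrA subrKA opprD !addrA [P - U - Q]addrAC.
Qed.

Lemma is_derive_bilinear (V X Y W : normedModType R) (B : X -> Y -> W)
    (f : V -> X) (g : V -> Y) (x v : V) (f' : X) (g' : Y) :
  (forall a b y, B (a - b) y = B a y - B b y) ->
  (forall a y z, B a (y - z) = B a y - B a z) ->
  (forall k a y, B (k *: a) y = k *: B a y) ->
  (forall k a y, B a (k *: y) = k *: B a y) ->
  (forall a y, `|B a y| <= `|a| * `|y|) ->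
  is_derive x v f f' -> is_derive x v g g' ->
  is_derive x v (fun y => B (f y) (g y)) (B f' (g x) + B (f x) g').
Proof.
move=> B1 B2 B3 B4 BN /is_deriveP fd /is_deriveP gd; apply/is_deriveP => e e0.
pose a := `|g'| + 1; have a0 : 0 < a by rewrite ltr_wpDl.
pose b := `|g x| + a; have b0 : 0 < b by rewrite ltr_wpDl.
pose c := `|f'| + 1; have c0 : 0 < c by rewrite ltr_wpDl.
pose k := `|f x| + 1; have k0 : 0 < k by rewrite ltr_wpDl.
have e3 : 0 < e / 3 by rewrite divr_gt0.
have [d1 d10 H1] := fd _ (divr_gt0 e3 b0).
have [d2 d20 H2] := gd _ (divr_gt0 e3 k0).
have [d3 d30 H3] := gd _ ltr01.
exists (Num.min (Num.min d1 d2) (Num.min d3 (Num.min 1 (e / 3 / (c * a))))).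
  by rewrite !lt_min d10 d20 d30 ltr01 !divr_gt0// mulr_gt0.
move=> h; rewrite !lt_min => /andP[/andP[hd1 hd2] /andP[hd3 /andP[h1 he]]].
have {}H1 := H1 _ hd1; have {}H2 := H2 _ hd2; have {}H3 := H3 _ hd3.
set fh := f (h *: v + x) in H1 *; set gh := g (h *: v + x) in H2 H3 *.
have G1 : `|gh - g x| <= a * `|h|.
  rewrite -[gh - g x](subrK (h *: g')) (le_trans (ler_normD _ _))// addrC /a mulrDl.
  by rewrite lerD// normrZ mulrC.
have G2 : `|gh| <= b.
  rewrite -[gh](subrK (g x)) addrC (le_trans (ler_normD _ _))// lerD//.
  by rewrite (le_trans G1)// ler_piMr ?(ltW a0) ?(ltW h1).
have -> : B fh gh - B (f x) (g x) - h *: (B f' (g x) + B (f x) g') =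
   B (fh - f x - h *: f') gh + B (h *: f') (gh - g x) + B (f x) (gh - g x - h *: g').
  by rewrite !B1 !B2 !B3 !B4 telescope3 scalerDr.
have -> : e * `|h| = e / 3 * `|h| + e / 3 * `|h| + e / 3 * `|h| by field.
apply: le_trans (ler_normD _ _) _; apply: lerD; first (apply: le_trans (ler_normD _ _) _; apply: lerD).
- apply: le_trans (BN _ _) _.
  apply: (@le_trans _ _ (e / 3 / b * `|h| * b)); first by rewrite ler_pM.
  by rewrite mulrAC divfK ?gt_eqF.
- apply: le_trans (BN _ _) _; rewrite normrZ.
  apply: (@le_trans _ _ ((`|h| * c) * (a * `|h|))).
    by rewrite ler_pM// ler_wpM2l// lerDl.
  have -> : `|h| * c * (a * `|h|) = `|h| * (c * a) * `|h| by ring.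
  by rewrite ler_wpM2r// -ler_pdivlMr ?mulr_gt0// ltW.
- apply: le_trans (BN _ _) _.
  apply: (@le_trans _ _ (k * (e / 3 / k * `|h|))); first by rewrite ler_pM// lerDl.
  by rewrite mulrA mulrCA divff ?gt_eqF// mulr1.
Qed.

Lemma is_derive_mulC (V : normedModType R) (f g : V -> Rcomplex R) (x v : V) (f' g' : Rcomplex R) :
  is_derive x v f f' -> is_derive x v g g' ->
  is_derive x v (fun y => f y * g y : Rcomplex R) (f' * g x + f x * g' : Rcomplex R).
Proof.
apply: (@is_derive_bilinear _ _ _ _ (fun a b : Rcomplex R => a * b : Rcomplex R)).
- by move=> a b y; rewrite mulrBl.
- by move=> a b y; rewrite mulrBr.
- by move=> k a y; rewrite scalerMC.
- by move=> k a y; rewrite scalerMCr.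
- by move=> a y; rewrite normCM.
Qed.

Lemma is_derive_scale (V W : normedModType R) (f : V -> R) (g : V -> W) (x v : V) (f' : R) (g' : W) :
  is_derive x v f f' -> is_derive x v g g' ->
  is_derive x v (fun y => f y *: g y) (f' *: g x + f x *: g').
Proof.
apply: (@is_derive_bilinear _ _ _ _ (fun (a : R) (b : W) => a *: b)).
- by move=> a b y; rewrite scalerBl.
- by move=> a b y; rewrite scalerBr.
- by move=> k a y; rewrite scalerA.
- by move=> k a y; rewrite !scalerA mulrC.
- by move=> a y; rewrite normrZ.
Qed.

Lemma is_derive_linear (V X Y : normedModType R) (L : X -> Y) (f : V -> X) (x v : V) (f' : X) :
  (forall a b, L (a - b) = L a - L b) -> (forall k a, L (k *: a) = k *: L a) ->
  (forall a, `|L a| <= `|a|) ->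
  is_derive x v f f' -> is_derive x v (fun y => L (f y)) (L f').
Proof.
move=> LB LZ LN /is_deriveP H; apply/is_deriveP => e /H[d d0 {}H]; exists d => // h /H.
by apply: le_trans; rewrite -LZ -!LB; exact: LN.
Qed.

Lemma is_derive_ext (V W : normedModType R) (f g : V -> W) (x v : V) (l l' : W) :
  (forall y, f y = g y) -> l = l' -> is_derive x v f l -> is_derive x v g l'.
Proof. by move=> fg <-; apply: is_derive_local ltr01 _ => h _. Qed.

(** Differentiability to finite order, in the inductive form that makes its
closure properties follow from those of the first derivative. *)
Fixpoint Cn (W : normedModType R) (n : nat) (f : R -> W) : Prop :=
  if n is m.+1 then exists2 f', (forall t : R, is_derive t 1 f (f' t)) & Cn m f' else True.

Lemma CnS (W : normedModType R) n (f : R -> W) : Cn n.+1 f -> Cn n f.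
Proof. by elim: n f => // n IH f [f' fd /IH]; exists f'. Qed.

Lemma smooth_curveP (W : normedModType R) (f : R -> W) : smooth_curve f <-> forall n, Cn n f.
Proof.
split=> [fs n|H n t].
  suff H m : Cn n (derive1n m f) by exact: (H 0%N).
  elim: n m => // n IH m; exists (derive1n m.+1 f); last exact: IH.
  by move=> t; rewrite derive1nS derive1E; exact/derivableP/fs.
elim: n f H t => [|n IH] f H t; first by have [f' fd _] := H 1%N; have [] := fd t.
rewrite derive1Sn; apply: IH => m; have [f' fd mf'] := H m.+1.
suff -> : derive1 f = f' by [].
by apply/funext => u; rewrite derive1E; have [_ ->] := fd u.
Qed.

Lemma smooth_curve_seq (W : normedModType R) (d : nat -> R -> W) :
  (forall n (t : R), is_derive t 1 (d n) (d n.+1 t)) -> smooth_curve (d 0%N).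
Proof.
move=> H; apply/smooth_curveP => n.
suff K m : Cn n (d m) by exact: K.
elim: n m => // n IH m; exists (d m.+1); [exact: H|exact: IH].
Qed.

Lemma Cn_ext (W : normedModType R) n (f g : R -> W) : f =1 g -> Cn n f -> Cn n g.
Proof. by move=> /funext ->. Qed.

Lemma Cn_cst (W : normedModType R) n (a : W) : Cn n (fun _ : R => a).
Proof.
elim: n a => // n IH a; exists (fun=> 0); last exact: IH.
by move=> t; exact: is_derive_cst.
Qed.

Lemma Cn_id n : Cn n (fun t : R => t).
Proof.
case: n => // n; exists (fun=> 1); last exact: Cn_cst.
by move=> t; exact: is_derive_id.
Qed.

Lemma CnD (W : normedModType R) n (f g : R -> W) : Cn n f -> Cn n g -> Cn n (fun t => f t + g t).
Proof.
elim: n f g => // n IH f g [f' fd nf] [g' gd ng].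
exists (fun t => f' t + g' t); last exact: IH.
by move=> t; exact: is_deriveD.
Qed.

Lemma Cn_scale (W : normedModType R) n (f : R -> R) (g : R -> W) :
  Cn n f -> Cn n g -> Cn n (fun t => f t *: g t).
Proof.
elim: n f g => // n IH f g nf ng; have mf := CnS nf; have mg := CnS ng.
case: nf ng => f' fd nf [g' gd ng].
exists (fun t => f' t *: g t + f t *: g' t); last by apply: CnD; exact: IH.
by move=> t; exact: is_derive_scale.
Qed.

Lemma Cn_mulC n (f g : R -> Rcomplex R) : Cn n f -> Cn n g -> Cn n (fun t => f t * g t : Rcomplex R).
Proof.
elim: n f g => // n IH f g nf ng; have mf := CnS nf; have mg := CnS ng.
case: nf ng => f' fd nf [g' gd ng].
exists (fun t => f' t * g t + f t * g' t : Rcomplex R); last first.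
  by apply: (@CnD (Rcomplex R)); exact: IH.
by move=> t; exact: is_derive_mulC.
Qed.

Lemma Cn_linear (X Y : normedModType R) (L : X -> Y) n (f : R -> X) :
  (forall a b, L (a - b) = L a - L b) -> (forall k a, L (k *: a) = k *: L a) ->
  (forall a, `|L a| <= `|a|) -> Cn n f -> Cn n (fun t => L (f t)).
Proof.
move=> LB LZ LN; elim: n f => // n IH f [f' fd nf].
exists (fun t => L (f' t)); last exact: IH.
by move=> t; exact: is_derive_linear.
Qed.

Lemma Cn_comp n (f g : R -> R) : Cn n f -> Cn n g -> Cn n (fun t => f (g t)).
Proof.
elim: n f g => // n IH f g nf ng; have mf := CnS nf; have mg := CnS ng.
case: nf ng => f' fd nf [g' gd ng].
exists (fun t => f' (g t) *: g' t).
  by move=> t; apply: is_derive_ext (is_derive1_comp (fd (g t)) (gd t)).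
by apply: (@Cn_scale R); [exact: IH|].
Qed.

Lemma smooth_curve_local (W : normedModType R) (c : R -> W) :
  (forall t, exists2 c', smooth_curve c' & exists2 d, 0 < d & forall u, `|u - t| < d -> c u = c' u) ->
  smooth_curve c.
Proof.
move=> H.
have loc n (t : R) c' : (\forall u \near t, c u = c' u) ->
    \forall u \near t, derive1n n c u = derive1n n c' u.
  move=> cc'; elim: n => [|n IH]; first exact: cc'.
  have := nbhs_interior IH; apply: filterS => u.
  by rewrite !derive1nS !derive1E; exact: near_eq_derive.
move=> n t; have [c' c's [d d0 Hd]] := H t.
have nr : \forall u \near t, c' u = c u.
  apply/nbhs_ballP; exists d => // u; rewrite /ball/= => ut.
  by rewrite Hd// distrC.
apply: near_eq_derivable (c's n t).
have nr' : \forall u \near t, c u = c' u by apply: filterS nr.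
by apply: filterS (loc n t c' nr').
Qed.

(** The derivatives of exp(-1/t), extended by 0 to t <= 0, are linear combinations
of these functions. *)
Definition flat (k : nat) (t : R) : R :=
  if 0 < t then t ^- k * expR (- t^-1) else 0.

(** The exponential of 1/t exceeds its Taylor term of order k + 2. *)
Lemma flat_small k (t : R) : `|flat k t| <= (k.+2)`!%:R * t ^+ 2.
Proof.
rewrite /flat; case: ifPn => [t0|_]; last by rewrite normr0 mulr_ge0 ?sqr_ge0.
have tk : 0 < t ^+ k by rewrite exprn_gt0.
rewrite ger0_norm; last by rewrite mulr_ge0 ?invr_ge0 ?expR_ge0// ltW.
rewrite expRN -invfM -div1r ler_pdivrMr ?mulr_gt0 ?expR_gt0//.
have ti0 : 0 <= t^-1 by rewrite invr_ge0 ltW.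
have := expR_ge1Dxn k.+1 ti0 => H.
have {}H : t^-1 ^+ k.+2 / (k.+2)`!%:R <= expR t^-1 by apply: le_trans H; rewrite lerDr.
have f0 : 0 < (k.+2)`!%:R :> R by rewrite ltr0n fact_gt0.
apply: (@le_trans _ _ ((k.+2)`!%:R * t ^+ 2 * (t ^+ k * (t^-1 ^+ k.+2 / (k.+2)`!%:R)))).
  rewrite le_eqVlt; apply/orP; left; apply/eqP.
  by rewrite !exprVn !exprS; field; rewrite !gt_eqF.
apply: ler_wpM2l; first by rewrite mulr_ge0 ?sqr_ge0 ?(ltW f0).
by apply: ler_wpM2l => //; exact: ltW.
Qed.

Lemma is_derive_flat k (t : R) :
  is_derive t 1 (flat k) (flat k.+2 t - k%:R * flat k.+1 t).
Proof.
have [t0|t0|->] := ltgtP t 0.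
- have -> : flat k.+2 t - k%:R * flat k.+1 t = 0.
    by rewrite /flat ltNge (ltW t0) /= mulr0 subr0.
  have d0 : 0 < - t by rewrite oppr_gt0.
  apply: (is_derive_local d0 _ (is_derive_cst (0 : R) t 1)) => h hd; rewrite /flat ifN// -leNgt [h *: 1]mulr1.
  by rewrite -lerBrDr sub0r ltW// (le_lt_trans (ler_norm _)).
- have tn0 : t != 0 by rewrite gt_eqF.
  have D1 : is_derive t 1 (fun u : R => u^-1) (- t ^- 2).
    have := is_deriveV tn0 (is_derive_id t 1).
    by rewrite /GRing.scale /= mulr1.
  have D2 : is_derive t 1 (fun u : R => expR (- u^-1)) (expR (- t^-1) * t ^- 2).
    have D1' : is_derive t 1 (fun u : R => - u^-1) (t ^- 2).
      by have := is_deriveN D1; rewrite opprK; apply: is_derive_local ltr01 _ => h _.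
    exact: (is_derive_ext _ _ (@is_derive1_comp _ expR _ t _ _ (is_derive_expR (- t^-1)) D1')).
  have D3 : is_derive t 1 (fun u : R => u ^- k) (- k%:R * t ^- k.+1).
    have := is_deriveX k D1.
    apply: is_derive_ext => [u|]; first by rewrite fctE exprVn.
    rewrite /GRing.scale /= mulrN mulNr; congr (- _).
    case: k => [|k]; first by rewrite !mul0r.
    by rewrite /= -mulrA -exprVn -exprVn -exprD addn2.
  have D4 := is_derive_scale D3 D2.
  have d0 : 0 < t by [].
  apply: (@is_derive_local _ _ _ (fun u : R => u ^- k *: expR (- u^-1)) _ _ _ _ _ d0).
    move=> h hd; rewrite /flat ifT// [h *: 1]mulr1.
    by rewrite -ltrBlDr sub0r (lt_le_trans _ (lerNnormlW (lexx _)))// ltrN2.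
  move: D4; rewrite /GRing.scale /= /flat t0.
  have -> // : - k%:R * t ^- k.+1 * expR (- t^-1) + t ^- k * (expR (- t^-1) * t ^- 2) =
    t ^- k.+2 * expR (- t^-1) - k%:R * (t ^- k.+1 * expR (- t^-1)).
  rewrite -!exprVn !exprS; ring.
- rewrite /flat ltxx mulr0 subr0.
  apply: (@is_derive_quad _ _ _ _ _ _ _ (k.+2)`!%:R) ltr01 _ => h _.
  rewrite addr0 [h *: 1]mulr1 scaler0 ltxx !subr0; exact: flat_small.
Qed.

Lemma Cn_flat n k : Cn n (flat k).
Proof.
elim: n k => // n IH k; exists (fun t => flat k.+2 t - k%:R * flat k.+1 t).
  by move=> t; exact: is_derive_flat.
apply: (@Cn_ext _ _ (fun t => flat k.+2 t + (- k%:R : R) *: flat k.+1 t)).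
  by move=> t; rewrite scaleNr.
by apply: CnD => //; apply: Cn_scale => //; exact: Cn_cst.
Qed.

(** For t <= 0 the inner value flat (1 - t) exceeds exp(-1), so that the outer
argument is negative; for t >= 1 it vanishes. *)
Definition step (t : R) : R := flat 0 (expR (- 1) - flat 0 (1 - t)) / flat 0 (expR (- 1)).

Lemma flat0_gt0 (t : R) : 0 < t -> 0 < flat 0 t.
Proof. by move=> t0; rewrite /flat t0 expr0 invr1 mul1r expR_gt0. Qed.

Lemma step0 (t : R) : t <= 0 -> step t = 0.
Proof.
move=> t0; rewrite /step {1}/flat ifN ?mul0r// -leNgt subr_le0 /flat.
have t1 : 1 <= 1 - t by rewrite lerBrDr gerDl.
rewrite ifT; last exact: lt_le_trans t1.
rewrite expr0 invr1 mul1r ler_expR lerN2 invf_le1//; exact: lt_le_trans t1.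
Qed.

Lemma step1 (t : R) : 1 <= t -> step t = 1.
Proof.
move=> t1; rewrite /step [flat 0 (1 - t)]/flat ifN; last by rewrite -leNgt subr_le0.
by rewrite subr0 divff// gt_eqF// flat0_gt0// expR_gt0.
Qed.

Lemma Cn_affine n (a b : R) : Cn n (fun t => a + b * t).
Proof. by apply: CnD; [exact: Cn_cst|apply: (@Cn_scale R); [exact: Cn_cst|exact: Cn_id]]. Qed.

Lemma Cn_step n : Cn n step.
Proof.
apply: (@Cn_ext _ _ (fun t => (flat 0 (expR (- 1)))^-1 *: flat 0 (expR (- 1) + (- 1) *: flat 0 (1 + (-1) * t)))).
  by move=> t; rewrite /step scaleN1r mulN1r [RHS]mulrC.
apply: Cn_scale; first exact: Cn_cst.
apply: Cn_comp; first exact: Cn_flat.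
apply: CnD; first exact: Cn_cst.
apply: Cn_scale; first exact: Cn_cst.
by apply: Cn_comp; [exact: Cn_flat|exact: Cn_affine].
Qed.

Definition bump (t : R) : R := step (2 + 2 * t) * step (2 + (- 2) * t).

Lemma Cn_bump n : Cn n bump.
Proof. by apply: (@Cn_scale R); apply: Cn_comp; [exact: Cn_step|exact: Cn_affine|exact: Cn_step|exact: Cn_affine]. Qed.

Lemma bump_smooth : smooth_curve bump.
Proof. by apply/smooth_curveP => n; exact: Cn_bump. Qed.

Lemma bump1 (t : R) : `|t| <= 2^-1 -> bump t = 1.
Proof. by rewrite ler_norml => /andP[? ?]; rewrite /bump !step1 ?mulr1//; lra. Qed.

Lemma bump0 (t : R) : 1 <= `|t| -> bump t = 0.
Proof.
rewrite ler_normr => /orP[?|?]; rewrite /bump; last by rewrite step0 ?mul0r//; lra.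
by rewrite [X in _ * X]step0 ?mulr0//; lra.
Qed.

Lemma is_derive_bump n (t : R) : is_derive t 1 (derive1n n bump) (derive1n n.+1 bump t).
Proof. by rewrite derive1nS derive1E; apply/derivableP/bump_smooth. Qed.

Lemma bump_derive0 n (t : R) : 1 < `|t| -> derive1n n bump t = 0.
Proof.
move=> t1; suff : \forall u \near t, derive1n n bump u = 0 by move/nbhs_singleton.
have : \forall u \near t, bump u = 0.
  apply/nbhs_ballP; exists (`|t| - 1) => /=; first by rewrite subr_gt0.
  move=> u; rewrite /ball/= => ut; apply: bump0.
  rewrite ltrBrDr -ltrBrDl in ut; rewrite ltW// (lt_le_trans ut)// lerBlDl.
  by rewrite -{1}[t](subrK u) (le_trans (ler_normD _ _)).
move=> n0; elim: n => // n IH; have := nbhs_interior IH; apply: filterS => u nu.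
rewrite derive1nS derive1E (@near_eq_derive _ _ _ _ (fun=> 0))//.
exact: derive_cst.
Qed.

Lemma bump_derive_bounded n : exists M, forall t, `|derive1n n bump t| <= M.
Proof.
have cn : {within `[-1, 1], continuous (derive1n n bump)}.
  by apply: derivable_within_continuous => t _; exact: bump_smooth.
have /compact_bounded[M [_ HM]] : compact (derive1n n bump @` `[-1, 1]).
  by apply: continuous_compact => //; exact: segment_compact.
exists (Num.max (M + 1) 0) => t; rewrite le_max.
have [t1|t1] := leP `|t| 1; last by rewrite bump_derive0// normr0 lexx orbT.
rewrite (HM (M + 1)) ?ltrDl//; exists t => //=.
by rewrite in_itv/= -ler_norml.
Qed.

End SmoothCurves.

(** * Independence of the order of differentiation *)

Section SortedDirections.
Variable s : nat.
Local Notation le := (fun i j : 'I_s => (i <= j)%N).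

Lemma ord_le_trans : transitive le.
Proof. by move=> j i k; exact: leq_trans. Qed.

Lemma ord_le_anti : antisymmetric le.
Proof. by move=> i j; rewrite -eqn_leq => /eqP/val_inj. Qed.

Lemma ord_le_total : total le.
Proof. by move=> i j; exact: leq_total. Qed.

Lemma sorted_midx_dirs (al : 'I_s -> nat) : sorted le (midx_dirs al).
Proof.
rewrite (sorted_pairwise ord_le_trans) /midx_dirs.
have : pairwise (fun i j : 'I_s => (i < j)%N) (enum 'I_s).
  rewrite -(pairwise_map val ltn) val_enum_ord -sorted_pairwise; last exact: ltn_trans.
  exact: iota_ltn_sorted.
elim: (enum 'I_s) => //= i e IH /andP[/allP ie /IH {}IH].
rewrite pairwise_cat IH andbT; apply/andP; split.
  apply/allrelP => x y /nseqP[-> _] /flatten_mapP[k /ie ik /nseqP[-> _]].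
  exact: ltnW.
by elim: (al i) => //= n ->; rewrite andbT; apply/allP => x /nseqP[-> _].
Qed.

Lemma sorted_dirs_eq (l l' : seq 'I_s) : sorted le l -> sorted le l' -> perm_eq l l' -> l = l'.
Proof. exact: sorted_eq ord_le_trans ord_le_anti _ _. Qed.

(** Derivatives with respect to a multi-index are taken in the order of sorted
lists; this is the one order of differentiation for which a test object is
assumed to have bounded derivatives. *)
Lemma sorted_midx (l : seq 'I_s) : sorted le l -> l = midx_dirs (fun i => count_mem i l).
Proof.
by move=> sl; apply: sorted_dirs_eq => //; [exact: sorted_midx_dirs|exact: perm_midx_dirs].
Qed.

End SortedDirections.

Section LFJets.
Variables (R : realType) (s : nat).
Local Notation E := 'rV[R]_s.
Local Notation C := (Rcomplex R).
Local Notation fn := (E -> C).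
Local Notation e_ i := (delta_mx 0 i : E).
Local Notation D := (@test_functions R s setT).
Local Notation le := (fun i j : 'I_s => (i <= j)%N).

Definition LF_partials (f : E -> fn) (l : seq 'I_s) : E -> fn :=
  foldr (fun i g x => LF_derive setT g x (e_ i)) f l.

Lemma is_LF_derive_congr (O : set E) (f g : E -> fn) (x v : E) l : open O -> O x ->
  (forall y, O y -> f y = g y) -> is_LF_derive setT f x v l -> is_LF_derive setT g x v l.
Proof.
move=> oO Ox fg; have [d d0 Hd] := open_ball oO Ox.
have v0 : 0 < `|v| + 1 by rewrite ltr_wpDl.
have d'0 : 0 < d / (`|v| + 1) by rewrite divr_gt0.
apply: (is_LF_derive_local d'0) => h.
rewrite ltr_pdivlMr// => hd; apply/fg/Hd; rewrite addrK normrZ (le_lt_trans _ hd)//.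
by rewrite ler_wpM2l// lerDl.
Qed.

Lemma LF_derive_congr (O : set E) (f g : E -> fn) (x v : E) : open O -> O x ->
  (forall y, O y -> f y = g y) -> LF_derive setT f x v = LF_derive setT g x v.
Proof.
move=> oO Ox fg; rewrite /LF_derive; congr get; apply/funext => l; apply/propext.
by split; apply: (is_LF_derive_congr oO Ox) => y Oy; rewrite fg.
Qed.

Section Smooth.
Variables (O : set E) (f : E -> fn).
Hypothesis oO : open O.
Hypothesis f_curve : forall x : R -> E, smooth_curve x -> (forall t, O (x t)) ->
  LF_smooth_curve setT (fun t => f (x t)).
Hypothesis f_bounded : forall K alpha, compact K -> K `<=` O ->
  LF_bounded setT [set LF_mpartial setT alpha f x | x in K].

Local Notation Phi := (LF_partials f).

(** The smoothness hypothesis only concerns curves defined on all of R with values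
in O; a straight line is slowed down by a bump function before leaving O. *)
Lemma bounded_line_curve (x v : E) : O x -> `|v| <= 1 -> exists (rho : R -> R) (d : R),
  [/\ 0 < d, forall t : R, `|t| < d -> rho t = t,
      smooth_curve (fun t => x + rho t *: v) & forall t, O (x + rho t *: v)].
Proof.
move=> Ox v1; have [d d0 Hd] := open_ball oO Ox.
have [M HM] := bump_derive_bounded R 0.
pose a := d / (`|M| + 1); have M0 : 0 < `|M| + 1 by rewrite ltr_wpDl.
have a0 : 0 < a by rewrite divr_gt0.
exists (fun t => t * bump (a^-1 * t)), (a / 2); split.
- by rewrite divr_gt0.
- move=> t ta; rewrite bump1 ?mulr1//.
  by rewrite normrM ger0_norm ?invr_ge0 ?(ltW a0)// ler_pdivrMl// ltW.
- apply/smooth_curveP => n; apply: CnD; first exact: Cn_cst.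
  apply: Cn_scale; last exact: Cn_cst.
  apply: (@Cn_scale R); first exact: Cn_id.
  apply: Cn_comp; first exact: Cn_bump.
  by apply: (@Cn_scale R); [exact: Cn_cst|exact: Cn_id].
- move=> t; apply: Hd; rewrite addrC addKr normrZ.
  apply: (@le_lt_trans _ _ (`|t * bump (a^-1 * t)| * 1)); first by rewrite ler_wpM2l.
  rewrite mulr1 normrM; have [ta|ta] := leP a `|t|.
    by rewrite bump0 ?normr0 ?mulr0// normrM ger0_norm ?invr_ge0 ?(ltW a0)// ler_pdivlMl// mulr1.
  apply: (@le_lt_trans _ _ (`|t| * `|M|)).
    by rewrite ler_wpM2l// (le_trans (HM _))// ler_norm.
  apply: (@lt_le_trans _ _ (a * (`|M| + 1))); last by rewrite /a divfK ?gt_eqF.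
  apply: (@le_lt_trans _ _ (`|t| * (`|M| + 1))); first by rewrite ler_wpM2l// lerDl.
  by rewrite ltr_pM2r.
Qed.

Lemma LF_pure_partials n i x : O x ->
  is_LF_derive setT (Phi (nseq n i)) x (e_ i) (Phi (nseq n.+1 i) x).
Proof.
move=> Ox; have [rho [d [d0 rhoE rhos rhoO]]] := bounded_line_curve Ox (norm_delta R i).
have [c [c0 cd]] := f_curve rhos rhoO.
have dt (t : R) : `|t| < d -> 0 < d - `|t| by rewrite subr_gt0.
have near_t (t h : R) : `|t| < d -> `|h| < d - `|t| -> `|h + t| < d.
  by move=> td hd; rewrite (le_lt_trans (ler_normD _ _))// -ltrBrDr.
have PE m (t : R) : `|t| < d -> Phi (nseq m i) (t *: e_ i + x) = c m t.
  elim: m t => [|m IH] t td; first by rewrite c0 /= rhoE// addrC.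
  rewrite [LHS]/=; apply: is_LF_deriveE.
  apply: (is_LF_derive_transfer (dt t td) _ (cd m t).2) => h hd.
  by rewrite [h *: 1]mulr1 addrA -scalerDl IH//; exact: near_t.
have H : is_LF_derive setT (Phi (nseq n i)) x (e_ i) (c n.+1 0).
  apply: (is_LF_derive_transfer d0 _ (cd n 0).2) => h hd.
  by rewrite [h *: 1]mulr1 addr0 PE.
by rewrite [Phi (nseq n.+1 i) x](is_LF_deriveE H).
Qed.

Lemma LF_partials_bounded l K : sorted le l -> compact K -> K `<=` O ->
  LF_bounded setT [set Phi l x | x in K].
Proof. by move=> /sorted_midx ->; exact: f_bounded. Qed.

(** By induction on the list, the derivatives of Phi l in direction i of all orders
and the first two derivatives in a direction j preceding l satisfy the hypotheses of
[LF_mixed_derivatives]: being equal to derivatives along sorted lists, they are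
bounded. So j can be moved past the copies of i and, if necessary, the list be
sorted. *)
Lemma LF_partials_sorted l : sorted le l -> forall n i x, O x ->
  is_LF_derive setT (Phi (nseq n i ++ l)) x (e_ i) (Phi (nseq n.+1 i ++ l) x) /\
  forall l', sorted le l' -> perm_eq l' (nseq n i ++ l) -> Phi (nseq n i ++ l) x = Phi l' x.
Proof.
have snseq n (i : 'I_s) : sorted le (nseq n i).
  by rewrite (sorted_pairwise (@ord_le_trans s)); elim: n => //= n ->; rewrite andbT; apply/allP => y /nseqP[-> _].
elim: l => [_|j l IH sjl] n i x Ox.
  rewrite !cats0; split; first exact: LF_pure_partials.
  by move=> l' sl' /(sorted_dirs_eq sl' (snseq n i)) ->.
have sl : sorted le l by exact: path_sorted sjl.
have jl k : k \in l -> (j <= k)%N.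
  by move=> kl; have := order_path_min (@ord_le_trans s) sjl => /allP/(_ k kl).
have [ij|ij] := eqVneq i j.
  have E m : nseq m i ++ j :: l = nseq m.+1 i ++ l.
    by rewrite -ij; elim: m => //= m ->.
  by rewrite !E; exact: IH.
have bT m k K : compact K -> K `<=` O -> LF_bounded setT [set Phi (nseq m k ++ l) y | y in K].
  move=> cK KO; have := @LF_partials_bounded (sort le (nseq m k ++ l)) K (sort_sorted (@ord_le_total s) _) cK KO.
  congr LF_bounded; apply/seteqP; split=> _ [y Ky <-]; exists y => //.
    by apply: (IH sl m k y (KO _ Ky)).2; [exact: sort_sorted (@ord_le_total s) _|rewrite perm_sort].
  by apply/esym; apply: (IH sl m k y (KO _ Ky)).2; [exact: sort_sorted (@ord_le_total s) _|rewrite perm_sort].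
have mix := @LF_mixed_derivatives R s O i j (fun m => Phi (nseq m i ++ l)) (Phi (j :: l)) (Phi [:: j, j & l]) oO
  (fun m y Oy => (IH sl m i y Oy).1) (fun y Oy => (IH sl 0%N j y Oy).1) (fun y Oy => (IH sl 1%N j y Oy).1)
  (bT ^~ i) (bT 2 j).
have swap m : forall y, O y -> Phi (nseq m i ++ j :: l) y = Phi (j :: nseq m i ++ l) y.
  elim: m => // m IHm y Oy.
  transitivity (LF_derive setT (Phi (j :: nseq m i ++ l)) y (e_ i)).
    exact: LF_derive_congr oO Oy IHm.
  by apply: is_LF_deriveE; exact: (mix m y Oy).2.
split.
  rewrite [Phi (nseq n.+1 i ++ _) x]swap//.
  apply: (is_LF_derive_congr oO Ox _ (mix n x Ox).2) => y Oy; exact/esym/swap.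
move=> l' sl' pl'.
have [lij|] := ltnP i j.
  congr (Phi _ x); apply: sorted_dirs_eq => //; last by rewrite perm_sym.
  rewrite (sorted_pairwise (@ord_le_trans s)) pairwise_cat -!(sorted_pairwise (@ord_le_trans s)) snseq sjl !andbT.
  apply/allrelP => a b /nseqP[-> _]; rewrite inE => /predU1P[->|/jl]; first exact: ltnW.
  exact: leq_trans (ltnW lij).
move=> ji; rewrite swap//.
pose l1 := sort le (nseq n i ++ l).
have sl1 : sorted le l1 by exact: sort_sorted (@ord_le_total s) _.
have -> : l' = j :: l1.
  apply: sorted_dirs_eq => //.
    rewrite /= path_min_sorted//; apply/allP => k; rewrite mem_sort mem_cat => /orP[/nseqP[-> _]//|].
    exact: jl.
  by rewrite (perm_trans pl')// perm_catC /= perm_cons perm_catC perm_sym /l1 perm_sort.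
apply: LF_derive_congr oO Ox _ => y Oy.
by apply: (IH sl n i y Oy).2 => //; rewrite /l1 perm_sort.
Qed.

Lemma LF_partials_sort l x : O x -> Phi l x = Phi (sort le l) x.
Proof.
elim: l x => // i l IH x Ox.
transitivity (Phi (i :: sort le l) x); first exact: LF_derive_congr oO Ox IH.
have := (LF_partials_sorted (sort_sorted (@ord_le_total s) l) 1 i Ox).2; apply.
  exact: sort_sorted (@ord_le_total s) _.
by rewrite perm_sort /= perm_cons perm_sym perm_sort.
Qed.

(** Only the derivatives taken in sorted order are bounded by assumption;
[LF_mixed_derivatives] provides all the others. *)
Theorem LF_partials_derive l i x : O x ->
  is_LF_derive setT (Phi l) x (e_ i) (Phi (i :: l) x).
Proof.
move=> Ox.
have -> : Phi (i :: l) x = Phi (i :: sort le l) x.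
  by apply: LF_derive_congr oO Ox _ => y; exact: LF_partials_sort.
have := (LF_partials_sorted (sort_sorted (@ord_le_total s) l) 0 i Ox).1.
by apply: is_LF_derive_congr oO Ox _ => y Oy; rewrite [RHS]LF_partials_sort.
Qed.

Theorem LF_partials_perm l l' x : O x -> perm_eq l l' -> Phi l x = Phi l' x.
Proof.
move=> Ox ll'; rewrite LF_partials_sort// [RHS]LF_partials_sort//; congr (Phi _ x).
by apply/perm_sortP => //; [exact: ord_le_total|exact: ord_le_trans|exact: ord_le_anti].
Qed.

Lemma LF_partials_mpartial l x : O x -> Phi l x = LF_mpartial setT (fun i => count_mem i l) f x.
Proof. by move=> Ox; apply: LF_partials_perm => //; exact: perm_midx_dirs. Qed.

End Smooth.
End LFJets.

(** * Integrals and moments of test functions *)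

Section CompactSupport.
Variable R : realType.

Definition supported_continuous (s : nat) (r : R) (f : 'rV[R]_s -> R) : Prop :=
  continuous f /\ forall x, r < `|x| -> f x = 0.

Lemma supported_uniform (s : nat) (r : R) (f : 'rV[R]_s -> R) e :
  supported_continuous r f -> 0 < e ->
  exists2 d, 0 < d & forall x y, `|y - x| < d -> `|f y - f x| < e.
Proof.
move=> [/continuousE_norm fc fr] e0.
have cK := @ball_compact R s 0 (r + 1).
have /compact_near_coveringP cov := cK.
have : \forall d \near (0 : R)^'+, [set x : 'rV[R]_s | `|x - 0| <= r + 1] `<=`
    [set x | forall y, `|y - x| < d -> `|f y - f x| < e].
  apply: cov => x _; have e2 : 0 < e / 2 by rewrite divr_gt0.
  have [d d0 Hd] := fc x _ e2.
  have d2 : 0 < d / 2 by rewrite divr_gt0.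
  exists ([set x' | `|x' - x| < d / 2], [set d' | d' < d / 2]) => /=.
    split; last by apply: nbhs_right_lt.
    apply/nbhs_ballP; exists (d / 2) => //= y; rewrite mx_norm_ball /ball_/= distrC; exact.
  move=> [x' d'] [/= x'x d'd] y yx'.
  have H1 : `|f y - f x| < e / 2.
    apply: Hd; rewrite -(subrK x' y) -addrA (le_lt_trans (ler_normD _ _))// [ltRHS]splitr ltrD//.
    exact: lt_trans d'd.
  have H2 : `|f x' - f x| < e / 2.
    by apply: Hd; apply: lt_trans x'x _; rewrite ltr_pdivrMr// ltr_pMr// ltr1n.
  rewrite -(subrK (f x) (f y)) -addrA [e]splitr (le_lt_trans (ler_normD _ _))// ltrD// distrC//.
rewrite near_withinE => /nbhs_ballP[d /= d0 H].
have [d' [d'0 dd']] : exists d', 0 < d' /\ (forall x, `|x - 0| <= r + 1 -> forall y, `|y - x| < d' -> `|f y - f x| < e).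
  exists (d / 2); split; first by rewrite divr_gt0.
  apply: (H (d / 2)); rewrite /= ?divr_gt0// /ball/= sub0r normrN gtr0_norm ?divr_gt0//.
  by rewrite ltr_pdivrMr// ltr_pMr// ltr1n.
exists (Num.min d' 1); first by rewrite lt_min d'0 ltr01.
move=> x y; rewrite lt_min => /andP[yd' y1].
have [xr|rx] := leP `|x| (r + 1); first by apply: dd' => //; rewrite subr0.
have ry : r < `|y|.
  rewrite -(ltrD2r 1) (lt_le_trans rx)// -lerBlDl.
  by rewrite (le_trans _ (ltW y1))// distrC lerB_dist.
by rewrite !fr ?subrr ?normr0// (lt_trans _ rx)// ltrDl.
Qed.

Lemma supportedD (s : nat) (r : R) (f g : 'rV[R]_s -> R) (a b : R) :
  supported_continuous r f -> supported_continuous r g ->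
  supported_continuous r (fun x => a * f x + b * g x).
Proof.
have Z h c : continuous (h : 'rV[R]_s -> R) -> continuous (fun x => c * h x).
  by move=> hc x; apply: continuousM; [exact: cst_continuous|exact: hc].
move=> [fc fr] [gc gr]; split; last by move=> x rx; rewrite fr// gr// !mulr0 addr0.
exact: (continuousE_add (Z f a fc) (Z g b gc)).
Qed.

Lemma row_mx_dist (s : nat) (t t' : R) (y y' : 'rV[R]_s) :
  `|(row_mx (t%:M : 'rV[R]_1) y : 'rV[R]_(1 + s)) - row_mx (t'%:M) y'| <= Num.max `|t - t'| `|y - y'|.
Proof.
apply: norm_le_entries => [|i]; first by rewrite le_max normr_ge0.
rewrite !mxE; case: splitP => j _; rewrite le_max.
  by rewrite !mxE ord1 eqxx !mulr1n lexx.
by have := norm_entry (y - y') j; rewrite !mxE => ->; rewrite orbT.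
Qed.

Lemma row_mx_norm (s : nat) (t : R) (y : 'rV[R]_s) :
  (`|t| <= `|row_mx (t%:M : 'rV[R]_1) y : 'rV[R]_(1 + s)|) /\
  (`|y| <= `|row_mx (t%:M : 'rV[R]_1) y : 'rV[R]_(1 + s)|).
Proof.
split.
  by have := norm_entry (row_mx (t%:M : 'rV[R]_1) y) (lshift s 0); rewrite row_mxEl mxE eqxx mulr1n.
apply: norm_le_entries => // i.
by have := norm_entry (row_mx (t%:M : 'rV[R]_1) y) (rshift 1 i); rewrite row_mxEr.
Qed.

Definition slice (s : nat) (f : 'rV[R]_s.+1 -> R) (t : R) : 'rV[R]_s -> R :=
  fun y => f (row_mx (t%:M : 'rV[R]_1) y).

Lemma slice_supported (s : nat) (r : R) (f : 'rV[R]_s.+1 -> R) t :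
  supported_continuous r f -> supported_continuous r (slice f t).
Proof.
move=> [/continuousE_norm fc fr]; split.
  apply/continuousE_norm => x e e0.
  have [d d0 Hd] := fc (row_mx (t%:M : 'rV[R]_1) x) e e0; exists d => // y yd.
  by apply: Hd; rewrite (le_lt_trans (row_mx_dist _ _ _ _))// subrr normr0 max_r.
by move=> y ry; apply: fr; apply: lt_le_trans ry (row_mx_norm t y).2.
Qed.

Let mu := @lebesgue_measure R.

Lemma continuous_support_integrable (F : R -> R) (r : R) : continuous F ->
  (forall t, r < `|t| -> F t = 0) -> mu.-integrable setT (EFin \o F).
Proof.
move=> Fc Fr.
have H : mu.-integrable `[- r, r] (EFin \o F).
  apply: continuous_compact_integrable; first exact: segment_compact.
  exact: continuous_subspaceT.
have -> : EFin \o F = (EFin \o F) \_ `[- r, r].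
  apply/funext => t; rewrite patchE; case: ifPn => // /negP tr /=.
  rewrite Fr// ltNge; apply/negP => tr'; apply: tr; rewrite inE/= in_itv/=.
  by rewrite -ler_norml.
have mD : measurable (`[- r, r] : set R) by exact: measurable_itv.
exact: (@integrable_mkcond _ _ R mu _ (EFin \o F) mD).1.
Qed.

Lemma continuous_support_bound (F : R -> R) (r M : R) : 0 <= r -> continuous F ->
  (forall t, r < `|t| -> F t = 0) -> (forall t, `|F t| <= M) ->
  `|Rintegral mu setT F| <= 2 * r * M.
Proof.
move=> r0 Fc Fr FM.
have H : mu.-integrable `[- r, r] (EFin \o F).
  apply: continuous_compact_integrable; first exact: segment_compact.
  exact: continuous_subspaceT.
have -> : Rintegral mu setT F = Rintegral mu `[- r, r] F.
  rewrite [RHS]Rintegral_mkcond; apply: eq_Rintegral => t _.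
  rewrite patchE; case: ifPn => // /negP tr.
  rewrite Fr// ltNge; apply/negP => tr'; apply: tr; rewrite inE/= in_itv/=.
  by rewrite -ler_norml.
apply: le_trans (le_normr_Rintegral _ H) _; first exact: measurable_itv.
have HM : mu.-integrable `[- r, r] (EFin \o (fun=> M : R)).
  apply: continuous_compact_integrable; first exact: segment_compact.
  by apply: continuous_subspaceT => t; exact: cvg_cst.
apply: (@le_trans _ _ (Rintegral mu `[- r, r] (fun=> M))).
  apply: le_Rintegral => //.
  exact: (integrable_abse H).
rewrite Rintegral_cst//= /mu lebesgue_measure_itv/= lte_fin.
have M0 : 0 <= M by apply: le_trans (FM 0).
case: ltP => _ /=; last by rewrite mulr0 !mulr_ge0.
by rewrite opprK mulrC ler_wpM2r//; lra.
Qed.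

(** Linearity and boundedness are proved together by induction on the dimension:
linearity and boundedness of the inner integral imply that it depends
continuously on the outer variable, which makes the outer integral linear and
bounded. *)
Lemma rv_integral_linear_bounded (s : nat) (r : R) : 0 <= r ->
  (forall (f g : 'rV[R]_s -> R) a b, supported_continuous r f -> supported_continuous r g ->
    rv_integral (fun x => a * f x + b * g x) = a * rv_integral f + b * rv_integral g) /\
  (exists K, 0 <= K /\ forall (f : 'rV[R]_s -> R) M, supported_continuous r f ->
    (forall x, `|f x| <= M) -> `|rv_integral f| <= K * M).
Proof.
move=> r0; elim: s => [|s [IHl [K [K0 IHb]]]].
  by split=> //; exists 1; split=> // f M _ fM; rewrite mul1r; exact: fM.
pose F (f : 'rV[R]_s.+1 -> R) t := rv_integral (slice f t).
have Fc f : supported_continuous r f -> continuous (F f).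
  move=> fs t; apply/cvgrPdist_lt => e e0.
  have K1 : 0 < K + 1 by rewrite ltr_wpDl.
  have [d d0 Hd] := supported_uniform fs (divr_gt0 e0 K1).
  apply/nbhs_ballP; exists d => //= u; rewrite /ball/= => tu.
  have H := IHl (slice f t) (slice f u) 1 (-1) (slice_supported t fs) (slice_supported u fs).
  rewrite mul1r mulN1r in H; rewrite /F -H.
  apply: (@le_lt_trans _ _ (K * (e / (K + 1)))).
    apply: IHb; first by apply: supportedD; exact: slice_supported.
    move=> y; rewrite mul1r mulN1r; apply/ltW/Hd.
    by rewrite (le_lt_trans (row_mx_dist _ _ _ _))// subrr normr0 max_l.
  by rewrite mulrCA gtr_pMr// ltr_pdivrMr// mul1r ltrDl.
have F0 f : supported_continuous r f -> forall t, r < `|t| -> F f t = 0.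
  move=> fs t rt; apply/eqP; rewrite -normr_le0 -(mulr0 K).
  apply: IHb; first exact: slice_supported.
  move=> y; rewrite /slice (fs.2 _ (lt_le_trans rt (row_mx_norm t y).1)).
  by rewrite normr0.
split.
  move=> f g a b fs gs /=.
  have fi := continuous_support_integrable (Fc f fs) (F0 f fs).
  have gi := continuous_support_integrable (Fc g gs) (F0 g gs).
  rewrite -!RintegralZl//.
  rewrite -RintegralD//; last 2 first.
    by have := integrableZl measurableT a fi; apply: eq_integrable => // t _.
    by have := integrableZl measurableT b gi; apply: eq_integrable => // t _.
  by apply: eq_Rintegral => t _; apply: (IHl (slice f t) (slice g t)); exact: slice_supported.
exists (2 * r * K); split; first by rewrite !mulr_ge0.
move=> f M fs fM; have -> : 2 * r * K * M = 2 * r * (K * M) by ring.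
change (`|Rintegral mu setT (F f)| <= 2 * r * (K * M)).
apply: (continuous_support_bound r0 (Fc f fs) (F0 f fs)) => t.
by apply: IHb; [exact: slice_supported|move=> y; exact: fM].
Qed.

End CompactSupport.

Section Moments.
Variables (R : realType) (s : nat).
Local Notation E := 'rV[R]_s.
Local Notation C := (Rcomplex R).
Local Notation fn := (E -> C).
Local Notation D := (@test_functions R s setT).

Lemma continuousE_scale (V : normedModType R) (m : E -> R) (f : E -> V) :
  continuous m -> continuous f -> continuous (fun x => m x *: f x).
Proof. by move=> mc fc x; apply: continuousZ; [exact: mc|exact: fc]. Qed.

Lemma monomial_continuous (al : 'I_s -> nat) : continuous (@monomial R s al).
Proof.
rewrite /monomial; elim: (index_enum _) => [|i l IH].
  by under eq_fun do rewrite big_nil; exact: cst_continuous.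
under eq_fun do rewrite big_cons.
apply: continuousE_scale => // x.
apply: (continuous_comp (f := fun x : E => x 0 i) (g := fun y => y ^+ al i)).
  exact: coord_continuous.
exact: exprn_continuous.
Qed.

Lemma ReD (z w : C) : complex.Re (z + w) = complex.Re z + complex.Re w.
Proof. by case: z w => [? ?] [? ?]. Qed.
Lemma ImD (z w : C) : complex.Im (z + w) = complex.Im z + complex.Im w.
Proof. by case: z w => [? ?] [? ?]. Qed.
Lemma supported_Re (f : fn) r : continuous f -> (forall x, r < `|x| -> f x = 0) ->
  supported_continuous r (fun x => complex.Re (f x)) /\
  supported_continuous r (fun x => complex.Im (f x)).
Proof.
move=> /continuousE_norm fc fr; split; (split; last by move=> x /fr ->).
  apply/continuousE_norm => x e /(fc x)[d d0 Hd]; exists d => // y /Hd; apply: le_lt_trans.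
  by apply: le_trans (norm_Re _); case: (f y) (f x) => [? ?] [? ?].
apply/continuousE_norm => x e /(fc x)[d d0 Hd]; exists d => // y /Hd; apply: le_lt_trans.
by apply: le_trans (norm_Im _); case: (f y) (f x) => [? ?] [? ?].
Qed.

Lemma moment_support (al : 'I_s -> nat) (f : fn) r : continuous f ->
  (forall x, r < `|x| -> f x = 0) ->
  supported_continuous r (fun x => complex.Re (monomial al x *: f x)) /\
  supported_continuous r (fun x => complex.Im (monomial al x *: f x)).
Proof.
move=> fc fr; apply: supported_Re; last by move=> x /fr ->; rewrite scaler0.
apply: continuousE_scale => //; exact: monomial_continuous.
Qed.

Lemma rv_integral_linear (f g : E -> R) (a b r : R) :
  supported_continuous r f -> supported_continuous r g ->
  rv_integral (fun x => a * f x + b * g x) = a * rv_integral f + b * rv_integral g.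
Proof.
move=> [fc fr] [gc gr].
have r0 : 0 <= Num.max r 0 by rewrite le_max lexx orbT.
apply: (rv_integral_linear_bounded s r0).1; split=> // x; rewrite gt_max => /andP[? _].
  exact: fr.
exact: gr.
Qed.

Lemma momentD (al : 'I_s -> nat) (f g : fn) : D f -> D g -> moment al (f + g) = moment al f + moment al g.
Proof.
move=> /test_functionP[fs [r fr]] /test_functionP[gs [r' gr]].
have [fc _] := fs [::]; have [gc _] := gs [::].
pose q := Num.max r r'.
have fq x : q < `|x| -> f x = 0 by rewrite gt_max => /andP[/fr].
have gq x : q < `|x| -> g x = 0 by rewrite gt_max => /andP[_ /gr].
have [f1 f2] := moment_support al fc fq; have [g1 g2] := moment_support al gc gq.
rewrite /moment /rv_cintegral; apply/eqP; rewrite eq_complex /=.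
have := rv_integral_linear 1 1 f1 g1; rewrite !mul1r => <-.
have := rv_integral_linear 1 1 f2 g2; rewrite !mul1r => <-.
apply/andP; split; apply/eqP; congr rv_integral; apply/funext => x; rewrite !mul1r.
  by rewrite fctE scalerDr ReD.
by rewrite fctE scalerDr ImD.
Qed.

Lemma momentM (al : 'I_s -> nat) (z : C) (f : fn) : D f -> moment al (fun x => z * f x) = z * moment al f.
Proof.
move=> /test_functionP[fs [r fr]].
have [fc _] := fs [::].
have [f1 f2] := moment_support al fc fr.
rewrite /moment /rv_cintegral; case: z => a b; apply/eqP; rewrite eq_complex /=.
have := rv_integral_linear a (- b) f1 f2; rewrite mulNr => <-.
have := rv_integral_linear a b f2 f1 => <-.
apply/andP; split; apply/eqP; congr rv_integral; apply/funext => x.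
  by rewrite scalerMCr; case: (monomial al x *: f x) => c d /=; rewrite mulNr.
by rewrite scalerMCr; case: (monomial al x *: f x) => c d /=.
Qed.

Lemma moment_bound (al : 'I_s -> nat) (r : R) : 0 <= r -> exists K, 0 <= K /\ forall f M,
  continuous f -> (forall x, r < `|x| -> f x = 0) -> (forall x, `|f x| <= M) ->
  `|moment al f| <= K * M.
Proof.
move=> r0; have [K [K0 HK]] := (rv_integral_linear_bounded s r0).2.
have [A HA] := continuous_ball_bounded 0 r (@monomial_continuous al).
exists (2 * K * `|A|); split; first by rewrite !mulr_ge0.
move=> f M fc fr fM.
have M0 : 0 <= M := le_trans (normr_ge0 _) (fM 0).
have B x : `|monomial al x *: f x| <= `|A| * M.
  have [xr|rx] := leP `|x| r; last by rewrite fr// scaler0 normr0 mulr_ge0.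
  rewrite normrZ ler_pM// (le_trans _ (ler_norm _))// HA// subr0//.
have [f1 f2] := moment_support al fc fr.
apply: le_trans (norm_ReIm _) _ => /=.
have -> : 2 * K * `|A| * M = K * (`|A| * M) + K * (`|A| * M) by ring.
apply: lerD; apply: HK => // x; apply: le_trans (B x).
  exact: norm_Re.
exact: norm_Im.
Qed.

Lemma moment_LF_continuous (al : 'I_s -> nat) : LF_continuous_functional (@moment R s al).
Proof.
move=> e e0; split; [by move=> _; exact: momentD|by move=> _; exact: momentM|].
move=> K cK; have [M [_ HM]] := compact_bounded cK.
have {}HM x : K x -> `|x| <= `|M| + 1.
  by apply: HM; rewrite (le_lt_trans (ler_norm _))// ltrDl.
have r0 : 0 <= `|M| + 1 by rewrite addr_ge0.
have [A [A0 HA]] := moment_bound al r0.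
exists 0%N, (e / (A + 1)); split; first by rewrite divr_gt0// ltr_wpDl.
move=> f [fs fK] fd _.
apply: (@le_trans _ _ (A * (e / (A + 1)))).
  apply: HA; first by case: (fs [::]).
    by move=> x rx; apply: fK => /HM; rewrite leNgt rx.
  move=> x; have := fd (fun=> 0%N); rewrite /midx_deg big1// => /(_ isT x).
  rewrite /mpartial; have -> // : @midx_dirs s (fun=> 0%N) = [::].
  by apply: size0nil; rewrite size_midx_dirs /midx_deg big1.
by rewrite mulrCA ger_pMr// ler_pdivrMr ?ltr_wpDl// mul1r lerDl.
Qed.

Lemma moment0E (f : fn) : moment (fun=> 0%N) f = rv_cintegral f.
Proof.
rewrite /moment; congr rv_cintegral; apply/funext => x.
by rewrite /monomial big1 ?scale1r// => i _; rewrite expr0.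
Qed.

Lemma moment_LF_bounded (al : 'I_s -> nat) (B : set fn) : LF_bounded setT B ->
  exists M, forall f, B f -> `|moment al f| <= M.
Proof.
move=> bB; have [r _ H] := LF_bounded_functionals bB (moment_LF_continuous al ltr01).
by exists (r * 1) => f /H/(_ tt).
Qed.

End Moments.

(** * Test functions with prescribed moments, algebra of jets *)

Section MomentSection.
Variables (R : realType) (s N : nat).
Local Notation E := 'rV[R]_s.
Local Notation C := (Rcomplex R).
Local Notation fn := (E -> C).
Local Notation D := (@test_functions R s setT).
Variable T : 'I_N -> fn -> C.

Definition values (f : fn) : 'rV[C]_N := \row_j T j f.
Definition values_mx (r : nat) (g : 'I_r -> fn) : 'M[C]_(r, N) := \matrix_(i, j) T j (g i).

(** The rank of a family of values is at most N, and values of maximal rank span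
all the others. *)
Lemma spanning_test_functions : exists (r : nat) (g : 'I_r -> fn),
  (forall i, D (g i)) /\ forall f, D f -> (values f <= values_mx g)%MS.
Proof.
pose P r := `[< exists g : 'I_r -> fn, (forall i, D (g i)) /\ row_free (values_mx g) >].
have P0 : exists r, P r.
  exists 0%N; apply/asboolP; exists (fun=> 0); split; first by case.
  by rewrite /row_free; have := rank_leq_row (values_mx (fun _ : 'I_0 => 0)); case: (\rank _).
have PN r : P r -> (r <= N)%N.
  by move=> /asboolP[g [_ /eqP <-]]; exact: rank_leq_col.
have [r /asboolP[g [Dg fg]] rmax] := ex_maxnP P0 PN.
exists r, g; split=> // f Df; apply/negPn/negP => nf.
suff /rmax : P (r + 1)%N by rewrite addn1 ltnn.
apply/asboolP; exists (fun i => match fintype.split i with inl a => g a | inr _ => f end); split.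
  by move=> i; case: (fintype.split i).
have -> : values_mx (fun i : 'I_(r + 1) => match fintype.split i with inl a => g a | inr _ => f end) =
    col_mx (values_mx g) (values f).
  by apply/matrixP => i j; rewrite !mxE; case: (fintype.split i) => a; rewrite !mxE.
have : (\rank (values_mx g) < \rank (values_mx g + values f)%MS)%N.
  apply: rank_ltmx; rewrite ltmxE addsmxSl /=.
  by apply: contra nf => /(submx_trans (addsmxSr _ _)).
rewrite addsmxE (eqP fg) => lt.
rewrite /row_free eqn_leq rank_leq_row /=.
by apply: leq_trans _ lt; rewrite addn1.
Qed.

(** The map v |-> sum_i (v P)_i T (g_i) is linear, hence continuous, and it is the
identity on the values of test functions; so it is the identity on limits of such
values. *)
Lemma values_section : exists (r : nat) (g : 'I_r -> fn) (P : 'I_N -> 'I_r -> C),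
  (forall i, D (g i)) /\ forall v : 'I_N -> C,
    (forall e : R, 0 < e -> exists2 f, D f & forall j, `|T j f - v j| <= e) ->
    forall j, \sum_i (\sum_k v k * P k i) * T j (g i) = v j.
Proof.
have [r [g [Dg H]]] := spanning_test_functions.
exists r, g, (pinvmx (values_mx g)); split=> // v Hv j.
pose P := pinvmx (values_mx g).
pose Q k : C := \sum_i P k i * T j (g i).
have QE (u : 'I_N -> C) : \sum_i (\sum_k u k * P k i) * T j (g i) = \sum_k u k * Q k.
  under eq_bigr do rewrite mulr_suml.
  rewrite exchange_big /=; apply: eq_bigr => k _; rewrite mulr_sumr.
  by apply: eq_bigr => i _; rewrite mulrA.
rewrite QE.
have Hf f : D f -> \sum_k T k f * Q k = T j f.
  move=> Df; rewrite -QE; have := mulmxKpV (H f Df).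
  move/matrixP/(_ 0 j); rewrite !mxE => E1; rewrite -[RHS]E1.
  apply: eq_bigr => i _; rewrite !mxE; congr (_ * _).
  by apply: eq_bigr => k _; rewrite !mxE.
apply/eqP; rewrite -subr_eq0; apply/eqP/(@normr0_eq0 R C)/eqP.
rewrite eq_le normr_ge0 andbT; apply/ler_addgt0Pr => e e0; rewrite add0r.
pose S : R := \sum_k `|Q k : C| + 1.
have S0 : 0 < S by rewrite ltr_wpDl// sumr_ge0.
have [f Df fv] := Hv _ (divr_gt0 e0 S0).
have -> : \sum_k v k * Q k - v j = (T j f - v j) - \sum_k (T k f - v k) * Q k :> C.
  under [in RHS]eq_bigr do rewrite mulrBl.
  by rewrite sumrB Hf//; ring.
apply: le_trans (ler_normB _ _) _.
apply: (@le_trans _ _ (e / S + \sum_k e / S * `|Q k : C|)).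
  apply: lerD => //; apply: le_trans (ler_norm_sum _ _ _) _; apply: ler_sum => k _.
  by rewrite normCM ler_wpM2r.
by rewrite -mulr_sumr -[X in X + _]mulr1 -mulrDr addrC -/S divfK ?gt_eqF.
Qed.

End MomentSection.

Section JetAlgebra.
Variables (R : realType) (s : nat).
Local Notation E := 'rV[R]_s.
Local Notation C := (Rcomplex R).
Local Notation e_ i := (delta_mx 0 i : E).

Lemma dir_open (O : set E) (x : E) i : open O -> O x ->
  exists2 d, 0 < d & forall h : R, `|h| < d -> O (h *: e_ i + x).
Proof.
move=> oO Ox; have [d d0 Hd] := open_ball oO Ox; exists d => // h hd.
by apply: Hd; rewrite addrK; exact: le_lt_trans (norm_delta_scale _ _) hd.
Qed.

Lemma jet_unique (V : normedModType R) (O : set E) (X Y : seq 'I_s -> E -> V) : open O ->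
  is_jet O X -> is_jet O Y -> (forall x, O x -> X [::] x = Y [::] x) ->
  forall l x, O x -> X l x = Y l x.
Proof.
move=> oO jX jY XY; elim=> // i l IH x Ox.
apply: is_derive_unique (jX l i x Ox) _.
have [d d0 Hd] := dir_open i oO Ox.
by apply: (is_derive_local d0 _ (jY l i x Ox)) => h /Hd/IH.
Qed.

Lemma jet_sum (V : normedModType R) (O : set E) (n : nat) (X : 'I_n -> seq 'I_s -> E -> V) :
  (forall k, is_jet O (X k)) -> is_jet O (fun l x => \sum_k X k l x).
Proof.
move=> jX l i x Ox; have := is_derive_sum (fun k => jX k l i x Ox).
by apply: is_derive_ext => // y; rewrite fct_sumE.
Qed.

Lemma jet_mulr (O : set E) (X : seq 'I_s -> E -> C) (z : C) :
  is_jet O X -> is_jet O (fun l x => X l x * z : C).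
Proof.
move=> jX l i x Ox; have := is_derive_cmull z (jX l i x Ox).
by apply: is_derive_ext => [y|]; rewrite mulrC.
Qed.

Lemma jet_sub (V : normedModType R) (O : set E) (X Y : seq 'I_s -> E -> V) :
  is_jet O X -> is_jet O Y -> is_jet O (fun l x => X l x - Y l x).
Proof. by move=> jX jY l i x Ox; apply: is_deriveB; [exact: jX|exact: jY]. Qed.

(** The ways of distributing the derivatives of a list over two factors. *)
Fixpoint splits (l : seq 'I_s) : seq (seq 'I_s * seq 'I_s) :=
  if l is i :: l' then
    [seq (i :: p.1, p.2) | p <- splits l'] ++ [seq (p.1, i :: p.2) | p <- splits l']
  else [:: ([::], [::])].

(** The jet of a product. *)
Definition leibniz (V : normedModType R) (X : seq 'I_s -> E -> R) (Y : seq 'I_s -> E -> V)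
    (l : seq 'I_s) (x : E) : V := \sum_(p <- splits l) X p.1 x *: Y p.2 x.

Lemma jet_leibniz (V : normedModType R) (O : set E) X (Y : seq 'I_s -> E -> V) :
  is_jet O X -> is_jet O Y -> is_jet O (leibniz X Y).
Proof.
move=> jX jY l i x Ox.
have -> : leibniz X Y (i :: l) x = \sum_(p <- splits l) (X (i :: p.1) x *: Y p.2 x + X p.1 x *: Y (i :: p.2) x).
  by rewrite /leibniz /= big_cat !big_map /= -big_split.
rewrite /leibniz; elim: (splits l) => [|p r IH].
  rewrite big_nil; apply: is_derive_ext (is_derive_cst (0 : V) x (e_ i)) => // y.
  by rewrite big_nil.
rewrite big_cons.
have := is_deriveD (is_derive_scale (jX p.1 i x Ox) (jY p.2 i x Ox)) IH.
by apply: is_derive_ext => // y; rewrite big_cons.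
Qed.

Lemma splits_size l p : p \in splits l -> (size p.1 + size p.2 = size l)%N.
Proof.
elim: l p => [|i l IH] p /=; first by rewrite inE => /eqP ->.
rewrite mem_cat => /orP[] /mapP[r /IH <- ->] //=; by rewrite addnS.
Qed.

Lemma size_splits l : size (splits l) = (2 ^ size l)%N.
Proof. by elim: l => //= i l IH; rewrite size_cat !size_map IH addnn -mul2n expnS. Qed.

Lemma leibniz_bound (V : normedModType R) X (Y : seq 'I_s -> E -> V) l x (a b : R) :
  (forall l', (size l' <= size l)%N -> `|X l' x| <= a) ->
  (forall l', (size l' <= size l)%N -> `|Y l' x| <= b) ->
  `|leibniz X Y l x| <= 2 ^+ size l * (a * b).
Proof.
move=> Xa Yb; rewrite /leibniz; apply: le_trans (ler_norm_sum _ _ _) _.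
apply: (@le_trans _ _ (\sum_(p <- splits l) a * b)).
  rewrite big_seq [leRHS]big_seq; apply: ler_sum => p pl; rewrite normrZ.
  by apply: ler_pM => //; [apply: Xa|apply: Yb]; rewrite -(splits_size pl) ?leq_addr ?leq_addl.
by rewrite big_const_seq count_predT size_splits iter_addr_0 -[_ *+ (2 ^ _)]mulr_natl natrX.
Qed.

(** Only partial derivatives are at hand, so that x0 and y are joined by a path
parallel to the axes. *)
Lemma cube_mean_value (f : E -> C) (df : 'I_s -> E -> C) (x0 y : E) (eta B : R) :
  `|y - x0| <= eta ->
  (forall i z, `|z - x0| <= eta -> is_derive z (e_ i) f (df i z)) ->
  (forall i z, `|z - x0| <= eta -> `|df i z| <= B) ->
  `|f y - f x0| <= s%:R * (2 * B * eta).
Proof.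
move=> yx fd dB.
have eta0 : 0 <= eta by apply: le_trans yx.
pose z k : E := \row_j (if (j < k)%N then y 0 j else x0 0 j).
have yx' j : `|y 0 j - x0 0 j| <= eta.
  by have := norm_entry (y - x0) j; rewrite !mxE => /le_trans; apply.
have zs : z s = y by apply/rowP => j; rewrite mxE ltn_ord.
have z0 : z 0%N = x0 by apply/rowP => j; rewrite mxE.
suff H k : (k <= s)%N -> `|f (z k) - f x0| <= k%:R * (2 * B * eta) by rewrite -{1}zs H.
elim: k => [_|k IH ks]; first by rewrite z0 subrr normr0 mul0r.
pose i := Ordinal ks; pose a := y 0 i - x0 0 i.
have zS : z k.+1 = a *: e_ i + z k.
  apply/rowP => j; rewrite !mxE /= ltnS leq_eqVlt -val_eqE /=.
  case: eqP => [jk|_] /=; last by rewrite mulr0 add0r.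
  have -> : j = i by exact: val_inj.
  by rewrite ltnn mulr1 subrK.
have inC t : Num.min 0 a <= t <= Num.max 0 a -> `|t *: e_ i + z k - x0| <= eta.
  move=> ta; apply: norm_le_entries => // j; rewrite !mxE /=.
  have [->|ji] := eqVneq j i.
    rewrite ltnn mulr1 addrK; apply: le_trans (yx' i); rewrite -/a.
    by move: ta; case: (leP 0 a) => a0 /andP[? ?]; [rewrite !ger0_norm|rewrite !ler0_norm]; lra.
  by rewrite mulr0 add0r; case: ifP => _; rewrite ?subrr ?normr0.
have := @mean_value_seg R (fun t => f (t *: e_ i + z k)) (fun t => df i (t *: e_ i + z k)) 0 a B.
rewrite scale0r add0r subr0 -zS => step.
rewrite -(subrK (f (z k)) (f (z k.+1))) -addrA (le_trans (ler_normD _ _))//.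
rewrite -natr1 mulrDl mul1r [leRHS]addrC; apply: lerD; last by apply: IH; exact: ltnW.
have B0 : 0 <= B by apply: le_trans (dB i x0 _); rewrite // subrr normr0.
apply: le_trans (step _ _) _.
- by move=> t /inC tC; exact: (is_derive_line _ _ _ _ _).1 (fd i _ tC).
- by move=> t /inC tC; exact: dB.
- by rewrite ler_wpM2l ?mulr_ge0// yx'.
Qed.

(** Taylor's formula without its main terms: bounds at the centre and a crude
bound of the derivatives of high order give a good bound on a small cube. *)
Lemma jet_cube_bound (O : set E) (W : seq 'I_s -> E -> C) (x0 : E) (eta a b : R) M :
  0 <= eta <= 1 -> is_jet O W -> (forall z, `|z - x0| <= eta -> O z) -> 0 <= a ->
  forall l, (forall l', (size l' <= size l + M)%N -> `|W l' x0| <= a) ->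
  (forall l' z, (size l' <= size l + M)%N -> `|z - x0| <= eta -> `|W l' z| <= b) ->
  forall z, `|z - x0| <= eta -> `|W l z| <= (1 + 2 * s%:R) ^+ M * (a + eta ^+ M * b).
Proof.
move=> /andP[eta0 eta1] jW CO a0; elim: M => [|M IH] l Wa Wb z zx.
  by rewrite !expr0 !mul1r (le_trans (Wb l z _ zx)) ?addn0// lerDr.
pose B := (1 + 2 * s%:R) ^+ M * (a + eta ^+ M * b).
have b0 : 0 <= b by apply: le_trans (Wb l z _ zx); rewrite // leq_addr.
have W1 i y : `|y - x0| <= eta -> `|W (i :: l) y| <= B.
  move=> yx; apply: IH => //.
    by move=> l' /=; rewrite addSnnS; exact: Wa.
  by move=> l' y' /=; rewrite addSnnS; exact: Wb.
have := cube_mean_value zx (fun i y yx => jW l i y (CO y yx)) W1 => MV.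
rewrite -(subrK (W l x0) (W l z)) (le_trans (ler_normD _ _))//.
apply: (@le_trans _ _ (s%:R * (2 * B * eta) + a)).
  by apply: lerD => //; apply: Wa; exact: leq_addr.
have e1 : eta ^+ M <= 1 by rewrite exprn_ile1.
have eM : 0 <= eta ^+ M by exact: exprn_ge0.
have -> : (1 + 2 * s%:R) ^+ M.+1 * (a + eta ^+ M.+1 * b) =
    2 * s%:R * (1 + 2 * s%:R) ^+ M * (a + eta ^+ M.+1 * b) +
    (1 + 2 * s%:R) ^+ M * (a + eta ^+ M.+1 * b) :> R.
  by rewrite (exprS (1 + 2 * s%:R)); ring.
apply: lerD; last first.
  rewrite -[leLHS]mul1r; apply: ler_pM => //.
    by rewrite exprn_ege1// lerDl mulr_ge0.
  by rewrite lerDl mulr_ge0// exprn_ge0.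
have -> : s%:R * (2 * B * eta) = 2 * s%:R * (1 + 2 * s%:R) ^+ M * (eta * a + eta * eta ^+ M * b) :> R.
  by rewrite /B; ring.
apply: ler_wpM2l.
  by rewrite !mulr_ge0// exprn_ge0// addr_ge0// mulr_ge0.
by rewrite exprS; apply: lerD => //; exact: ler_piMl.
Qed.

End JetAlgebra.

(** * Cut-off functions *)

Section Cutoff.
Variables (R : realType) (s : nat).
Local Notation E := 'rV[R]_s.
Local Notation C := (Rcomplex R).
Local Notation e_ i := (delta_mx 0 i : E).

(** The jet of the product of the bumps (x_j - x0_j) / eta: the direction j is
differentiated as often as it occurs in l. *)
Definition cutoff (x0 : E) (eta : R) (l : seq 'I_s) (x : E) : R :=
  \prod_j (eta^-1 ^+ count_mem j l * derive1n (count_mem j l) (@bump R) (eta^-1 * (x 0 j - x0 0 j))).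

Lemma cutoff_jet (x0 : E) (eta : R) (O : set E) : is_jet O (cutoff x0 eta).
Proof.
move=> l i x _.
pose F n (u : R) : R := eta^-1 ^+ n * derive1n n (@bump R) (eta^-1 * (u - x0 0 i)).
pose Q (y : E) : R := \prod_(j | j != i) (eta^-1 ^+ count_mem j l * derive1n (count_mem j l) (@bump R) (eta^-1 * (y 0 j - x0 0 j))).
have FD n (u : R) : is_derive u 1 (F n) (F n.+1 u).
  have D1 : is_derive u 1 (fun u : R => eta^-1 * (u - x0 0 i)) eta^-1.
    apply: (@is_derive_quad _ _ _ _ _ _ _ 0 1) => // h _.
    rewrite [h *: 1]mulr1.
    have -> : eta^-1 * (h + u - x0 0 i) - eta^-1 * (u - x0 0 i) - h *: eta^-1 = 0.
      by rewrite -[h *: _]/(h * _); ring.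
    by rewrite normr0 mul0r.
  have D2 := @is_derive1_comp R _ (fun u : R => eta^-1 * (u - x0 0 i)) u _ _
    (@is_derive_bump R n (eta^-1 * (u - x0 0 i))) D1.
  have := is_deriveZ (eta^-1 ^+ n) D2.
  apply: is_derive_ext => //; rewrite /F exprSr -[_ *: _]/(_ * _); ring.
have D0 : is_derive x (e_ i) (fun y : E => F (count_mem i l) (y 0 i)) (F (count_mem i l).+1 (x 0 i)).
  have /is_deriveP H := FD (count_mem i l) (x 0 i).
  apply/is_deriveP => e /H[d d0 {}H]; exists d => // h /H.
  by rewrite !mxE !eqxx.
have D1 := is_derive_scale D0 (is_derive_cst (Q x : R) x (e_ i)).
rewrite scaler0 addr0 in D1.
have E1 : cutoff x0 eta (i :: l) x = F (count_mem i l).+1 (x 0 i) * Q x.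
  rewrite /cutoff (bigD1 i)//= eqxx add1n; congr (_ * _).
  by apply: eq_bigr => j ji; rewrite eq_sym (negbTE ji) add0n.
rewrite E1; apply: is_derive_local ltr01 _ D1 => h _.
rewrite /cutoff (bigD1 i)//=; congr (_ * _); apply: eq_bigr => j ji.
by rewrite !mxE (negbTE ji) andbF mulr0 add0r.
Qed.

Lemma cutoff1 (x0 : E) (eta : R) (x : E) : 0 < eta -> `|x - x0| <= eta / 2 -> cutoff x0 eta [::] x = 1.
Proof.
move=> eta0 xx; rewrite /cutoff big1// => j _; rewrite expr0 mul1r /= bump1//.
rewrite normrM gtr0_norm ?invr_gt0// ler_pdivrMl// -[_ * 2^-1]/(eta / 2).
by have := norm_entry (x - x0) j; rewrite !mxE => /le_trans; apply.
Qed.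

Lemma cutoff0 (x0 : E) (eta : R) l (x : E) : 0 < eta -> eta < `|x - x0| -> cutoff x0 eta l x = 0.
Proof.
move=> eta0 xx; have [j xj] : exists j, eta < `|x 0 j - x0 0 j|.
  apply: contrapT => /forallNP H; move: xx; apply/negP; rewrite -leNgt.
  apply: norm_le_entries => [|j]; first exact: ltW.
  by rewrite !mxE leNgt; apply/negP; exact: H.
rewrite /cutoff (bigD1 j)//= bump_derive0 ?mulr0 ?mul0r//.
by rewrite normrM gtr0_norm ?invr_gt0// ltr_pdivlMl// mulr1.
Qed.

Lemma cutoff_bound l : exists2 M, 0 <= M & forall (x0 x : E) (eta : R), 0 < eta ->
  `|cutoff x0 eta l x| <= M * eta^-1 ^+ size l.
Proof.
have /choice[B HB] := @bump_derive_bounded R.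
exists (\prod_j `|B (count_mem j l)|); first by rewrite prodr_ge0.
move=> x0 x eta eta0.
rewrite -midx_deg_count /midx_deg -prodrXr /cutoff -big_split normr_prod.
apply: ler_prod => j _; rewrite normr_ge0 /= normrM mulrC.
have e0 : 0 <= eta^-1 ^+ count_mem j l by rewrite exprn_ge0// invr_ge0 ltW.
by rewrite [`|_ ^+ _|]ger0_norm// ler_wpM2r// (le_trans (HB _ _))// ler_norm.
Qed.

Lemma Cn_prod n (I : Type) (r : seq I) (f : I -> R -> R) :
  (forall i, Cn n (f i)) -> Cn n (fun t => \prod_(i <- r) f i t).
Proof.
move=> fn; elim: r => [|i r IH].
  by apply: Cn_ext (Cn_cst n (1 : R)) => t; rewrite big_nil.
apply: Cn_ext (Cn_scale (fn i) IH) => t; by rewrite big_cons.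
Qed.

Lemma Cn_cutoff n (x0 : E) (eta : R) (x : R -> E) : Cn n x -> Cn n (fun t => cutoff x0 eta [::] (x t)).
Proof.
move=> xn; apply: Cn_prod => j.
apply: (@Cn_ext _ _ _ (fun t => bump (eta^-1 * (x t 0 j - x0 0 j)))).
  by move=> t; rewrite expr0 mul1r.
apply: Cn_comp; first exact: Cn_bump.
apply: (@Cn_scale _ R); first exact: Cn_cst.
apply: (@CnD _ R); last exact: Cn_cst.
apply: (@Cn_linear _ _ _ (fun y : E => y 0 j)) xn.
- by move=> a b; rewrite !mxE.
- by move=> k a; rewrite !mxE.
- by move=> a; exact: norm_entry.
Qed.

Lemma Cn_sum (W : normedModType R) n (m : nat) (f : 'I_m -> R -> W) :
  (forall i, Cn n (f i)) -> Cn n (fun t => \sum_i f i t).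
Proof.
elim: m f => [|m IH] f fn.
  by apply: Cn_ext (Cn_cst n (0 : W)) => t; rewrite big_ord0.
apply: Cn_ext (CnD (IH _ (fun i => fn (widen_ord (leqnSn m) i))) (fn ord_max)) => t.
by rewrite big_ord_recr.
Qed.

End Cutoff.

(** * Deviation of the moments of a test object *)

Section TestObject.
Variables (R : realType) (s : nat).
Local Notation E := 'rV[R]_s.
Local Notation C := (Rcomplex R).
Local Notation fn := (E -> C).
Local Notation e_ i := (delta_mx 0 i : E).
Local Notation D := (@test_functions R s setT).

Lemma at_right0P (P : R -> Prop) : (\forall e \near (0 : R)^'+, P e) <->
  exists2 d, 0 < d & forall e, 0 < e < d -> P e.
Proof.
rewrite near_withinE; split=> [/nbhs_ballP[d /= d0 H]|[d d0 H]].
  exists d => // e /andP[e0 ed]; apply: H => //.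
  by rewrite /ball/= sub0r normrN gtr0_norm.
apply/nbhs_ballP; exists d => //= e; rewrite /ball/= sub0r normrN => ed e0.
by apply: H; rewrite e0 (le_lt_trans (ler_norm _)).
Qed.

Lemma LF_bounded_subset (A B : set fn) : A `<=` B -> LF_bounded setT B -> LF_bounded setT A.
Proof.
move=> AB [BD HB]; split; first exact: subset_trans AB BD.
by move=> V /HB[r r0 H]; exists r => //; exact: subset_trans AB H.
Qed.

Lemma compact_margin (K O : set E) : compact K -> open O -> K `<=` O ->
  exists2 r, 0 < r & forall x y, K x -> `|y - x| <= r -> O y.
Proof.
move=> cK oO KO; have /compact_near_coveringP cov := cK.
have : \forall d \near (0 : R)^'+, K `<=` [set x | forall y, `|y - x| <= d -> O y].
  apply: cov => x /KO/(open_ball oO)[d d0 Hd].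
  have d2 : 0 < d / 2 by rewrite divr_gt0.
  exists ([set x' | `|x' - x| < d / 2], [set d' | d' < d / 2]) => /=.
    split; last exact: nbhs_right_lt.
    by apply/nbhs_ballP; exists (d / 2) => //= y; rewrite mx_norm_ball /ball_/= distrC; exact.
  move=> [x' d'] [/= x'x d'd] y yx'; apply: Hd.
  rewrite -(subrK x' y) -addrA (le_lt_trans (ler_normD _ _))// [ltRHS]splitr ltrD//.
  exact: le_lt_trans d'd.
move=> /at_right0P[d d0 H]; exists (d / 2); first by rewrite divr_gt0.
move=> x y Kx; apply: H => //.
by rewrite divr_gt0//= ltr_pdivrMr// ltr_pMr// ltr1n.
Qed.

Lemma compact_thicken (K O : set E) : compact K -> open O -> K `<=` O ->
  exists2 r, 0 < r & exists K', [/\ compact K', K' `<=` O &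
    forall x y, K x -> `|y - x| <= r -> K' y].
Proof.
move=> cK oO KO; have [r r0 H] := compact_margin cK oO KO.
exists r => //; exists ((fun p : E * E => p.1 + p.2) @` (K `*` [set x | `|x - 0| <= r])); split.
- apply: continuous_compact; last by apply: compact_setX => //; exact: ball_compact.
  apply: continuous_subspaceT => p; exact: add_continuous.
- by move=> _ [[x y] [/= Kx yr] <-]; apply: (H x) => //; rewrite addrC addKr -[y]subr0.
- by move=> x y Kx yx; exists (x, y - x) => /=; [split=> //=; rewrite subr0|rewrite addrC subrK].
Qed.

Variables (Omega : set E) (phi : R -> E -> fn).
Hypothesis oO : open Omega.
Hypothesis hphi : test_object Omega phi.
Local Notation Phi e := (LF_partials (phi e)).

Lemma test_object_curve e : unit_itv e -> forall x : R -> E, smooth_curve x ->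
  (forall t, Omega (x t)) -> LF_smooth_curve setT (fun t => phi e (x t)).
Proof.
case: hphi => _ H _ ue x xs xO; apply: (H (fun=> e) x) => //.
by apply/smooth_curveP => n; exact: Cn_cst.
Qed.

Lemma test_object_bounded e : unit_itv e -> forall K al, compact K -> K `<=` Omega ->
  LF_bounded setT [set LF_mpartial setT al (phi e) x | x in K].
Proof.
case: hphi => _ _ H ue K al cK KO; apply: LF_bounded_subset (H K al cK KO).
by move=> _ [x Kx <-]; exists e, x; split.
Qed.

Lemma Phi_derive e l i x : unit_itv e -> Omega x ->
  is_LF_derive setT (Phi e l) x (e_ i) (Phi e (i :: l) x).
Proof.
move=> ue; apply: LF_partials_derive => //.
  exact: test_object_curve.
exact: test_object_bounded.
Qed.

Lemma Phi_mpartial e l x : unit_itv e -> Omega x ->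
  Phi e l x = LF_mpartial setT (fun i => count_mem i l) (phi e) x.
Proof.
move=> ue; apply: LF_partials_mpartial => //.
  exact: test_object_curve.
exact: test_object_bounded.
Qed.

Lemma Phi_bounded l K : compact K -> K `<=` Omega ->
  LF_bounded setT [set f | exists e x, [/\ unit_itv e, K x & f = Phi e l x]].
Proof.
case: hphi => _ _ H cK KO; apply: LF_bounded_subset (H K (fun i => count_mem i l) cK KO).
move=> _ [e [x [ue Kx ->]]]; exists e, x; split=> //.
by rewrite Phi_mpartial//; exact: KO.
Qed.

Lemma Phi_test e l x : unit_itv e -> Omega x -> D (Phi e l x).
Proof.
move=> ue Ox; case: l => [|i l]; first by have [+ _ _] := hphi; move=> /(_ e x ue Ox)[].
by have [] := Phi_derive l i ue Ox.
Qed.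

Lemma Phi_functional (T : fn -> C) e : LF_continuous_functional T -> unit_itv e ->
  is_jet Omega (fun l x => T (Phi e l x)).
Proof.
move=> cT ue l i x Ox; have [d d0 Hd] := dir_open i oO Ox.
apply: (is_LF_derive_functional cT d0 _ (Phi_derive l i ue Ox)) => h hd.
by apply: Phi_test => //; exact: Hd.
Qed.

Variable q : nat.

(** The entries are bounded by q in order to have a finite type. *)
Definition multi_index := {a : {ffun 'I_s -> 'I_q.+1} | (\sum_i (a i : nat) <= q)%N}.
Definition index_of (k : 'I_#|{: multi_index}|) : 'I_s -> nat := fun i => sval (enum_val k) i.

Lemma index_of_deg k : (midx_deg (index_of k) <= q)%N.
Proof. by rewrite /midx_deg /index_of; case: (enum_val k). Qed.

Lemma index_of_surj (al : 'I_s -> nat) : (midx_deg al <= q)%N -> exists k, index_of k = al.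
Proof.
move=> alq; have alq' i : (al i < q.+1)%N.
  by rewrite ltnS (leq_trans _ alq)// /midx_deg (bigD1 i)//= leq_addr.
pose a : {ffun 'I_s -> 'I_q.+1} := [ffun i => Ordinal (alq' i)].
have aq : (\sum_i (a i : nat) <= q)%N.
  by rewrite (eq_bigr al)// => i _; rewrite ffunE.
exists (enum_rank (exist _ a aq : multi_index)).
by apply/funext => i; rewrite /index_of enum_rankK /= ffunE.
Qed.

Local Notation N := #|{: multi_index}|.

(** The deviation of the moments from those of an element of A_0 whose moments
of order 1 to q vanish. *)
Definition deviation (k : 'I_N) (e : R) (l : seq 'I_s) (x : E) : C :=
  if midx_deg (index_of k) == 0%N then 0 else moment (index_of k) (Phi e l x).

Lemma deviation_jet k e : unit_itv e -> is_jet Omega (deviation k e).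
Proof.
move=> ue; rewrite /deviation; case: (_ == 0%N).
  exact: is_jet0.
exact: Phi_functional (@moment_LF_continuous R s (index_of k)) ue.
Qed.

Lemma ord_bound n (P : 'I_n -> R -> Prop) : (forall k M M', P k M -> M <= M' -> P k M') ->
  (forall k, exists M, P k M) -> exists M, forall k, P k M.
Proof.
move=> mono /choice[F HF]; exists (\sum_k `|F k|) => k; apply: mono (HF k) _.
by rewrite (bigD1 k)//= (le_trans (ler_norm _))// lerDl sumr_ge0.
Qed.

Lemma deviation_bounded l K : compact K -> K `<=` Omega ->
  exists M, forall k e x, unit_itv e -> K x -> `|deviation k e l x| <= M.
Proof.
move=> cK KO; apply: (@ord_bound N (fun k M => forall e x, unit_itv e -> K x -> `|deviation k e l x| <= M)).
  by move=> k M M' H MM' e x ue Kx; exact: le_trans (H e x ue Kx) MM'.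
move=> k; have [M HM] := moment_LF_bounded (index_of k) (Phi_bounded l cK KO).
exists `|M| => e x ue Kx; rewrite /deviation; case: ifP => _.
  by rewrite normr0.
by apply: le_trans (ler_norm _); apply: HM; exists e, x.
Qed.

Variable K : set E.
Hypothesis cK : compact K.
Hypothesis KO : K `<=` Omega.
Hypothesis phiK : type_Al K (q + 2) phi.

(** The estimate holds below some threshold only; the condition e * M < 1 expresses
this by the same constant M. *)
Lemma deviation_small l : exists M, forall k e x, unit_itv e -> e * M < 1 -> K x ->
  `|deviation k e l x| <= M * e ^+ (q + 2).
Proof.
apply: (@ord_bound N (fun k M => forall e x, unit_itv e -> e * M < 1 -> K x -> `|deviation k e l x| <= M * e ^+ (q + 2))).
  move=> k M M' H MM' e x ue eM' Kx; have /andP[e0 e1] := ue.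
  apply: le_trans (H e x ue _ Kx) _.
    by apply: le_lt_trans eM'; rewrite ler_wpM2l// ltW.
  by rewrite ler_wpM2r// exprn_ge0// ltW.
move=> k; rewrite /deviation; case: (boolP (_ == 0%N)) => [_|k0].
  by exists 0 => e x _ _ _; rewrite normr0 mul0r.
have kq : (1 <= midx_deg (index_of k) <= q + 2)%N.
  by rewrite lt0n k0 (leq_trans (index_of_deg k))// leq_addr.
have [M /at_right0P[d d0 H]] := phiK (fun i => count_mem i l) kq.
exists (`|M| + d^-1) => e x ue eM Kx; have /andP[e0 e1] := ue.
have ed : e < d.
  have : e * d^-1 < 1 by apply: le_lt_trans eM; rewrite ler_wpM2l ?(ltW e0)// lerDr.
  by rewrite ltr_pdivrMr// mul1r.
have e0d : 0 < e < d by rewrite e0.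
rewrite Phi_mpartial//; last exact: KO.
apply: le_trans (H e e0d x Kx) _; rewrite ler_wpM2r ?exprn_ge0 ?(ltW e0)//.
by rewrite (le_trans (ler_norm _))// lerDl invr_ge0 ltW.
Qed.

(** With eta = eps^(1/(k+1)), Taylor's formula with M = (q+2)(k+1) terms shows that
the deviation is O (eps^(q+2)) on the cube, and a derivative of the cut-off
function of order at most k is O (eta^(-k)), hence O (eps^(-1)). The remaining
factor eps absorbs the constants for small eps. *)
Lemma cutoff_deviation_small (r : R) K' k : 0 < r -> compact K' -> K' `<=` Omega ->
  (forall x y, K x -> `|y - x| <= r -> K' y) ->
  exists2 t, 0 < t & forall eps, 0 < eps < t -> exists2 eta, 0 < eta <= r &
    forall l j e x0 y, (size l <= k)%N -> `|e - eps| < eps / 4 -> K x0 -> `|y - x0| <= eta ->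
      `|leibniz (cutoff x0 eta) (deviation j e) l y| <= e ^+ q.
Proof.
move=> r0 cK' K'O KK'.
pose M := (q.+2 * k.+1)%N.
have [||A HA] := @lists_bound R s (fun l A => forall k e x, unit_itv e -> e * A < 1 -> K x ->
    `|deviation k e l x| <= A * e ^+ (q + 2)) (k + M).
- move=> l A A' H AA' j e x ue eA' Kx; have /andP[e0 e1] := ue.
  apply: le_trans (H j e x ue _ Kx) _.
    by apply: le_lt_trans eA'; rewrite ler_wpM2l// ltW.
  by rewrite ler_wpM2r// exprn_ge0// ltW.
- exact: deviation_small.
have [||B HB] := @lists_bound R s (fun l B => forall k e x, unit_itv e -> K' x -> `|deviation k e l x| <= B) (k + M).
- by move=> l B B' H BB' j e x ue Kx; exact: le_trans (H j e x ue Kx) BB'.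
- by move=> l; exact: deviation_bounded.
have [||Cx HC] := @lists_bound R s (fun l M => forall (x0 x : E) (eta : R), 0 < eta ->
  `|cutoff x0 eta l x| <= M * eta^-1 ^+ size l) k.
- move=> l C0 C1 H CC x0 x eta eta0; apply: le_trans (H x0 x eta eta0) _.
  by rewrite ler_wpM2r// exprn_ge0// invr_ge0 ltW.
- by move=> l; have [C0 _ HC0] := cutoff_bound R l; exists C0.
pose G : R := (1 + 2 * s%:R) ^+ M * (`|A| + 2 ^+ (q + 2) * `|B|).
have G0 : 0 <= G by rewrite mulr_ge0 ?exprn_ge0 ?addr_ge0 ?mulr_ge0.
pose H : R := 2 ^+ k * (2 * `|Cx| * G) + 1.
have H0 : 0 < H by rewrite ltr_wpDl// !mulr_ge0// exprn_ge0.
have A1 : 0 < `|A| + 1 by rewrite ltr_wpDl.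
(* The four conditions ensure, for |e - eps| < eps / 4, that e <= 1, that
   e * A < 1, that eta <= r, and that the constants are absorbed. *)
pose t := Num.min (2^-1 : R) (Num.min ((2 * (`|A| + 1))^-1) (Num.min (r ^+ k.+1) (2 * H)^-1)).
exists t.
  by rewrite !lt_min !invr_gt0 exprn_gt0// !mulr_gt0// ltr0n.
move=> eps /andP[eps0]; rewrite !lt_min => /and4P[eps2 epsA epsr epsH].
pose eta := eps `^ k.+1%:R^-1.
have etak : eta ^+ k.+1 = eps.
  by rewrite -powR_mulrn ?powR_ge0// -powRrM mulVf ?pnatr_eq0// powRr1// ltW.
have eta0 : 0 < eta by rewrite powR_gt0.
have eta1 : eta <= 1.
  by rewrite -(@expr_le1 _ k.+1) ?etak ?(ltW eta0)//; lra.
have etar : eta <= r.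
  by rewrite -(@ler_pXn2r _ k.+1) ?nnegrE ?(ltW eta0) ?(ltW r0)// etak ltW.
exists eta; first by rewrite eta0.
move=> l j e x0 y lk ee Kx0 yx0.
have /andP[e1 e2] : (3 / 4 * eps < e) && (e < 5 / 4 * eps).
  by move: ee; rewrite ltr_norml => /andP[? ?]; apply/andP; split; lra.
have e0 : 0 < e by lra.
have ue : unit_itv e by rewrite /unit_itv/= e0; lra.
have epsA' : eps * (2 * (`|A| + 1)) < 1 by rewrite -ltr_pdivlMr ?mulr_gt0// div1r.
have epsH' : eps * (2 * H) < 1 by rewrite -ltr_pdivlMr ?mulr_gt0// div1r.
have eA : e * A < 1.
  apply: (@le_lt_trans _ _ (e * (`|A| + 1))).
    by rewrite ler_wpM2l ?(ltW e0)// (le_trans (ler_norm _))// lerDl.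
  have : e * (`|A| + 1) <= 5 / 4 * eps * (`|A| + 1) by rewrite ler_wpM2r// ltW.
  move: epsA' A1; set a := `|A| + 1 => ? ? ?.
  have : 0 < eps * a by rewrite mulr_gt0.
  lra.
have CO z : `|z - x0| <= eta -> Omega z.
  by move=> zx; apply/K'O/(KK' x0) => //; exact: le_trans zx etar.
have eq0 m : 0 <= e ^+ m by rewrite exprn_ge0// ltW.
have dev l' : (size l' <= size l)%N -> `|deviation j e l' y| <= G * e ^+ (q + 2).
  move=> l'l; have l'k : (size l' <= k)%N := leq_trans l'l lk.
  have eta01 : 0 <= eta <= 1 by rewrite (ltW eta0) eta1.
  have a0 : 0 <= `|A| * e ^+ (q + 2) by rewrite mulr_ge0.
  have := @jet_cube_bound R s Omega (deviation j e) x0 eta (`|A| * e ^+ (q + 2)) `|B| M eta01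
    (deviation_jet j ue) CO a0 l'.
  move=> /(_ _ _ y yx0)/le_trans; apply.
  - move=> l0 l0k; apply: le_trans (HA l0 _ j e x0 ue eA Kx0) _.
      by rewrite (leq_trans l0k)// leq_add2r.
    by rewrite ler_wpM2r// ler_norm.
  - move=> l0 z l0k zx; apply: le_trans (HB l0 _ j e z ue _) (ler_norm _).
      by rewrite (leq_trans l0k)// leq_add2r.
    by apply: (KK' x0) => //; exact: le_trans zx etar.
  rewrite /G -mulrA ler_wpM2l ?exprn_ge0 ?addr_ge0 ?mulr_ge0//.
  rewrite mulrDl lerD// mulrAC ler_wpM2r//.
  rewrite /M mulnC exprM etak -addn2 -exprMn.
  by apply: lerXn2r; rewrite ?nnegrE; lra.
have cut l' : (size l' <= size l)%N -> `|cutoff x0 eta l' y| <= `|Cx| * eps^-1.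
  move=> l'l; have l'k : (size l' <= k)%N := leq_trans l'l lk.
  apply: le_trans (HC l' l'k x0 y eta eta0) _.
  have e1' : 1 <= eta^-1 by rewrite invf_ge1.
  apply: ler_pM; rewrite ?exprn_ge0 ?invr_ge0 ?(ltW eta0) ?ler_norm//; last first.
    rewrite -etak -exprVn ler_weXn2l//.
    exact: leq_trans l'k (leqnSn k).
  have := le_trans (normr_ge0 _) (HC [::] isT x0 y eta eta0).
  by rewrite expr0 mulr1.
apply: le_trans (leibniz_bound cut dev) _.
have k2 : (2 : R) ^+ size l <= 2 ^+ k by rewrite ler_weXn2l// ler1n.
apply: (@le_trans _ _ (2 ^+ k * (`|Cx| / eps * (G * e ^+ (q + 2))))).
  by rewrite ler_wpM2r// !mulr_ge0// invr_ge0 ltW.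
have -> : e ^+ (q + 2) = e ^+ q * (e * e) by rewrite exprD expr2.
have -> : 2 ^+ k * (`|Cx| / eps * (G * (e ^+ q * (e * e)))) =
    e ^+ q * ((2 ^+ k * (`|Cx| * G) * e) * (e / eps)) by ring.
rewrite -[leRHS]mulr1; apply: ler_wpM2l => //.
have ee2 : e / eps <= 2 by rewrite ler_pdivrMr//; lra.
have z0 : 0 <= 2 ^+ k * (`|Cx| * G) * e by rewrite !mulr_ge0 ?exprn_ge0// ltW.
apply: le_trans (ler_wpM2l z0 ee2) _.
have -> : 2 ^+ k * (`|Cx| * G) * e * 2 = (H - 1) * e by rewrite /H; ring.
have : (H - 1) * e <= H * e by rewrite ler_wpM2r ?(ltW e0)// gerBl.
have : H * e <= H * (5 / 4 * eps) by rewrite ler_wpM2l ?(ltW H0)// ltW.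
have : 0 < eps * H by rewrite mulr_gt0.
move: epsH'; lra.
Qed.

End TestObject.

(** * Correction of the moments *)

Section Correction.
Variables (R : realType) (s : nat).
Local Notation E := 'rV[R]_s.
Local Notation C := (Rcomplex R).
Local Notation fn := (E -> C).
Local Notation e_ i := (delta_mx 0 i : E).
Local Notation D := (@test_functions R s setT).

Lemma smooth_curve_derive (W : normedModType R) (c : R -> W) n (t : R) : smooth_curve c ->
  is_derive t 1 (derive1n n c) (derive1n n.+1 c t).
Proof. by move=> cs; rewrite derive1nS derive1E; apply/derivableP; exact: cs. Qed.

Lemma fn_sumE (n : nat) (F : 'I_n -> fn) x : (\sum_i F i) x = \sum_i F i x.
Proof. by rewrite fct_sumE. Qed.

Lemma test_function_sum (n : nat) (z : 'I_n -> C) (g : 'I_n -> fn) : (forall i, D (g i)) ->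
  D (\sum_i (fun xi => z i * g i xi)).
Proof.
move=> Dg; elim/big_ind: _ => [|f h|i _]; first exact: test_function0.
  exact: test_functionD.
exact: test_functionM.
Qed.

Lemma moment_sum (al : 'I_s -> nat) (n : nat) (z : 'I_n -> C) (g : 'I_n -> fn) :
  (forall i, D (g i)) ->
  moment al (\sum_i (fun xi => z i * g i xi)) = \sum_i z i * moment al (g i).
Proof.
move=> Dg; elim: n z g Dg => [|n IH] z g Dg.
  rewrite !big_ord0.
  have := @momentM R s al 0 0 (test_function0 R s).
  rewrite mul0r => <-; congr moment; apply/funext => x; by rewrite mul0r.
rewrite !big_ord_recl momentD ?momentM ?IH//.
- by apply: test_functionM.
- exact: test_function_sum.
Qed.

Variables (Omega : set E) (phi : R -> E -> fn) (q : nat).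
Hypothesis oO : open Omega.
Hypothesis hphi : test_object Omega phi.
Local Notation Phi e := (LF_partials (phi e)).
Local Notation N := #|{: multi_index s q}|.
Local Notation dev := (@deviation R s phi q).

Variables (r : nat) (g : 'I_r -> fn) (P : 'I_N -> 'I_r -> C).
Hypothesis Dg : forall i, D (g i).
Hypothesis section_dev : forall e x, unit_itv e -> Omega x -> forall j : 'I_N,
  \sum_i (\sum_k dev k e [::] x * P k i) * moment (index_of j) (g i) = dev j e [::] x.
Variable Lam : R -> seq 'I_s -> E -> R.
(* Lam e is the jet of the localizing function; the last hypothesis states that
   the localized deviation is small, uniformly on Omega. *)
Hypothesis Lam_jet : forall e, is_jet Omega (Lam e).
Hypothesis Lam_curve : forall (e : R -> R) (x : R -> E),
  smooth_curve e -> (forall t, unit_itv (e t)) -> smooth_curve x -> (forall t, Omega (x t)) ->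
  smooth_curve (fun t => Lam (e t) [::] (x t)).
Hypothesis Lam_dev : forall l, exists M, forall (j : 'I_N) e x, unit_itv e -> Omega x ->
  `|leibniz (Lam e) (dev j e) l x| <= M * e ^+ q.

(** The jet of the coefficient of g i, namely ((Lam - 1) W P)_i for the vector W of
the deviations. *)
Definition correction i e l x : C :=
  \sum_k (leibniz (Lam e) (dev k e) l x - dev k e l x) * P k i.

Definition corrected_partials e l x : fn :=
  Phi e l x + \sum_i (fun xi => correction i e l x * g i xi).

Definition corrected e x : fn := corrected_partials e [::] x.

Lemma correction_jet i e : unit_itv e -> is_jet Omega (correction i e).
Proof.
move=> ue; apply: jet_sum => k; apply: jet_mulr; apply: jet_sub.
  exact: (jet_leibniz (@Lam_jet e) (deviation_jet oO hphi _ ue)).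
exact: (deviation_jet oO hphi _ ue).
Qed.

Lemma corrected_derive e l i x : unit_itv e -> Omega x ->
  is_LF_derive setT (corrected_partials e l) x (e_ i) (corrected_partials e (i :: l) x).
Proof.
move=> ue Ox; apply: is_LF_deriveD; first exact: (Phi_derive oO hphi _ _ ue Ox).
apply: is_LF_derive_sum => j; apply: is_LF_derive_scalar; first exact: Dg.
exact: (correction_jet _ ue).
Qed.

Lemma corrected_partialsE e l x : unit_itv e -> Omega x ->
  LF_partials (corrected e) l x = corrected_partials e l x.
Proof.
move=> ue; elim: l x => //= i l IH x Ox.
rewrite (LF_derive_congr _ oO Ox IH).
exact: is_LF_deriveE (corrected_derive _ _ ue Ox).
Qed.

Lemma corrected_test e l x : unit_itv e -> Omega x -> D (corrected_partials e l x).
Proof.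
by move=> ue Ox; apply: test_functionD; [exact: (Phi_test oO hphi _ ue Ox)|exact: test_function_sum].
Qed.

(** The moments of the corrections are known by [section_dev] for l = [::]; both
sides are jets, so that the equality extends to all l. *)
Lemma corrected_moment (j : 'I_N) e l x : unit_itv e -> Omega x ->
  moment (index_of j) (corrected_partials e l x) =
  moment (index_of j) (Phi e l x) + (leibniz (Lam e) (dev j e) l x - dev j e l x).
Proof.
move=> ue Ox; rewrite (momentD _ (Phi_test oO hphi l ue Ox) (test_function_sum _ Dg)).
rewrite moment_sum//; congr (_ + _).
have j1 : is_jet Omega (fun l x => \sum_i correction i e l x * moment (index_of j) (g i) : C).
  by apply: jet_sum => i; apply: jet_mulr; exact: (correction_jet _ ue).
have j2 : is_jet Omega (fun l x => leibniz (Lam e) (dev j e) l x - dev j e l x).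
  apply: jet_sub; last exact: (deviation_jet oO hphi _ ue).
  exact: (jet_leibniz (@Lam_jet e) (deviation_jet oO hphi _ ue)).
apply: (jet_unique oO j1 j2) => // y Oy.
rewrite /correction /leibniz /= big_seq1.
rewrite -!(section_dev ue Oy j) scaler_sumr -sumrB; apply: eq_bigr => i _.
rewrite scalerMC -mulrBl; congr (_ * _).
rewrite scaler_sumr -sumrB; apply: eq_bigr => k _.
by rewrite big_seq1 mulrBl scalerMC.
Qed.

Lemma corrected_A0 e x : unit_itv e -> Omega x -> A0 setT (corrected e x).
Proof.
move=> ue Ox; split; first exact: corrected_test.
have [|j jE] := @index_of_surj s q (fun=> 0%N).
  by rewrite /midx_deg big1.
have [H _ _] := hphi; have [_ phi1] := H e x ue Ox.
have := corrected_moment j [::] ue Ox.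
rewrite /leibniz /= big_seq1 /dev /deviation jE.
have -> : midx_deg (fun _ : 'I_s => 0%N) == 0%N by rewrite /midx_deg big1.
by rewrite scaler0 subr0 addr0 !moment0E phi1.
Qed.

Lemma deviation_curve (k : 'I_N) (e : R -> R) (x : R -> E) :
  smooth_curve e -> (forall t, unit_itv (e t)) -> smooth_curve x -> (forall t, Omega (x t)) ->
  smooth_curve (fun t => dev k (e t) [::] (x t)).
Proof.
move=> es eI xs xO; rewrite /dev /deviation; case: (_ == 0%N).
  by apply/smooth_curveP => n; exact: Cn_cst.
have [_ H _] := hphi; have [d [d0 dH]] := H e x es eI xs xO.
have -> : (fun t => moment (index_of k) (Phi (e t) [::] (x t))) =
    (fun t => moment (index_of k) (d 0%N t)) by rewrite d0.
apply: (@smooth_curve_seq R _ (fun n t => moment (index_of k) (d n t))) => n t.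
apply: (is_LF_derive_functional (@moment_LF_continuous R s (index_of k)) ltr01 _ (dH n t).2).
by move=> h _; exact: (dH n _).1.
Qed.

Lemma correction_curve i (e : R -> R) (x : R -> E) :
  smooth_curve e -> (forall t, unit_itv (e t)) -> smooth_curve x -> (forall t, Omega (x t)) ->
  smooth_curve (fun t => correction i (e t) [::] (x t)).
Proof.
move=> es eI xs xO; apply/smooth_curveP => n; apply: Cn_sum => k.
have /smooth_curveP/(_ n) dn := @deviation_curve k e x es eI xs xO.
have /smooth_curveP/(_ n) Ln := Lam_curve es eI xs xO.
apply: Cn_mulC; last exact: Cn_cst.
apply: (@Cn_ext _ _ _ (fun t => Lam (e t) [::] (x t) *: dev k (e t) [::] (x t) + (-1 : R) *: dev k (e t) [::] (x t))).
  by move=> t; rewrite /leibniz /= big_seq1 scaleN1r.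
apply: CnD; first exact: Cn_scale.
by apply: Cn_scale => //; exact: Cn_cst.
Qed.

(** The coefficients are smooth along smooth curves, because moments are
continuous linear functionals and the localizing function is smooth. *)
Lemma corrected_curve (e : R -> R) (x : R -> E) :
  smooth_curve e -> (forall t, unit_itv (e t)) -> smooth_curve x -> (forall t, Omega (x t)) ->
  LF_smooth_curve setT (fun t => corrected (e t) (x t)).
Proof.
move=> es eI xs xO; have [_ H _] := hphi; have [d [d0 dH]] := H e x es eI xs xO.
pose c i t := correction i (e t) [::] (x t).
exists (fun n t => d n t + \sum_i (fun xi => derive1n n (c i) t * g i xi)); split.
  by apply/funext => t; rewrite d0.
move=> n t; split.
  by apply: test_functionD; [exact: (dH n t).1|exact: test_function_sum].
apply: is_LF_deriveD; first exact: (dH n t).2.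
apply: is_LF_derive_sum => i; apply: is_LF_derive_scalar; first exact: Dg.
by apply: smooth_curve_derive; exact: correction_curve.
Qed.

(** The derivatives of the localizing function are not bounded uniformly in e, but
those of its product with the deviation are. *)
Lemma correction_bounded l L : compact L -> L `<=` Omega ->
  exists M, forall i e x, unit_itv e -> L x -> `|correction i e l x| <= M.
Proof.
move=> cL LO; apply: (@ord_bound R r (fun i M => forall e x, unit_itv e -> L x -> `|correction i e l x| <= M)).
  by move=> i M M' H MM' e x ue Lx; exact: le_trans (H e x ue Lx) MM'.
move=> i; have [M HM] := Lam_dev l; have [M' HM'] := deviation_bounded oO hphi q l cL LO.
exists (\sum_k (`|M| + `|M'|) * `|P k i : C|) => e x ue Lx; have /andP[e0 e1] := ue.
apply: le_trans (ler_norm_sum _ _ _) _; apply: ler_sum => k _; rewrite normCM.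
apply: ler_wpM2r => //; apply: le_trans (ler_normB _ _) _; apply: lerD.
  apply: le_trans (HM k e x ue (LO _ Lx)) _.
  apply: (@le_trans _ _ (`|M| * e ^+ q)).
    by rewrite ler_wpM2r ?ler_norm// exprn_ge0// ltW.
  by apply: ler_piMr => //; apply: exprn_ile1 => //; exact: ltW.
by apply: le_trans (ler_norm _); exact: HM'.
Qed.

Lemma corrected_bounded l L : compact L -> L `<=` Omega ->
  LF_bounded setT [set f | exists e x, [/\ unit_itv e, L x & f = corrected_partials e l x]].
Proof.
move=> cL LO.
have bA := Phi_bounded oO hphi l cL LO.
have [c Hc] := correction_bounded l cL LO.
have gs i : smooth (g i) by exact: test_function_smooth.
have partials_sum e x l' : partials l' (\sum_i (fun xi => correction i e l x * g i xi)) =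
    \sum_i (fun xi => correction i e l x * partials l' (g i) xi).
  apply: (@proj2 (smooth (\sum_i (fun xi => correction i e l x * g i xi)))).
  elim/big_rec2: _ => [|i f h _ [hs hE]].
    split; first exact: smooth0.
    have := @partialsM R s 0 0 l' (@smooth0 R s).
    have -> : (fun x0 : E => (0 : C) * (0 : fn) x0) = (0 : fn) by apply/funext => y; rewrite mul0r.
    by move=> ->; apply/funext => y; rewrite mul0r.
  split; first by apply: smoothD => //; exact: smoothM.
  by rewrite partialsD ?partialsM ?hE//; exact: smoothM.
apply: LF_boundedI.
- move=> _ [e [x [ue Lx ->]]]; exact: (test_function_smooth (corrected_test _ ue (LO _ Lx))).
- have [rho Hrho] := LF_bounded_support bA.
  have [rho' Hrho'] : exists rho', forall i x, rho' < `|x| -> g i x = 0.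
    apply: (@ord_bound R r (fun i rho' => forall x, rho' < `|x| -> g i x = 0)).
      by move=> i M M' H MM' x xM'; apply: H; exact: le_lt_trans xM'.
    by move=> i; have /test_functionP[] := Dg i.
  exists (Num.max rho rho') => _ [e [x [ue Lx ->]]] y; rewrite gt_max => /andP[y1 y2].
  rewrite /corrected_partials /GRing.add /= fn_sumE.
  rewrite (Hrho (Phi e l x))//; last by exists e, x; split.
  by rewrite add0r big1// => i _; rewrite Hrho' ?mulr0.
- move=> l'; have [M HM] := LF_bounded_partials l' bA.
  have [M' HM'] : exists M, forall i x, `|partials l' (g i) x| <= M.
    apply: (@ord_bound R r (fun i M => forall x, `|partials l' (g i) x| <= M)).
      by move=> i M1 M2 H MM x; exact: le_trans (H x) MM.
    by move=> i; exact: test_function_bounded (Dg i).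
  exists (M + \sum_(i < r) `|c| * `|M'|) => _ [e [x [ue Lx ->]]] y.
  have Dphi : D (Phi e l x) := Phi_test oO hphi l ue (LO _ Lx).
  rewrite /corrected_partials partialsD; first last.
  - by apply: test_function_smooth; exact: test_function_sum.
  - exact: test_function_smooth.
  rewrite partials_sum; apply: le_trans (ler_normD _ _) _; apply: lerD.
    by apply: HM; exists e, x; split.
  rewrite fn_sumE; apply: le_trans (ler_norm_sum _ _ _) _; apply: ler_sum => i _.
  rewrite normCM; apply: ler_pM => //.
    by apply: le_trans (ler_norm _); exact: Hc.
  by apply: le_trans (ler_norm _); exact: HM'.
Qed.

Lemma corrected_test_object : test_object Omega corrected.
Proof.
split; [exact: corrected_A0|exact: corrected_curve|] => L al cL LO.
apply: LF_bounded_subset (corrected_bounded (midx_dirs al) cL LO) => _ [e [x [ue Lx ->]]].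
by exists e, x; split => //; exact: (corrected_partialsE _ ue (LO _ Lx)).
Qed.

Lemma corrected_type : type_Ag Omega q corrected.
Proof.
move=> L cL LO al be /andP[al1 alq]; have [j jE] := index_of_surj alq.
have [M HM] := Lam_dev (midx_dirs be).
exists M; apply/at_right0P; exists 1; first exact: ltr01.
move=> e /andP[e0 e1] x Lx; have Ox := LO _ Lx.
have ue : unit_itv e by rewrite /unit_itv/= e0 ltW.
have -> : LF_mpartial setT be (corrected e) x = corrected_partials e (midx_dirs be) x.
  exact: corrected_partialsE.
have devE : dev j e (midx_dirs be) x = moment al (Phi e (midx_dirs be) x).
  by rewrite /deviation jE -[_ == 0%N]negbK -lt0n al1.
have := corrected_moment j (midx_dirs be) ue Ox; rewrite devE jE => ->.
by rewrite addrC subrK; exact: HM.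
Qed.

Lemma corrected_eq e x : Lam e [::] x = 1 -> corrected e x = phi e x.
Proof.
move=> L1; apply/funext => xi; rewrite /corrected /corrected_partials /GRing.add /= fn_sumE.
rewrite big1 ?addr0// => i _; rewrite /correction big1 ?mul0r// => k _.
by rewrite /leibniz /= big_seq1 L1 scale1r subrr mul0r.
Qed.

End Correction.

(** * Localization near a sequence of points *)

Section Windows.
Variables (R : realType) (s : nat).
Local Notation E := 'rV[R]_s.
Local Notation C := (Rcomplex R).
Local Notation fn := (E -> C).
Local Notation e_ i := (delta_mx 0 i : E).
Local Notation D := (@test_functions R s setT).

Lemma leibnizZ (V : normedModType R) (a : R) X (Y : seq 'I_s -> E -> V) l x :
  leibniz (fun l x => a * X l x) Y l x = a *: leibniz X Y l x.
Proof. by rewrite /leibniz scaler_sumr; apply: eq_bigr => p _; rewrite scalerA. Qed.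

Lemma leibniz0 (V : normedModType R) X (Y : seq 'I_s -> E -> V) l x :
  (forall l', X l' x = 0) -> leibniz X Y l x = 0.
Proof. by move=> X0; rewrite /leibniz big1// => p _; rewrite X0 scale0r. Qed.

Variables (eps eta : nat -> R) (xs : nat -> E).
Hypothesis eps0 : forall k, 0 < eps k.
Hypothesis epsS : forall k, eps k.+1 < eps k / 8.
Hypothesis eps_inv : forall k, eps k < k.+1%:R^-1.
Hypothesis eta0 : forall k, 0 < eta k.

Definition window k : set R := [set e | `|e - eps k| < eps k / 4].

Lemma eps_decr k m : (k < m)%N -> eps m < eps k / 8.
Proof.
elim: m => // m IH; rewrite ltnS leq_eqVlt => /orP[/eqP <- //|/IH H].
apply: lt_trans (epsS m) _; apply: le_lt_trans H.
by rewrite ler_pdivrMr// ler_peMr ?(ltW (eps0 m))// ler1n.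
Qed.

(** The windows are disjoint because 5/4 * eps (k + 1) < 3/4 * eps k. *)
Lemma window_unique k m e : window k e -> window m e -> k = m.
Proof.
wlog km : k m / (k < m)%N => [W wk wm|].
  by case: (ltngtP k m) => [km|mk|//]; [exact: W km wk wm|apply/esym; exact: W mk wm wk].
rewrite /window /= !ltr_norml => /andP[a1 a2] /andP[b1 b2].
by exfalso; have := eps_decr km; have := eps0 k; have := eps0 m; lra.
Qed.

(** Outside of all windows this is a default value, where [localizer] vanishes
because every [window_bump] does. *)
Definition window_index (e : R) : nat := get [set k | window k e].

Lemma window_indexE k e : window k e -> window_index e = k.
Proof.
move=> wk; apply: (@window_unique _ _ e) => //.
exact: (@getPex _ [set k | window k e] (ex_intro _ k wk)).
Qed.

Definition window_bump k (e : R) : R := bump (4 / eps k * (e - eps k)).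

Lemma window_bump1 k : window_bump k (eps k) = 1.
Proof. by rewrite /window_bump subrr mulr0 bump1// normr0. Qed.

Lemma window_bump0 k e : ~ window k e -> window_bump k e = 0.
Proof.
move=> /negP; rewrite -leNgt => H; apply: bump0.
rewrite normrM gtr0_norm ?divr_gt0//.
have E1 : (1 : R) = 4 / eps k * (eps k / 4) by field; rewrite gt_eqF.
by rewrite [leLHS]E1 ler_wpM2l// divr_ge0// ltW.
Qed.

Lemma Cn_window_bump n k (e : R -> R) : Cn n e -> Cn n (fun t => window_bump k (e t)).
Proof.
move=> en; rewrite /window_bump.
apply: (@Cn_comp _ n (@bump R) (fun t => 4 / eps k * (e t - eps k))); first exact: Cn_bump.
apply: (@Cn_scale _ R); first exact: Cn_cst.
by apply: (@CnD _ R) => //; exact: Cn_cst.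
Qed.

Definition localizer (e : R) (l : seq 'I_s) (x : E) : R :=
  window_bump (window_index e) e * cutoff (xs (window_index e)) (eta (window_index e)) l x.

Lemma localizer1 k x : `|x - xs k| <= eta k / 2 -> localizer (eps k) [::] x = 1.
Proof.
move=> xk; have wk : window k (eps k) by rewrite /window /= subrr normr0 divr_gt0.
by rewrite /localizer (window_indexE wk) window_bump1 mul1r cutoff1.
Qed.

Lemma localizer_jet (O : set E) e : is_jet O (localizer e).
Proof.
move=> l i x Ox; rewrite /localizer.
exact: is_deriveZ (cutoff_jet _ _ l i Ox).
Qed.

Lemma localizer_sum n e x : (forall k, window k e -> (k < n)%N) ->
  localizer e [::] x = \sum_(k < n) window_bump k e * cutoff (xs k) (eta k) [::] x.
Proof.
move=> wn; have [wk|nw] := pselect (window (window_index e) e).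
  rewrite (bigD1 (Ordinal (wn _ wk)))//= big1 ?addr0// => k kn.
  rewrite window_bump0 ?mul0r// => wk'; move: kn; rewrite -val_eqE /= => /eqP; apply.
  exact: window_unique wk' wk.
rewrite /localizer window_bump0// mul0r big1// => k _.
rewrite window_bump0 ?mul0r// => wk; apply: nw.
by rewrite (window_indexE wk).
Qed.

(** As e (t) is bounded from below by a positive number locally, only finitely many
windows matter. *)
Lemma localizer_curve (e : R -> R) (x : R -> E) :
  smooth_curve e -> (forall t, unit_itv (e t)) -> smooth_curve x ->
  smooth_curve (fun t => localizer (e t) [::] (x t)).
Proof.
move=> es eI xs'; apply: smooth_curve_local => t.
have /andP[et0 _] := eI t.
have [n Hn] : exists n, forall k, (n <= k)%N -> eps k < e t / 4.
  have [n _ Hn] := @near_infty_natSinv_lt R (PosNum (divr_gt0 et0 (ltr0Sn R 3))).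
  exists n => k nk; apply: lt_trans (eps_inv k) _; exact: Hn.
exists (fun u => \sum_(k < n) window_bump k (e u) * cutoff (xs k) (eta k) [::] (x u)).
  apply/smooth_curveP => m; apply: Cn_sum => k; apply: (@Cn_scale _ R).
    by apply: Cn_window_bump; exact: (smooth_curveP e).1.
  by apply: Cn_cutoff; exact: (smooth_curveP x).1.
have ec : {for t, continuous e}.
  by apply: differentiable_continuous; apply/derivable1_diffP; exact: (es 0%N t).
have [d d0 Hd] : exists2 d, 0 < d & forall u, `|u - t| < d -> `|e u - e t| < e t / 2.
  have /cvgrPdist_lt/(_ (e t / 2)) := ec; rewrite divr_gt0// => /(_ isT)/nbhs_ballP[d /= d0 H].
  by exists d => // u ut; rewrite distrC; apply: H; rewrite /ball/= distrC.
exists d => // u /Hd; rewrite ltr_norml => /andP[u1 u2].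
apply: localizer_sum => k; rewrite /window /= ltr_norml => /andP[k1 k2].
rewrite ltnNge; apply/negP => /Hn; have := eps0 k; lra.
Qed.

Variables (Omega K' : set E) (phi : R -> E -> fn) (q : nat).
Hypothesis oO : open Omega.
Hypothesis hphi : test_object Omega phi.
Hypothesis cK' : compact K'.
Hypothesis K'O : K' `<=` Omega.
Hypothesis cubeK : forall k y, `|y - xs k| <= eta k -> K' y.
Local Notation N := #|{: multi_index s q}|.
Local Notation dev := (@deviation R s phi q).
Hypothesis small : forall k l (j : 'I_N) e y, (size l <= k)%N -> window k e -> `|y - xs k| <= eta k ->
  `|leibniz (cutoff (xs k) (eta k)) (dev j e) l y| <= e ^+ q.

(** For a single window, which stays away from e = 0, boundedness is sufficient. *)
Lemma window_crude k l : exists M, forall (j : 'I_N) e y, unit_itv e -> window k e ->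
  `|y - xs k| <= eta k -> `|leibniz (cutoff (xs k) (eta k)) (dev j e) l y| <= M * e ^+ q.
Proof.
have [||A HA] := @lists_bound R s (fun l A => forall j e x, unit_itv e -> K' x -> `|dev j e l x| <= A) (size l).
- by move=> l' A A' H AA' j e x ue Kx; exact: le_trans (H j e x ue Kx) AA'.
- by move=> l'; exact: (deviation_bounded oO hphi q l' cK' K'O).
have [||B HB] := @lists_bound R s (fun l B => forall x, `|cutoff (xs k) (eta k) l x| <= B) (size l).
- by move=> l' B B' H BB' x; exact: le_trans (H x) BB'.
- by move=> l'; have [M _ HM] := cutoff_bound R l'; exists (M * (eta k)^-1 ^+ size l') => x; exact: HM.
have ek0 : 0 < (3 / 4 * eps k) ^+ q by rewrite exprn_gt0// mulr_gt0.
exists (2 ^+ size l * (`|B| * `|A|) / (3 / 4 * eps k) ^+ q) => j e y ue we yk.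
apply: (@le_trans _ _ (2 ^+ size l * (`|B| * `|A|))).
  apply: leibniz_bound => l' l'l.
    by apply: le_trans (ler_norm _); exact: HB.
  by apply: le_trans (ler_norm _); apply: HA => //; exact: cubeK yk.
rewrite mulrAC -mulrA ler_peMr ?mulr_ge0 ?exprn_ge0//.
rewrite ler_pdivlMr// mul1r; move: we; rewrite /window /= ltr_norml => /andP[? ?].
by apply: lerXn2r; rewrite ?nnegrE; have := eps0 k; lra.
Qed.

(** The windows of index at least the order of differentiation are covered by
[small], each of the finitely many others by [window_crude]. *)
Lemma localizer_deviation l : exists M, forall (j : 'I_N) e x, unit_itv e -> Omega x ->
  `|leibniz (localizer e) (dev j e) l x| <= M * e ^+ q.
Proof.
have [B HB] := @bump_derive_bounded R 0.
have [A HA] : exists M, forall (k : 'I_(size l)) (j : 'I_N) e y, unit_itv e -> window k e ->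
    `|y - xs k| <= eta k -> `|leibniz (cutoff (xs k) (eta k)) (dev j e) l y| <= M * e ^+ q.
  apply: (@ord_bound R (size l) (fun k M => forall (j : 'I_N) e y, unit_itv e -> window k e ->
    `|y - xs k| <= eta k -> `|leibniz (cutoff (xs k) (eta k)) (dev j e) l y| <= M * e ^+ q)).
    move=> k M M' H MM' j e y ue we yk; apply: le_trans (H j e y ue we yk) _.
    by have /andP[e0 _] := ue; rewrite ler_wpM2r// exprn_ge0// ltW.
  by move=> k; exact: window_crude.
exists (`|B| * (`|A| + 1)) => j e x ue Ox; have /andP[e0 e1] := ue.
have eq0 : 0 <= e ^+ q by rewrite exprn_ge0// ltW.
rewrite /localizer; set k := window_index e.
rewrite leibnizZ normrZ -mulrA; have [we|nw] := pselect (window k e); last first.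
  by rewrite window_bump0// normr0 mul0r !mulr_ge0// addr_ge0.
apply: ler_pM => //; first by apply: le_trans (HB _) (ler_norm _).
have [xk|xk] := leP `|x - xs k| (eta k); last first.
  by rewrite leibniz0 ?normr0 ?mulr_ge0 ?addr_ge0// => l'; rewrite cutoff0.
have [lk|kl] := leqP (size l) k.
  by apply: le_trans (small j lk we xk) _; rewrite ler_peMl// lerDr.
apply: le_trans (HA (Ordinal kl) j e x ue we xk) _.
by rewrite ler_wpM2r// (le_trans (ler_norm _))// lerDl.
Qed.

End Windows.

(** * Comparison of the two types *)

Section Globalization.
Variables (R : realType) (s : nat).
Local Notation E := 'rV[R]_s.
Local Notation C := (Rcomplex R).
Local Notation fn := (E -> C).
Local Notation D := (@test_functions R s setT).
Variables (Omega : set E) (phi : R -> E -> fn) (q : nat) (K : set E).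
Hypothesis oO : open Omega.
Hypothesis hphi : test_object Omega phi.
Hypothesis cK : compact K.
Hypothesis KO : K `<=` Omega.
Hypothesis phiK : type_Al K (q + 2) phi.
Local Notation N := #|{: multi_index s q}|.
Local Notation dev := (@deviation R s phi q).

Lemma moment_deviation (j : 'I_N) e x : unit_itv e -> Omega x ->
  moment (index_of j) (phi e x) = dev j e [::] x + (midx_deg (index_of j) == 0%N)%:R.
Proof.
move=> ue Ox; rewrite /deviation; case: (boolP (_ == 0%N)) => [/eqP j0|_]; last by rewrite addr0.
have -> : index_of j = (fun=> 0%N).
  apply/funext => i; apply/eqP; rewrite -leqn0 -j0 /midx_deg.
  by rewrite (bigD1 i)//= leq_addr.
by have [H _ _] := hphi; rewrite add0r moment0E; have [_ ->] := H e x ue Ox.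
Qed.

(** The deviation at (e, x) is the limit of the moments of phi e x - phi e' x' for
e' -> 0 and x' in K, so that it can be realized by test functions. *)
Lemma deviation_section : (forall d : R, 0 < d -> exists e x, 0 < e < d /\ K x) ->
  exists (r : nat) (g : 'I_r -> fn) (P : 'I_N -> 'I_r -> C), (forall i, D (g i)) /\
    forall e x, unit_itv e -> Omega x -> forall j : 'I_N,
    \sum_i (\sum_k dev k e [::] x * P k i) * moment (index_of j) (g i) = dev j e [::] x.
Proof.
move=> eK; have [r [g [P [Dg H]]]] := @values_section R s N (fun j => moment (index_of j)).
exists r, g, P; split=> // e x ue Ox; apply: (H (fun j => dev j e [::] x)) => a a0.
have [M HM] := deviation_small oO hphi KO phiK [::].
have M1 : 0 < `|M| + 1 by rewrite ltr_wpDl.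
have [|e' [x' [/andP[e'0]]]] := eK (Num.min 1 (Num.min (`|M| + 1)^-1 (a / (`|M| + 1)))).
  by rewrite !lt_min ltr01 invr_gt0 M1 divr_gt0.
rewrite !lt_min => /and3P[e'1 e'M e'a] Kx'.
have ue' : unit_itv e' by rewrite /unit_itv /= e'0 ltW.
have e'M1 : e' * M < 1.
  apply: (@le_lt_trans _ _ (e' * (`|M| + 1))).
    by rewrite ler_wpM2l ?(ltW e'0)// (le_trans (ler_norm _))// lerDl.
  by rewrite -ltr_pdivlMr// div1r.
exists (phi e x - phi e' x').
  by apply: test_functionB; [exact: (Phi_test oO hphi [::] ue Ox)|exact: (Phi_test oO hphi [::] ue' (KO Kx'))].
move=> j.
have [_ _ _ mB] := LF_continuous_functional_linear (@moment_LF_continuous R s (index_of j)).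
rewrite mB; [|exact: (Phi_test oO hphi [::] ue Ox)|exact: (Phi_test oO hphi [::] ue' (KO Kx'))].
rewrite (moment_deviation j ue Ox) (moment_deviation j ue' (KO Kx')).
set z := (_ == 0%N)%:R.
have -> : dev j e [::] x + z - (dev j e' [::] x' + z) - dev j e [::] x = - dev j e' [::] x' by ring.
rewrite normrN; apply: le_trans (HM j e' x' ue' e'M1 Kx') _.
apply: (@le_trans _ _ ((`|M| + 1) * e')).
  apply: (@le_trans _ _ ((`|M| + 1) * e' ^+ (q + 2))).
    by rewrite ler_wpM2r ?exprn_ge0 ?(ltW e'0)// (le_trans (ler_norm _))// lerDl.
  by rewrite ler_wpM2l ?(ltW M1)// addn2 exprS ler_piMr ?(ltW e'0)// exprn_ile1 ?ltW.
by rewrite mulrC -ler_pdivlMr// ltW.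
Qed.

(** The predicates bad n stand for the failure of an estimate with constant n. The
points of failure are chosen recursively, eps n being so small that the cut-off
deviation of index n is small and that the windows are disjoint. *)
Theorem globalization (bad : nat -> R -> E -> Prop) :
  (forall n d, 0 < d -> exists e x, [/\ 0 < e < d, K x & bad n e x]) ->
  exists psi, [/\ test_object Omega psi, type_Ag Omega q psi &
    forall n, exists e x, [/\ 0 < e < n.+1%:R^-1, K x, bad n e x &
      exists2 d, 0 < d & forall y, `|y - x| < d -> psi e y = phi e y]].
Proof.
move=> badK.
have [|r [g [P [Dg gP]]]] := deviation_section.
  by move=> d /(badK 0%N)[e [x [ed Kx _]]]; exists e, x.
have [rho rho0 [K' [cK' K'O KK']]] := compact_thicken cK oO KO.
have /choice[t Ht] : forall k, exists t : R, 0 < t /\ forall eps, 0 < eps < t ->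
    exists2 eta, 0 < eta <= rho & forall l (j : 'I_N) e x0 y, (size l <= k)%N ->
    `|e - eps| < eps / 4 -> K x0 -> `|y - x0| <= eta ->
    `|leibniz (cutoff x0 eta) (dev j e) l y| <= e ^+ q.
  by move=> k; have [t t0 H] := cutoff_deviation_small oO hphi KO phiK k rho0 cK' K'O KK'; exists t.
pose t' k := Num.min (t k) k.+1%:R^-1.
have t'0 k : 0 < t' k by rewrite lt_min (Ht k).1 invr_gt0 ltr0n.
have /choice[sel Hsel] : forall nd : nat * R, exists ex : R * E, 0 < nd.2 ->
    [/\ 0 < ex.1 < nd.2, K ex.2 & bad nd.1 ex.1 ex.2].
  move=> [n d]; have [/(badK n)[e [x H]]|d0] := boolP (0 < d); last by exists (0, 0).
  by exists (e, x).
pose ex := fix ex k := if k is m.+1 then sel (k, Num.min (t' k) ((ex m).1 / 8)) else sel (0%N, t' 0%N).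
have exP k : [/\ 0 < (ex k).1 < t' k, K (ex k).2 & bad k (ex k).1 (ex k).2] /\ (ex k.+1).1 < (ex k).1 / 8.
  have next m : 0 < (ex m).1 -> [/\ 0 < (ex m.+1).1 < Num.min (t' m.+1) ((ex m).1 / 8), K (ex m.+1).2 & bad m.+1 (ex m.+1).1 (ex m.+1).2].
    by move=> em; apply: (Hsel (m.+1, _)); rewrite /= lt_min t'0 divr_gt0.
  have H m : [/\ 0 < (ex m).1 < t' m, K (ex m).2 & bad m (ex m).1 (ex m).2].
    elim: m => [|m [/andP[em0 _] _ _]]; first exact: (Hsel (0%N, t' 0%N) (t'0 0%N)).
    have [/andP[e0]] := next m em0; rewrite lt_min => /andP[e1 _] Kx bx.
    by split=> //; rewrite e0.
  split=> //; have [/andP[em0 _] _ _] := H k.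
  by have [/andP[_]] := next k em0; rewrite lt_min => /andP[].
pose eps k := (ex k).1; pose xs k := (ex k).2.
have eps0 k : 0 < eps k by have [[/andP[]]] := exP k.
have epsS k : eps k.+1 < eps k / 8 by have [] := exP k.
have epsV k : eps k < k.+1%:R^-1.
  by have [[/andP[_]]] := exP k; rewrite lt_min => /andP[].
have Kxs k : K (xs k) by have [[]] := exP k.
have /choice[eta Heta] : forall k, exists eta, 0 < eta <= rho /\ forall l (j : 'I_N) e x0 y, (size l <= k)%N ->
    `|e - eps k| < eps k / 4 -> K x0 -> `|y - x0| <= eta ->
    `|leibniz (cutoff x0 eta) (dev j e) l y| <= e ^+ q.
  move=> k; have [_ H] := Ht k; have [|eta ? ?] := H (eps k); last by exists eta.
  by have [[/andP[e0]]] := exP k; rewrite lt_min -/(eps k) e0 => /andP[->].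
have eta0 k : 0 < eta k by have [/andP[]] := Heta k.
have cubeK k y : `|y - xs k| <= eta k -> K' y.
  by move=> yk; apply: KK' (Kxs k) _; apply: le_trans yk _; have [/andP[]] := Heta k.
pose Lam := localizer eps eta xs.
have jLam e : is_jet Omega (Lam e) by exact: localizer_jet.
have dLam l : exists M, forall (j : 'I_N) e x, unit_itv e -> Omega x ->
    `|leibniz (Lam e) (dev j e) l x| <= M * e ^+ q.
  apply: (localizer_deviation eps0 eta0 oO hphi cK' K'O cubeK) => k l' j e y lk we yk.
  exact: (Heta k).2 lk we (Kxs k) yk.
exists (corrected phi g P Lam); split.
- apply: (corrected_test_object oO hphi Dg gP jLam _ dLam) => e x es eI xs' _.
  exact: (@localizer_curve R s eps eta xs eps0 epsS epsV e x es eI xs').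
- exact: (corrected_type oO hphi Dg gP jLam dLam).
move=> n; exists (eps n), (xs n); have [[_ Kx bx] _] := exP n.
split=> //; first by rewrite eps0 epsV.
exists (eta n / 2); first by rewrite divr_gt0.
move=> y yn; apply: corrected_eq; apply: localizer1 => //; exact: ltW.
Qed.

End Globalization.

Section Transfer.
Variables (R : realType) (s : nat).
Local Notation E := 'rV[R]_s.
Local Notation C := (Rcomplex R).
Local Notation fn := (E -> C).

Lemma type_Ag_Al (Omega K : set E) q (phi : R -> E -> fn) : compact K -> K `<=` Omega ->
  type_Ag Omega q phi -> type_Al K q phi.
Proof. by move=> cK KO; exact. Qed.

Lemma not_sup_bigO (K : set E) (f : R -> E -> C) (b : R -> R) : ~ sup_bigO K f b ->
  forall M d : R, 0 < d -> exists e x, [/\ 0 < e < d, K x & M * b e < `|f e x|].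
Proof.
move=> nO M d d0; apply: contrapT => H; apply: nO; exists M; apply/at_right0P.
exists d => // e ed x Kx; rewrite leNgt; apply/negP => Hx; apply: H.
by exists e, x.
Qed.

(** The composite depends on the values of the test object only. *)
Lemma composite_local (F : fn -> E -> C) (phi psi : R -> E -> fn) e x d al : 0 < d ->
  (forall y, `|y - x| < d -> psi e y = phi e y) ->
  mpartial al (composite F psi e) x = mpartial al (composite F phi e) x.
Proof.
move=> d0 H; apply: (@nbhs_singleton E x (fun y => mpartial al (composite F psi e) y = mpartial al (composite F phi e) y)).
apply: partials_local; apply/nbhs_ballP; exists d => //= y.
rewrite mx_norm_ball /ball_ /= distrC => yx.
by rewrite /composite H.
Qed.

(** A failing estimate for a test object of local type would also fail for the test
object of global type that agrees with it at the points of failure. *)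
Lemma estimate_transfer (Omega K : set E) (F : fn -> E -> C) al q (b b' : R -> R) :
  open Omega -> compact K -> K `<=` Omega ->
  (forall e, unit_itv e -> 0 < b e <= b' e) ->
  (forall psi, test_object Omega psi -> type_Ag Omega q psi ->
    sup_bigO K (fun e => mpartial al (composite F psi e)) b) ->
  forall phi, test_object Omega phi -> type_Al K (q + 2) phi ->
    sup_bigO K (fun e => mpartial al (composite F phi e)) b'.
Proof.
move=> oO cK KO bb' Hb phi hphi phiK; apply: contrapT => /not_sup_bigO nO.
have [psi [hpsi psiA Hpsi]] := globalization oO hphi cK KO phiK (fun n => nO n%:R).
have [M /at_right0P[d d0 HM]] := Hb psi hpsi psiA.
have [n [Mn nd]] : exists n : nat, M <= n%:R /\ n.+1%:R^-1 < d.
  have [m _ Hm] := @near_infty_natSinv_lt R (PosNum d0).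
  have [m' Hm'] : exists m', M <= m'%:R.
    exists (Num.truncn `|M|).+1; apply/ltW/(le_lt_trans (ler_norm _)).
    by have /andP[] := Num.Theory.truncn_itv (normr_ge0 M).
  exists (maxn m m'); split; first by apply: le_trans Hm' _; rewrite ler_nat leq_maxr.
  by apply: Hm; exact: leq_maxl.
have [e [x [/andP[e0 en] Kx bad [d' d'0 Hd']]]] := Hpsi n.
have ue : unit_itv e.
  rewrite /unit_itv /= e0 (le_trans (ltW en))// invf_le1 ?ltr0n// ler1n//.
have ed : 0 < e < d by rewrite e0 (lt_trans en).
move: bad; rewrite -(composite_local F al d'0 Hd'); apply/negP; rewrite -leNgt.
apply: le_trans (HM e ed x Kx) _; have /andP[b0 b1] := bb' e ue.
apply: le_trans (ler_wpM2r (ltW b0) Mn) _.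
by rewrite ler_wpM2l.
Qed.

End Transfer.

Theorem corollary17p6 (R : realType) (s : nat) (Omega : set 'rV[R]_s)
    (F : ('rV[R]_s -> Rcomplex R) -> 'rV[R]_s -> Rcomplex R)
    (hOmega : open Omega) (hF : basic_space Omega F) :
  (moderate_Ag Omega F <-> moderate_Al Omega F) /\
  (negligible_Ag Omega F <-> negligible_Al Omega F).
Proof.
split; split=> H K cK KO al.
- have [N N1 HN] := H K cK KO al; exists (N + 2)%N; first by rewrite addn2.
  apply: (estimate_transfer hOmega cK KO _ HN) => e /andP[e0 e1].
  rewrite invr_gt0 exprn_gt0//= lef_pV2 ?posrE ?exprn_gt0//.
  by rewrite exprD ler_piMr ?exprn_ge0 ?exprn_ile1// ltW.
- have [N N1 HN] := H K cK KO al; exists N => // phi hphi phiA.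
  by apply: HN => //; exact: type_Ag_Al phiA.
- move=> n n1; have [q q1 Hq] := H K cK KO al n n1; exists (q + 2)%N; first by rewrite addn2.
  by apply: (estimate_transfer hOmega cK KO _ Hq) => e /andP[e0 e1]; rewrite exprn_gt0/=.
- move=> n n1; have [q q1 Hq] := H K cK KO al n n1; exists q => // phi hphi phiA.
  by apply: Hq => //; exact: type_Ag_Al phiA.
Qed.
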